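(* Let $G$ be an essentially 4-connected planar graph on $n$ vertices. Then $\operatorname{circ}(G) \geq \frac{3}{5}(n+2)$.
   Context: All graphs are finite and simple. The circumference $\operatorname{circ}(G)$ is the length of a longest cycle of $G$. A set $S\subseteq V(G)$ is an $s$-separator if $|S|=s$ and $G-S$ is disconnected. A 3-connected planar graph $G$ is called essentially 4-connected if for every 3-separator $S$ of $G$, at least one of the (two) components of $G-S$ consists of a single vertex. *)

(* Defs.v *)
From mathcomp Require Import all_boot.
Set Implicit Arguments. Unset Strict Implicit. Unset Printing Implicit Defensive.

Section Graphs.
Variable T : finType.
Implicit Types (e : rel T) (S : {set T}).

Definition simple_graph e : Prop := symmetric e /\ irreflexive e.

Definition del_rel e S : rel T :=
  [rel x y | [&& e x y, x \notin S & y \notin S]].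

(* G - S is connected (the empty graph counts as connected) *)
Definition connected_minus e S : Prop :=
  forall x y, x \notin S -> y \notin S -> connect (del_rel e S) x y.

Definition separator e S (s : nat) : Prop :=
  #|S| = s /\ ~ connected_minus e S.

Definition three_connected e : Prop :=
  3 < #|T| /\ forall S, #|S| < 3 -> connected_minus e S.

(* essentially 4-connected: 3-connected and for every 3-separator S some
   component of G - S is a single vertex x (x not in S, all neighbours in S) *)
Definition essentially_4_connected e : Prop :=
  three_connected e /\
  forall S, separator e S 3 ->
    exists x, x \notin S /\ forall y, e x y -> y \in S.

Definition darts e : {set T * T} := [set d | e d.1 d.2].

(* rho v is a cyclic permutation of the neighbourhood of v *)
Definition rotation_system e (rho : T -> T -> T) : Prop :=
  forall v,
    [/\ forall u, e v u -> e v (rho v u),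
        {in [pred u | e v u] &, injective (rho v)}
      & forall u w, e v u -> e v w -> fconnect (rho v) u w].

Definition face_perm e (rho : T -> T -> T) (d : T * T) : T * T :=
  if e d.1 d.2 then (d.2, rho d.2 d.1) else d.

Definition num_faces e rho : nat := fcard (face_perm e rho) (mem (darts e)).

Definition num_components e : nat := n_comp e (mem [set: T]).

Definition num_isolated e : nat := #|[set v | [forall u, ~~ e v u]]|.

(* planar: some rotation system has Euler characteristic 2 on every
   component, i.e. V - E + F + I = 2 C  (I = isolated vertices, C = components),
   written without subtraction using E = #darts / 2. *)
Definition planar e : Prop :=
  exists rho, rotation_system e rho /\
    2 * (#|T| + num_faces e rho + num_isolated e)
      = 4 * num_components e + #|darts e|.

Definition is_graph_cycle e (s : seq T) : bool :=
  [&& 2 < size s, uniq s & cycle e s].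

End Graphs.

(* Main.v *)
Require Import Defs.
From mathcomp Require Import all_boot all_order all_algebra zify.
Set Implicit Arguments. Unset Strict Implicit. Unset Printing Implicit Defensive.

(** Euler's formula says that, over 'F_2, every closed walk is the boundary of a set of faces.
This replaces the topology of the plane: it shows that disjoint walks inside a cycle do not
cross, and that K33 is not planar.

Take a vertex o of maximal degree. A Tutte path in G - o between two neighbours of o closes up,
through o, to a cycle of length at least 5 whose bridges have at most three attachments. By
3-connectivity, essential 4-connectivity and the non-planarity of K33, every such bridge is a
single cubic vertex, so the vertices off the cycle are independent and cubic.

Let C be a longest cycle with this property, of length c, and n0 the number of vertices off C.
Each of them is drawn on one of the two sides of C. Give every edge of C four units of charge and
split them between the sides. As C cannot be lengthened by a local detour, the charge can be
moved so that on each side every segment of C cut off by an outer vertex, with no further outer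
vertex behind it, holds at least 6 units. A side with m > 0 outer vertices has at least m + 2
such segments, so 4 c >= 6 n0 + 12, and n = c + n0 gives the bound. *)

(** A bridge of a path found in one piece of a disc may also touch what lies outside that piece, so
    a bound of three attachments alone does not survive an induction. [tutte_path] therefore bounds
    attachments plus touched labels: [r], [N2] and [N3] each stand for one attachment that a bridge
    may acquire outside the piece, and the non-crossing of the labels keeps a bridge from touching
    too many of them. Maximality is taken among the cycles of [oi3], because nothing is known about
    the complement of an arbitrary longest cycle. A detour must therefore leave only allowed
    vertices behind, which is why all detours but one revisit every vertex that they bypass. A
    vertex off the cycle is never adjacent to two consecutive vertices of it, as it could be
    inserted there, so a segment cut off by it has at least two edges. With two units on each side
    of an edge, a segment of three edges holds exactly six, one of two edges lacks two, and longer
    ones have some to spare; this fixes the size of the transfers. *)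

Section Connected.
Variables (T : finType) (e : rel T).
Implicit Types (A B K S : {set T}) (x y z : T) (p : seq T).

Definition rel_in A : rel T := [rel x y | [&& e x y, x \in A & y \in A]].

(** The empty set is connected in this sense, which is why later bounds over all connected [K] treat
    [set0] apart. *)
Definition conn A : Prop :=
  forall x y, x \in A -> y \in A -> connect (rel_in A) x y.

Definition component S x : {set T} := [set y in S | connect (rel_in S) x y].

Definition attached K (P : {set T}) : {set T} :=
  [set y in P | [exists x in K, e x y]].

Hypothesis esym : symmetric e.

Lemma rel_in_sym A : symmetric (rel_in A).
Proof. by move=> x y; rewrite /rel_in /= esym; congr (_ && _); rewrite andbC. Qed.

Lemma connect_in_sym A x y : connect (rel_in A) x y = connect (rel_in A) y x.
Proof. exact: (sym_connect_sym (rel_in_sym A)). Qed.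

Lemma sub_connect_in A B x y :
  A \subset B -> connect (rel_in A) x y -> connect (rel_in B) x y.
Proof.
move=> /subsetP sAB; apply: connect_sub => u v /and3P[euv uA vA].
by apply: connect1; rewrite /rel_in /= euv !sAB.
Qed.

Lemma path_in_sub A x p : x \in A -> path (rel_in A) x p ->
  path e x p /\ {subset x :: p <= A}.
Proof.
elim: p x => [|y p IHp] x xA /=; first by split=> // z; rewrite inE => /eqP->.
move=> /andP[/and3P[exy _ yA] /(IHp y yA)[pp sub]]; rewrite exy; split=> // z.
by rewrite inE => /predU1P[-> // | /sub].
Qed.

Lemma path_inE A x p : path e x p -> {subset x :: p <= A} -> path (rel_in A) x p.
Proof.
elim: p x => //= y p IHp x /andP[exy pp] sub.
rewrite /rel_in /= exy !sub ?inE ?eqxx ?orbT //=; apply: IHp => // z zp.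
by apply: sub; rewrite inE zp orbT.
Qed.

Lemma conn_path A x y : conn A -> x \in A -> y \in A ->
  exists p, [/\ path e x p, last x p = y, {subset x :: p <= A} & uniq (x :: p)].
Proof.
move=> cA xA yA; have /connectP[p pp ->] := cA x y xA yA.
case/shortenP: pp => q qq uq _; have [qe sub] := path_in_sub xA qq.
by exists q.
Qed.

Lemma conn_from A r : r \in A -> (forall x, x \in A -> connect (rel_in A) r x) -> conn A.
Proof.
move=> rA cr x y /cr rx /cr ry; apply: connect_trans ry.
by rewrite connect_in_sym.
Qed.

Lemma path_conn x p : path e x p -> conn [set z in x :: p].
Proof.
move=> pp; apply: (conn_from (r := x)) => [|y]; first by rewrite !inE eqxx.
rewrite inE => yp; case/splitPl: yp pp => p1 p2 <-; rewrite cat_path => /andP[p1p _].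
apply/connectP; exists p1 => //; apply: path_inE => // z.
by rewrite !inE mem_cat => /orP[->|->]; rewrite ?orbT.
Qed.

Lemma conn1 x : conn [set x].
Proof. by move=> y z /set1P-> /set1P->. Qed.

Lemma connU A B x y : conn A -> conn B -> x \in A -> y \in B ->
  (x == y) || e x y -> conn (A :|: B).
Proof.
move=> cA cB xA yB xy; apply: (conn_from (r := x)) => [|z]; first by rewrite inE xA.
have xyc : connect (rel_in (A :|: B)) x y.
  case/orP: xy => [/eqP-> // | exy].
  by apply: connect1; rewrite /rel_in /= exy !inE xA yB orbT.
case/setUP=> zAB; first by apply: sub_connect_in (cA _ _ xA zAB); apply: subsetUl.
by apply: connect_trans xyc (sub_connect_in _ (cB _ _ yB zAB)); apply: subsetUr.
Qed.

Lemma connU1 A x y : conn A -> x \in A -> e x y -> conn (y |: A).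
Proof.
by move=> cA xA exy; rewrite setUC; apply: connU (@conn1 y) xA (set11 y) _ => //; rewrite exy orbT.
Qed.

(** Induction on a connected set, used throughout in place of inductions on paths. *)
Lemma conn_sub_closed K (C : {set T}) x : conn K -> x \in K -> x \in C ->
  (forall y z, y \in K -> z \in K -> y \in C -> e y z -> z \in C) -> K \subset C.
Proof.
move=> cK xK xC cl; apply/subsetP => y yK; have /connectP[p] := cK x y xK yK.
elim: p x xK xC => [|z p IHp] x xK xC /=; first by move=> _ ->.
by move=> /andP[/and3P[exz _ zK] pp]; apply: IHp => //; apply: cl exz.
Qed.

Lemma component_id S x : x \in S -> x \in component S x.
Proof. by rewrite inE connect0 andbT. Qed.

Lemma component_sub S x : component S x \subset S.
Proof. by apply/subsetP => y; rewrite inE => /andP[]. Qed.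

Lemma component_closed S x y z :
  y \in component S x -> z \in S -> e y z -> z \in component S x.
Proof.
rewrite !inE => /andP[yS xy] zS eyz; rewrite zS (connect_trans xy) //.
by apply: connect1; rewrite /rel_in /= eyz yS.
Qed.

Lemma component_conn S x : x \in S -> conn (component S x).
Proof.
move=> xS; apply: (conn_from (component_id xS)) => y.
rewrite inE => /andP[_ /connectP[p pp ->]]; have [pe sub] := path_in_sub xS pp.
apply/connectP; exists p => //; apply: path_inE => // z zp.
rewrite inE sub //=; case/splitPl: zp pp => p1 p2 <-; rewrite cat_path => /andP[p1p _].
by apply/connectP; exists p1.
Qed.

Lemma component_max S x K y : conn K -> K \subset S -> y \in K ->
  y \in component S x -> K \subset component S x.
Proof.
move=> cK /subsetP KS yK yx; apply: (conn_sub_closed cK yK yx) => u v uK vK ux euv.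
by apply: component_closed euv => //; apply: KS.
Qed.

Lemma component_eq S x y : y \in component S x -> component S y = component S x.
Proof.
rewrite inE => /andP[yS xy]; apply/setP => z; rewrite !inE; congr (_ && _).
by apply: (same_connect _ _); [apply: connect_in_sym | rewrite connect_in_sym].
Qed.

Lemma attachedP K (P : {set T}) y :
  reflect (y \in P /\ exists2 x, x \in K & e x y) (y \in attached K P).
Proof.
rewrite inE; apply: (iffP andP) => [[yP /exists_inP[x xK exy]]|[yP [x xK exy]]].
  by split=> //; exists x.
by split=> //; apply/exists_inP; exists x.
Qed.

End Connected.

(** * Sets of faces and their boundaries *)

Section Exactness.
Import GRing.Theory.
Local Open Scope ring_scope.
Variable K : fieldType.

(** The kernel lies in the line of constant vectors, so the nullity is at most one. *)
Lemma rank_const_kernel m n (A : 'M[K]_(m, n)) :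
  (forall u : 'rV_m, u *m A = 0 -> forall i j, u 0 i = u 0 j) ->
  (m <= \rank A + 1)%N.
Proof.
move=> cst; rewrite -leq_subLR -mxrank_ker.
case: m A cst => [|m] A cst; first exact: leq_trans (rank_leq_row _) _.
have le1 : (kermx A <= (const_mx 1 : 'rV[K]_m.+1))%MS.
  apply/row_subP => i.
  have /cst eqi : row i (kermx A) *m A = 0 by rewrite -row_mul mulmx_ker row0.
  apply/sub_rVP; exists (row i (kermx A) 0 0).
  by apply/rowP => j; rewrite (eqi 0 j) !mxE mulr1.
exact: leq_trans (mxrankS le1) (rank_leq_row _).
Qed.

(** The rank bounds and the dimension count give the image of [A] at least the dimension of the
    kernel of [B], in which it is contained. *)
Lemma exact_sequence m n p (A : 'M[K]_(m, n)) (B : 'M[K]_(n, p)) :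
  A *m B = 0 -> (m <= \rank A + 1)%N -> (p <= \rank B + 1)%N ->
  (n + 2 <= m + p)%N ->
  forall z : 'rV_n, z *m B = 0 -> exists g : 'rV_m, z = g *m A.
Proof.
move=> AB0 rA rB dims z zB0; apply/submxP.
have sAk : (A <= kermx B)%MS by apply/sub_kermxP.
have [_ eqAk] := mxrank_leqif_eq sAk.
have /andP[_ kA] : (A == kermx B)%MS.
  rewrite -eqAk eqn_leq mxrankS // mxrank_ker.
  rewrite leq_subLR; move: (leq_trans dims (leq_add rA rB)).
  by rewrite addnACA leq_add2r addnC.
by apply: submx_trans kA; apply/sub_kermxP.
Qed.

End Exactness.

Section FaceFunctions.
Variables (T : finType) (e : rel T) (rho : T -> T -> T).

(* A set of faces: [f x y] says whether the face containing the dart [(x, y)] is selected. *)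
Definition face_fun (f : T -> T -> bool) : Prop :=
  forall x y, e x y -> f y (rho y x) = f x y.

(** The boundary operator over ['F_2]: the sum of the values on the two sides of an edge. *)
Definition bd (f : T -> T -> bool) : T -> T -> bool :=
  fun x y => f x y (+) f y x.

Definition degree_even (z : T -> T -> bool) : Prop :=
  forall x, \big[addb/false]_(y | e x y) z x y = false.

Hypotheses (esym : symmetric e) (eirr : irreflexive e).
Hypothesis erot : rotation_system e rho.

Lemma bd_sym f x y : bd f x y = bd f y x.
Proof. by rewrite /bd addbC. Qed.

Lemma big_rho R (idx : R) (op : Monoid.com_law idx) (f : T -> R) x :
  \big[op/idx]_(y | e x y) f (rho x y) = \big[op/idx]_(y | e x y) f y.
Proof.
have [rhoe rhoI _] := erot x.
(* Nothing is known of [rho x] off the neighbourhood, so it is replaced there by the identity to get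
   an injection of all of [T]. *)
pose h y := if e x y then rho x y else y.
have hI : injective h.
  move=> y z; rewrite /h; case: ifP => ey; case: ifP => ez //.
  - by apply: rhoI.
  - by move=> E; rewrite -E rhoe in ez.
  - by move=> E; rewrite E rhoe in ey.
rewrite [RHS](reindex_inj hI) /=; apply: eq_big => y.
  by rewrite /h; case: ifP => // /rhoe.
by rewrite /h => ->.
Qed.

(** The terms [f y x] equal [f x (rho x y)], a permutation of the terms [f x y], so the two halves
    of the sum cancel. *)
Lemma bd_even f : face_fun f -> degree_even (bd f).
Proof.
move=> ff x; rewrite /bd big_split /=.
rewrite [X in X (+) _](_ : _ = \big[addb/false]_(y | e x y) f y x) ?addbb //.
rewrite -(big_rho _ (f x)); apply: eq_bigr => y exy.
by rewrite ff // esym.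
Qed.

(** Turning about [x] passes from face to face across the edges at [x], and none of them changes the
    value. *)
Lemma face_fun_at f x : face_fun f ->
  (forall y, e x y -> ~~ bd f x y) ->
  forall y z, e x y -> e x z -> f x y = f x z.
Proof.
move=> ff b0 y z exy exz; have [rhoe _ rhoc] := erot x.
have /iter_findex <- := rhoc y z exy exz.
elim: (findex _ _ _) => [//|n IHn]; rewrite iterS.
have en : e x (iter n (rho x) y).
  by elim: n {IHn} => //= n; apply: rhoe.
rewrite ff 1?esym // IHn; move: (b0 _ en); rewrite /bd.
by case: (f x _); case: (f _ x).
Qed.

Hypothesis econ : forall x y, connect e x y.

(** Connectivity of the dual graph: the common value around a vertex is carried along a path to any
    other vertex. *)
Lemma face_fun_const f : face_fun f ->
  (forall x y, e x y -> ~~ bd f x y) ->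
  exists b, forall x y, e x y -> f x y = b.
Proof.
move=> ff b0; case: (pickP [pred d : T * T | e d.1 d.2]) => [[x0 y0] /= e0|no].
  exists (f x0 y0) => x y exy.
  have /connectP[p] := econ x0 x.
  elim: p x0 y0 e0 => [|z p IHp] x0 y0 e0 /=.
    by move=> _ Ex; rewrite -Ex in e0 *; apply: face_fun_at => // w /b0.
  move=> /andP[ez pz] Ex; have ez' : e z x0 by rewrite esym.
  rewrite (IHp z x0 ez' pz Ex).
  have -> : f z x0 = f x0 z.
    by move: (b0 _ _ ez); rewrite /bd; case: (f x0 z); case: (f z x0).
  by apply: face_fun_at => // w /b0.
by exists false => x y exy; move: (no (x, y)); rewrite /= exy.
Qed.

Lemma face_fun_add f g : face_fun f -> face_fun g ->
  face_fun (fun x y => f x y (+) g x y).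
Proof. by move=> ff gg x y exy; rewrite ff ?gg. Qed.

Lemma face_fun_and f g : face_fun f -> face_fun g ->
  face_fun (fun x y => f x y && g x y).
Proof. by move=> ff gg x y exy; rewrite ff ?gg. Qed.

Lemma face_fun_neg f : face_fun f -> face_fun (fun x y => ~~ f x y).
Proof. by move=> ff x y exy; rewrite ff. Qed.

Section Euler.
Hypothesis euler : 2 * (#|T| + num_faces e rho) = 4 + #|darts e|.

Let phi := face_perm e rho.
Let D := darts e.

Lemma face_perm_darts d : (phi d \in D) = (d \in D).
Proof.
rewrite /phi /face_perm !inE; case: ifP => //= ed.
by have [rhoe _ _] := erot d.2; rewrite rhoe // esym.
Qed.

Lemma face_perm_inj : injective phi.
Proof.
move=> d d' E; have := face_perm_darts d; have := face_perm_darts d'.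
rewrite E => ->; move: E; rewrite !inE /phi /face_perm.
case: ifP => ed; case: ifP => ed' // [E1 E2] _; apply/eqP.
have [_ rhoI _] := erot d.2.
move: ed ed' E2; case: d d' E1 rhoI => [a b] [c d] /= <- rhoI ed ed' E2.
by rewrite xpair_eqE eqxx andbT; apply/eqP/rhoI; rewrite ?inE 1?esym.
Qed.

(** A face is represented by the root of its orbit, an edge by its dart ascending in [enum_rank]. *)
Let Orb : {set T * T} := [set d | froots phi d & d \in D].
Let Ed : {set T * T} := [set d in D | enum_rank d.1 < enum_rank d.2].

Lemma card_darts : #|D| = 2 * #|Ed|.
Proof.
pose swap (d : T * T) := (d.2, d.1).
have swapI : injective swap by move=> [a b] [c d] [-> ->].
have -> : D = Ed :|: swap @: Ed.
  apply/setP=> [[a b]]; rewrite !inE /=; apply/idP/idP => [eab|].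
    rewrite eab /=; case: ltngtP => //= [lt_ba | /ord_inj/enum_rank_inj E].
      by apply/imsetP; exists (b, a); rewrite // !inE /= esym eab.
    by move: eab; rewrite E eirr.
  case/orP=> [/andP[]//|/imsetP[[c d]]]; rewrite !inE /= => /andP[ecd _] [-> ->].
  by rewrite esym.
rewrite cardsU card_imset // (_ : _ :&: _ = set0) ?cards0 ?subn0 ?mul2n ?addnn //.
apply/setP=> [[a b]]; rewrite !inE /=; apply/negP => /andP[/andP[_ lt_ab]].
move=> /imsetP[[c d]]; rewrite !inE /= => /andP[_ lt_cd] [E1 E2].
by move: lt_ab; rewrite E1 E2 ltnNge ltnW.
Qed.

Import GRing.Theory.
Local Open Scope ring_scope.

(** An edge has one representing dart, while the neighbours of [v] see both orientations; the two
    incidence indicators pick out the two kinds of neighbours. *)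
Lemma sum_edges_at (G : T -> T -> 'F_2) v : (forall x y, G x y = G y x) ->
  \sum_(d in Ed) G d.1 d.2 * ((v == d.1)%:R + (v == d.2)%:R)
  = \sum_(u | e v u) G v u.
Proof.
move=> Gsym.
under eq_bigr do rewrite mulrDr !mulr_natr !mulrb.
rewrite big_split /= -!big_mkcondr /=.
rewrite [RHS](bigID (fun u => (enum_rank v < enum_rank u)%N)) /=.
congr (_ + _).
  rewrite (reindex_onto (fun u => (v, u)) snd) /=; last first.
    by move=> [a b] /= /andP[_ /eqP->].
  by apply: eq_bigl => u; rewrite !inE /= !eqxx !andbT.
rewrite (reindex_onto (fun u => (u, v)) fst) /=; last first.
  by move=> [a b] /= /andP[_ /eqP->].
apply: eq_big => [u|u _]; last by rewrite Gsym.
rewrite !inE /= !eqxx !andbT esym; apply/andP/andP => -[evu].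
  by move=> ltuv; rewrite evu -leqNgt ltnW.
rewrite -leqNgt leq_eqVlt => /orP[/eqP/ord_inj/enum_rank_inj E|]; last by [].
by move: evu; rewrite E eirr.
Qed.

Let rt d := froot phi d.

Lemma root_face x y : e x y -> rt (y, rho y x) = rt (x, y).
Proof.
move=> exy; apply/eqP; rewrite eq_sym root_connect; last first.
  exact: fconnect_sym face_perm_inj.
by have := fconnect1 phi (x, y); rewrite {2}/phi /face_perm /= exy.
Qed.

Lemma F2_inj (a b : 'F_2) : (a != 0) = (b != 0) -> a = b.
Proof. by case: a => [[|[|a]]] // ia; case: b => [[|[|b]]] // ib _; apply/val_inj. Qed.

Lemma F2_add0 (a b : 'F_2) : a + b = 0 -> a = b.
Proof. by move/eqP; rewrite addr_eq0 oppr_pchar2 ?pchar_Fp // => /eqP. Qed.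

Lemma F2_addb (a b : bool) : ((a (+) b)%:R : 'F_2) = a%:R + b%:R.
Proof. by case: a; case: b; apply/val_inj. Qed.

Lemma F2_neq0 (a b : 'F_2) (c : bool) : c%:R = a + b -> (a != 0) (+) (b != 0) = c.
Proof.
by move: a b => [[|[|a]]] // ia [[|[|b]]] // ib; case: c => /(congr1 val).
Qed.

(* Exactness of faces -> edges -> vertices over 'F_2: a boundary operator with one-dimensional
   kernel, so Euler's formula leaves room for nothing but boundaries among the even edge sets. *)
Lemma even_is_boundary z : (forall x y, z x y = z y x) -> degree_even z ->
  exists2 f, face_fun f & forall x y, e x y -> bd f x y = z x y.
Proof.
move=> zsym zev.
pose val (g : 'rV['F_2]_#|Orb|) x y : 'F_2 :=
  \sum_(i < #|Orb|) g 0 i * (rt (x, y) == enum_val i)%:R.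
pose A : 'M['F_2]_(#|Orb|, #|Ed|) := \matrix_(i, j)
   ((rt ((enum_val j).1, (enum_val j).2) == enum_val i)%:R
    + (rt ((enum_val j).2, (enum_val j).1) == enum_val i)%:R).
pose B : 'M['F_2]_(#|Ed|, #|T|) := \matrix_(j, k)
   ((enum_val k == (enum_val j).1)%:R + (enum_val k == (enum_val j).2)%:R).
have gA g j : (g *m A) 0 j = val g (enum_val j).1 (enum_val j).2
                             + val g (enum_val j).2 (enum_val j).1.
  rewrite mxE -big_split /=; apply: eq_bigr => i _.
  by rewrite mxE mulrDr.
have val_face g x y : e x y -> val g y (rho y x) = val g x y.
  by move=> exy; apply: eq_bigr => i _; rewrite root_face.
have edge x y : e x y -> exists j : 'I_#|Ed|,
    enum_val j = (x, y) \/ enum_val j = (y, x).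
  move=> exy; have [lt|lt|E] := ltngtP (enum_rank x) (enum_rank y).
  - have xyE : (x, y) \in Ed by rewrite !inE /= exy.
    by exists (enum_rank_in xyE (x, y)); left; rewrite enum_rankK_in.
  - have xyE : (y, x) \in Ed by rewrite !inE /= esym exy.
    by exists (enum_rank_in xyE (y, x)); right; rewrite enum_rankK_in.
  - by move: exy; rewrite (enum_rank_inj (ord_inj E)) eirr.
(* The argument of [bd_even] on matrix entries. *)
have AB0 : A *m B = 0.
  apply/matrixP => i k; rewrite !mxE.
  pose h x y : 'F_2 := (rt (x, y) == enum_val i)%:R.
  transitivity (\sum_(d in Ed) (h d.1 d.2 + h d.2 d.1)
       * ((enum_val k == d.1)%:R + (enum_val k == d.2)%:R)).
    by rewrite [RHS]big_enum_val; apply: eq_bigr => j _; rewrite !mxE.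
  rewrite (sum_edges_at (G := fun x y => h x y + h y x)); last first.
    by move=> x y; rewrite addrC.
  rewrite big_split /=.
  rewrite [X in _ + X](_ : _ = \sum_(u | e (enum_val k) u) h (enum_val k) u).
    by rewrite addrr_pchar2 ?pchar_Fp.
  rewrite -(big_rho _ (h (enum_val k))); apply: eq_bigr => u eku.
  by rewrite /h root_face // esym.
have rA : (#|Orb| <= \rank A + 1)%N.
  apply: rank_const_kernel => u uA0 i j.
  have [|x y exy|b fb] := @face_fun_const (fun x y => val u x y != 0).
  - by move=> x y exy; rewrite val_face.
  - have [k Ek] := edge x y exy; have := Logic.eq_sym (gA u k); rewrite uA0 mxE /bd.
    by case: Ek => -> /= H; rewrite (F2_add0 H) addbb.
  have val_enum k : val u (enum_val k).1 (enum_val k).2 = u 0 k.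
    have rtk : rt (enum_val k) = enum_val k.
      by have := enum_valP k; rewrite inE => /andP[/eqP].
    rewrite /val (bigD1 k) //= -surjective_pairing rtk eqxx mulr1 big1 ?addr0 // => l lk.
    by rewrite (inj_eq enum_val_inj) eq_sym (negbTE lk) mulr0.
  have ek (k : 'I_#|Orb|) : e (enum_val k).1 (enum_val k).2.
    by have := enum_valP k; rewrite !inE => /andP[].
  by apply: F2_inj; rewrite -!val_enum !fb.
(* The kernel of the transpose consists of the functions on vertices that agree along every edge;
   these are constant by connectivity. *)
have rB : (#|T| <= \rank B + 1)%N.
  rewrite -mxrank_tr; apply: rank_const_kernel => u uB0.
  have uE x y : e x y -> u 0 (enum_rank x) = u 0 (enum_rank y).
    move=> exy; have [k Ek] := edge x y exy.
    have : (u *m B^T) 0 k = 0 by rewrite uB0 mxE.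
    rewrite mxE; under eq_bigr do rewrite !mxE mulrDr.
    rewrite big_split /= => /F2_add0.
    have pick w : \sum_(l < #|T|) u 0 l * (enum_val l == w)%:R = u 0 (enum_rank w).
      rewrite (bigD1 (enum_rank w)) //= enum_rankK eqxx mulr1 big1 ?addr0 // => l.
      by rewrite -(inj_eq enum_val_inj) enum_rankK => /negbTE->; rewrite mulr0.
    by rewrite !pick; case: Ek => -> /=.
  have uC x y : u 0 (enum_rank x) = u 0 (enum_rank y).
    have /connectP[p] := econ x y.
    by elim: p x => [|w p IHp] x /= => [_ -> //|/andP[/uE -> /IHp IH] /IH].
  by move=> i j; rewrite -(enum_valK i) -(enum_valK j).
(* The only place where Euler's formula enters. *)
have dims : (#|Ed| + 2 <= #|Orb| + #|T|)%N.
  have -> : #|Orb| = num_faces e rho by apply: eq_card => d; rewrite !inE.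
  by rewrite -(leq_pmul2l (isT : 0 < 2)%N) mulnDr -card_darts [(_ + #|T|)%N]addnC euler addnC.
have [|g Eg] := exact_sequence AB0 rA rB dims (z := \row_j (z (enum_val j).1 (enum_val j).2)%:R).
  apply/rowP => k; rewrite !mxE.
  transitivity (\sum_(d in Ed) (z d.1 d.2)%:R
       * ((enum_val k == d.1)%:R + (enum_val k == d.2)%:R) : 'F_2).
    by rewrite [RHS]big_enum_val; apply: eq_bigr => j _; rewrite !mxE.
  rewrite (sum_edges_at (G := fun x y => (z x y)%:R)); last by move=> x y; rewrite zsym.
  have := zev (enum_val k); move/(congr1 (fun b : bool => b%:R : 'F_2)).
  by rewrite (big_morph _ F2_addb (erefl : false%:R = 0)).
exists (fun x y => val g x y != 0) => [x y exy|x y exy]; first by rewrite val_face.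
have [k Ek] := edge x y exy; move/rowP/(_ k): Eg; rewrite gA mxE.
rewrite /bd; case: Ek => -> /= H; first by rewrite (F2_neq0 H).
by rewrite addbC (F2_neq0 H) zsym.
Qed.

End Euler.
End FaceFunctions.

(** * Walks as edge sets over ['F_2] *)

Section WalkParity.
Variable T : finType.
Implicit Types (x y a b : T) (p q : seq T).

Definition same_edge x y a b : bool :=
  (a == x) && (b == y) || (a == y) && (b == x).

Fixpoint wpar x p a b : bool :=
  if p is y :: p' then same_edge x y a b (+) wpar y p' a b else false.

Lemma wpar_sym x p a b : wpar x p a b = wpar x p b a.
Proof.
elim: p x => //= y p IHp x; rewrite IHp /same_edge.
by rewrite orbC andbC [(b == y) && _]andbC.
Qed.

Lemma wpar_cat x p q a b :
  wpar x (p ++ q) a b = wpar x p a b (+) wpar (last x p) q a b.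
Proof. by elim: p x => //= y p IHp x; rewrite IHp addbA. Qed.

Lemma wpar_rcons x p y a b :
  wpar x (rcons p y) a b = wpar x p a b (+) same_edge (last x p) y a b.
Proof. by rewrite -cats1 wpar_cat /= addbF. Qed.

Lemma wpar_rev x p a b :
  wpar (last x p) (rev (belast x p)) a b = wpar x p a b.
Proof.
elim: p x => //= y p IHp x; rewrite rev_cons wpar_rcons IHp.
rewrite addbC; congr (_ (+) _); rewrite /same_edge orbC.
case: p {IHp} => //= z p; rewrite rev_cons last_rcons; done.
Qed.

Lemma wpar_mem x p a b : wpar x p a b -> (a \in x :: p) && (b \in x :: p).
Proof.
elim: p x => //= y p IHp x.
have [/IHp /andP[ap bp] _|_] := boolP (wpar y p a b).
  by rewrite !(in_cons x) ap bp !orbT.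
by rewrite addbF /same_edge !inE => /orP[]/andP[-> ->]; rewrite ?orbT.
Qed.

Lemma wpar_notin x p a b : a \notin x :: p -> wpar x p a b = false.
Proof. by apply: contraNF => /wpar_mem/andP[]. Qed.

Variables (e : rel T).
Hypotheses (esym : symmetric e) (eirr : irreflexive e).

(** A passage through [a] uses two edges at [a], so only the ends of the walk contribute. *)
Lemma wpar_degree x p a : path e x p ->
  \big[addb/false]_(b | e a b) wpar x p a b = (a == x) (+) (a == last x p).
Proof.
elim: p x => [|y p IHp] x /=; first by rewrite big1 // addbb.
move=> /andP[exy pp]; rewrite big_split /= IHp //.
rewrite addbA; congr (_ (+) _); rewrite /same_edge.
have nxy : x != y by apply: contraTneq exy => ->; rewrite eirr.
have [->|nax] := eqVneq a x.
  rewrite (negbTE nxy) (bigD1 y) //= eqxx /= big1 // => b /andP[_ /negbTE->].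
  by [].
have [->|nay] := eqVneq a y; last by rewrite big1.
rewrite (bigD1 x) 1?esym //= eqxx /= big1 ?addbF // => b /andP[_ /negbTE->].
by [].
Qed.

Lemma closed_walk_even x p : path e x p -> last x p = x -> degree_even e (wpar x p).
Proof. by move=> pp lp a; rewrite wpar_degree // lp addbb. Qed.

End WalkParity.

(** From here on Euler's formula is used through [pg_fill] alone. *)
Record plane_graph (T : finType) (e : rel T) (rho : T -> T -> T) : Prop :=
  PlaneGraph {
    pg_sym : symmetric e;
    pg_irr : irreflexive e;
    pg_rot : rotation_system e rho;
    pg_con : forall x y, connect e x y;
    pg_fill : forall x p, path e x p -> last x p = x ->
      exists2 f, face_fun e rho f &
        forall a b, e a b -> bd f a b = wpar x p a b }.

Lemma euler_plane_graph (T : finType) (e : rel T) (rho : T -> T -> T) :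
  simple_graph e -> rotation_system e rho -> (forall x y, connect e x y) ->
  2 * (#|T| + num_faces e rho) = 4 + #|darts e| -> plane_graph e rho.
Proof.
move=> [esym eirr] erot econ euler; split=> // x p pp lp.
apply: even_is_boundary => // [a b|]; first exact: wpar_sym.
exact: closed_walk_even pp lp.
Qed.

(** * Crossing walks and K33 *)

Section CycleParity.
Variable T : finType.
Implicit Types (a b x y z : T) (X p q : seq T).

(** On a simple cycle of length at least three this is the indicator of its edges. *)
Definition cpar X a b : bool :=
  if X is x :: p then wpar x (rcons p x) a b else false.

Lemma cpar_sym X a b : cpar X a b = cpar X b a.
Proof. by case: X => //= x p; rewrite wpar_sym. Qed.

Lemma cpar_catC p q a b : cpar (p ++ q) a b = cpar (q ++ p) a b.
Proof.
case: p q => [|x p] [|y q]; rewrite ?cats0 //=.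
rewrite !rcons_cat /= !wpar_cat /= !wpar_rcons.
move: (wpar x _ _ _) (wpar y _ _ _) (same_edge _ y _ _) (same_edge _ x _ _).
by do 4!case.
Qed.

Lemma cpar_rot n X a b : cpar (rot n X) a b = cpar X a b.
Proof. by rewrite /rot cpar_catC cat_take_drop. Qed.

Lemma cpar_mem X a b : cpar X a b -> (a \in X) && (b \in X).
Proof.
case: X => //= x p /wpar_mem; rewrite !in_cons !mem_rcons !in_cons.
by rewrite !orbA !orbb.
Qed.

Lemma cpar_head a b p z : uniq (a :: b :: p) -> p != [::] ->
  cpar (a :: b :: p) a z = (z == b) || (z == last b p).
Proof.
move=> /= /andP[ap /andP[bp up]] p0.
rewrite wpar_rcons wpar_notin // /same_edge eqxx /=.
have nal : a != last b p by apply: contraNneq ap => ->; rewrite mem_last.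
have nab : a != b by apply: contraNneq ap => ->; rewrite mem_head.
rewrite (negbTE nab) (negbTE nal) /= ?orbF ?andbT.
have nbl : b != last b p.
  by case: p p0 {ap up nal} bp => //= y p _; apply: contraNneq => ->; rewrite mem_last.
by case: eqVneq => [->|] //=; rewrite (negbTE nbl).
Qed.

Lemma cpar_next X a : uniq X -> 2 < size X -> a \in X -> cpar X a (next X a).
Proof.
move=> uX sX aX; have [i [|b p] E] := rot_to aX.
  by move: sX; rewrite -(size_rot i) E.
have uE : uniq (a :: b :: p) by rewrite -E rot_uniq.
have nE : next (a :: b :: p) a = b by rewrite /= eqxx.
rewrite -(cpar_rot i) -(next_rot i uX) E nE cpar_head ?eqxx //.
by apply: contraTneq sX => p0; rewrite -(size_rot i) E p0.
Qed.

End CycleParity.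

Section Crossing.
Variables (T : finType) (e : rel T) (rho : T -> T -> T).
Hypothesis G : plane_graph e rho.
Local Notation face := (face_fun e rho).
Let esym := pg_sym G.
Let eirr := pg_irr G.

(** The edges of the closed disc, the bounding cycle included. *)
Definition inside (f : T -> T -> bool) : rel T :=
  [rel x y | e x y && (f x y || f y x)].

(** The complement of [f] satisfies this as well; which side is meant is settled by
    normalisation. *)
Definition is_bd (f : T -> T -> bool) (X : seq T) : Prop :=
  face f /\ forall a b, e a b -> bd f a b = cpar X a b.

Lemma cycle_bd X : cycle e X -> exists f, is_bd f X.
Proof.
case: X => [_|x p] /=; first by exists (fun _ _ => false); split.
by move=> pp; have [|f ff fE] := pg_fill G pp; [rewrite last_rcons | exists f].
Qed.

(** At a vertex of [X] the boundary of [h] has even degree and can use only two edges, so it uses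
    both or none; the choice propagates around the cycle. *)
Lemma cycle_simple X h : is_graph_cycle e X -> face h ->
  (forall a b, e a b -> bd h a b -> cpar X a b) ->
  (forall a b, e a b -> bd h a b = false) \/
  (forall a b, e a b -> bd h a b = cpar X a b).
Proof.
move=> /and3P[sX uX cX] fh hX.
have loc a b c : e a b -> e a c -> cpar X a b -> cpar X a c -> bd h a b = bd h a c.
  move=> eab eac Xab Xac; have [->//|nbc] := eqVneq b c.
  have := bd_even esym (pg_rot G) fh a.
  rewrite (bigD1 b) //= (bigD1 c) 1?eq_sym ?eac //= big1 ?addbF.
    by case: (bd h a b); case: (bd h a c).
  move=> z /andP[/andP[eaz nzb] nzc]; apply: contraTF isT => /(hX _ _ eaz).
  have aX : a \in X by case/andP: (cpar_mem Xab).
  have [i [|y p] E] := rot_to aX.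
    by move: sX; rewrite -(size_rot i) E.
  have uE : uniq (a :: y :: p) by rewrite -E rot_uniq.
  have p0 : p != [::] by apply: contraTneq sX => p0; rewrite -(size_rot i) E p0.
  move: Xab Xac nbc nzb nzc; rewrite -!(cpar_rot i X) E !cpar_head //.
  by move=> /orP[]/eqP-> /orP[]/eqP->; rewrite ?eqxx // => _ /negbTE-> /negbTE->.
pose v a := bd h a (next X a).
have vloc a b : e a b -> cpar X a b -> bd h a b = v a.
  move=> eab Xab; have /andP[aX _] := cpar_mem Xab.
  by apply: loc => //; [apply: next_cycle | apply: cpar_next].
have vnext a : a \in X -> v (next X a) = v a.
  move=> aX; rewrite /v [RHS]bd_sym [RHS]vloc //.
    by rewrite esym; apply: next_cycle.
  by rewrite cpar_sym; apply: cpar_next.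
have vconst a b : a \in X -> b \in X -> v a = v b.
  move=> aX; rewrite -(fconnect_cycle (cycle_next uX) aX) => /iter_findex <-.
  elim: (findex _ _ _) => //= n ->; rewrite vnext //.
  by elim: n => //= n; rewrite mem_next.
have [x0 x0X] : exists x0, x0 \in X.
  by case: (X) sX => // x0 X' _; exists x0; rewrite mem_head.
case E: (v x0); [right | left] => a b eab.
  apply/idP/idP => [|Xab]; first exact: hX.
  by rewrite vloc // (vconst a x0) //; case/andP: (cpar_mem Xab).
apply: contraFF E => hab; have Xab := hX _ _ eab hab.
by rewrite (vconst x0 a) -?(vloc a b) //; case/andP: (cpar_mem Xab).
Qed.

(** The part of [g] outside [f] has its boundary on [X] alone, so by [cycle_simple] it is nothing or
    everything outside [f]. *)
Lemma below_simple X f g : is_graph_cycle e X -> is_bd f X -> face g ->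
  (forall a b, e a b -> bd g a b -> inside f a b || cpar X a b) ->
  exists c, forall a b, e a b -> ~~ f a b -> g a b = c.
Proof.
move=> cyX [ff fE] fg gX; have econ := pg_con G.
have fnf : face (fun x y => ~~ f x y) by apply: face_fun_neg.
pose h := fun x y => g x y && ~~ f x y.
have fh : face h by apply: face_fun_and.
have [a b eab|h0|h1] := cycle_simple cyX fh.
- rewrite -fE //; apply: contraLR; rewrite /bd /h => nfab.
  have := gX a b eab; rewrite -fE // /bd (negbTE nfab) orbF /inside /= eab /=.
  move: nfab; case: (f a b); case: (f b a); rewrite ?andbF //= !andbT => _.
  by case: (_ (+) _) => // /(_ isT).
- have [|c hc] := face_fun_const esym (pg_rot G) econ fh.
    by move=> a b eab; rewrite h0.
  by exists c => a b eab nf; rewrite -(hc a b eab) /h nf andbT.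
- have [|c hc] := face_fun_const esym (pg_rot G) econ (face_fun_add fh ff).
    move=> a b eab; move: (h1 a b eab); rewrite -fE // /bd.
    by case: (h a b); case: (h b a); case: (f a b); case: (f b a).
  exists c => a b eab nf; rewrite -(hc a b eab) /h (negbTE nf) andbT addbF //.
Qed.

Lemma bd_at_cycle X f z : is_graph_cycle e X -> is_bd f X -> z \in X ->
  exists y, [/\ e z y, cpar X z y & f z y != f y z].
Proof.
move=> /and3P[sX uX cX] [_ fE] zX; exists (next X z).
have ez := next_cycle cX zX; have Xz := cpar_next uX sX zX.
by split=> //; move: (fE _ _ ez); rewrite Xz /bd; case: (f z _); case: (f _ z).
Qed.

(** An edge of [X] at [z] has a side outside [f], where [g] vanishes, and the value of [g] does not
    change around [z]. *)
Lemma below_at_cycle X f g z : is_graph_cycle e X -> is_bd f X -> face g ->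
  (forall a b, e a b -> g a b -> f a b) -> z \in X ->
  (forall b, e z b -> ~~ bd g z b) -> forall b, e z b -> g z b = false.
Proof.
move=> cyX fX fg gf zX g0 b ezb; have [y [ezy _ fzy]] := bd_at_cycle cyX fX zX.
rewrite (face_fun_at esym (pg_rot G) fg g0 ezb ezy).
have := g0 _ ezy; rewrite /bd; have := gf z y ezy; have := gf y z.
rewrite esym ezy => /(_ isT); move: fzy.
by case: (f z y); case: (f y z); case: (g z y); case: (g y z) => //= _ H1 H2 _;
  (discriminate (H1 isT) || discriminate (H2 isT)).
Qed.

Lemma inside_sym f : symmetric (inside f).
Proof. by move=> x y; rewrite /inside /= esym orbC. Qed.

Lemma inside_path f x p : path (inside f) x p -> path e x p.
Proof. by apply: sub_path => u v /andP[]. Qed.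

Lemma wpar_rel (r : rel T) x p a b : symmetric r -> path r x p ->
  wpar x p a b -> r a b.
Proof.
move=> rs; elim: p x => //= u p IHp v /andP[vu ru].
have [/(IHp _ ru)//|_] := boolP (wpar u p a b); rewrite addbF /same_edge.
by case/orP=> /andP[/eqP-> /eqP->]; rewrite // rs.
Qed.

Lemma cycle_inside X f : is_graph_cycle e X -> is_bd f X -> cycle (inside f) X.
Proof.
move=> cyX [_ fE]; have /and3P[sX uX cX] := cyX.
apply: (sub_in_cycle (P := mem X) (e := frel (next X))); last 2 first.
- exact/allP.
- exact: cycle_next.
move=> x y xX _ /eqP<-; have ex := next_cycle cX xX.
have := fE _ _ ex; rewrite cpar_next // /bd /inside /= ex.
by case: (f x _) => //= ->.
Qed.

Lemma cycle_cpar X : is_graph_cycle e X -> cycle (cpar X) X.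
Proof.
move=> /and3P[sX uX cX].
apply: (sub_in_cycle (P := mem X) (e := frel (next X))); last 2 first.
- exact/allP.
- exact: cycle_next.
by move=> x y xX _ /eqP<-; apply: cpar_next.
Qed.

(** Sets of faces with a given boundary come in complementary pairs; the member that vanishes
    outside [f] is chosen. *)
Lemma below_normalize X f g : is_graph_cycle e X -> is_bd f X -> face g ->
  (forall a b, e a b -> bd g a b -> inside f a b || cpar X a b) ->
  exists g', [/\ face g', forall a b, bd g' a b = bd g a b
    & forall a b, e a b -> g' a b -> f a b].
Proof.
move=> cyX fX fg gX; have [c gc] := below_simple cyX fX fg gX.
exists (fun x y => g x y (+) c); split.
- by move=> x y exy; rewrite fg.
- by move=> x y; rewrite /bd addbACA addbb addbF.
- by move=> x y exy; apply: contraTT => /(gc _ _ exy) ->; rewrite addbb.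
Qed.

(** The path [p] cuts the disc into [g1], bounded by [p] and [w1], and [g2], bounded by [p] and
    [w2]. The path [q] starts on [w1], away from [g2], and never meets [p], so it cannot get to [d]
    on [w2]. *)
Lemma noncross_head X f a b c d Y1 Y2 Y3 Y4 p q :
  is_graph_cycle e X -> is_bd f X ->
  X = a :: Y1 ++ b :: Y2 ++ c :: Y3 ++ d :: Y4 ->
  path (inside f) a p -> last a p = c ->
  path (inside f) b q -> last b q = d ->
  (forall z, z \in a :: p -> z \notin b :: q) -> False.
Proof.
move=> cyX fX EX pp lp pq lq pqD; have [ff fE] := fX.
have /and3P[sX uX cX] := cyX.
pose w1 := Y1 ++ b :: Y2 ++ [:: c]; pose w2 := Y3 ++ d :: Y4 ++ [:: a].
have EXa : rcons (Y1 ++ b :: Y2 ++ c :: Y3 ++ d :: Y4) a = w1 ++ w2.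
  by rewrite -cats1 /w1 /w2 -!catA /= -!catA /= -!catA.
have lw1 : last a w1 = c by rewrite last_cat /= last_cat.
have cparE x y : cpar X x y = wpar a w1 x y (+) wpar c w2 x y.
  by rewrite EX /cpar EXa wpar_cat lw1.
have pX : path (inside f) c w2.
  by have := cycle_inside cyX fX; rewrite EX /= EXa cat_path lw1 => /andP[].
have aNp z : z \in b :: q -> (z != a) && (z != c).
  move=> zq; rewrite -lp; apply/andP; split; apply: contraTneq zq => ->.
    by apply: pqD; rewrite mem_head.
  by apply: pqD; rewrite mem_last.
have w12 z : z \in b :: q -> z \in c :: w2 -> z \notin a :: w1.
  move=> zq; have /andP[za zc] := aNp z zq.
  move: uX; rewrite EX.
  have -> : a :: Y1 ++ b :: Y2 ++ c :: Y3 ++ d :: Y4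
       = (a :: w1) ++ (Y3 ++ d :: Y4).
    by rewrite /w1 /= -!catA /= -!catA.
  rewrite cat_uniq => /and3P[_ /hasPn disj _] zw2.
  apply: disj; move: zw2; rewrite /w2 in_cons (negbTE zc) -cat_cons catA.
  by rewrite mem_cat [_ \in [:: a]]inE (negbTE za) orbF.
have [||g fg gE] := pg_fill G (x := a) (p := p ++ w2).
- by rewrite cat_path !(inside_path (f := f)) //= lp.
- by rewrite last_cat lp /w2 last_cat /= last_cat.
have {}gE x y : e x y -> bd g x y = wpar a p x y (+) wpar c w2 x y.
  by move=> /gE ->; rewrite wpar_cat lp.
have [x y exy|g2 [fg2 g2E g2f]] := below_normalize cyX fX fg.
  rewrite gE // => H; apply/orP; left.
  have [/(wpar_rel (inside_sym f) pp)//|/negbTE np] := boolP (wpar a p x y).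
  by move: H; rewrite np => /(wpar_rel (inside_sym f) pX).
have {}g2E x y : e x y -> bd g2 x y = wpar a p x y (+) wpar c w2 x y.
  by move=> exy; rewrite g2E gE.
pose g1 x y := f x y (+) g2 x y.
have fg1 : face g1 by apply: face_fun_add.
have g1E x y : e x y -> bd g1 x y = wpar a p x y (+) wpar a w1 x y.
  move=> exy; have -> : bd g1 x y = bd f x y (+) bd g2 x y.
    by rewrite /g1 /bd addbACA.
  rewrite fE // g2E // cparE.
  by case: (wpar a w1 x y); case: (wpar c w2 x y); case: (wpar a p x y).
have g1f x y : e x y -> g1 x y -> f x y.
  by move=> exy; rewrite /g1; have := g2f x y exy; case: (f x y); case: (g2 x y) => //= /(_ isT).
have np z y : z \in b :: q -> wpar a p z y = false.
  by move=> zq; apply: wpar_notin; apply: contraTN zq; apply: pqD.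
have mX2 z : z \in c :: w2 -> z \in X.
  rewrite EX /w2 !(inE, mem_cat).
  by do ![case/orP=> [->|] | move=> ->]; rewrite ?orbT.
have mX1 z : z \in a :: w1 -> z \in X.
  rewrite EX /w1 !(inE, mem_cat).
  by do ![case/orP=> [->|] | move=> ->]; rewrite ?orbT.
have cls2 z : z \in b :: q -> z \in c :: w2 -> forall y, e z y -> g1 z y = false.
  move=> zq z2; apply: (below_at_cycle cyX fX fg1 g1f (mX2 _ z2)) => y ezy.
  by rewrite g1E // np // wpar_notin ?w12.
(* The invariant along [q]: off the arc [w2], with no face of [g2] around. *)
pose C z := (z \notin c :: w2) /\ (forall y, e z y -> g2 z y = false).
have Cb : C b.
  have bq : b \in b :: q by rewrite mem_head.
  have b2 : b \notin c :: w2.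
    apply: contraL (mem_head b q) => /(w12 b bq).
    by rewrite /w1 !(inE, mem_cat) eqxx !orbT.
  split=> //; apply: (below_at_cycle cyX fX fg2 g2f) => [|y eby].
    by apply: mX1; rewrite /w1 !(inE, mem_cat) eqxx !orbT.
  by rewrite g2E // np // wpar_notin.
have Cq r x : path (inside f) x r -> C x -> {subset x :: r <= b :: q} -> C (last x r).
  elim: r x => //= y r IHr x /andP[/andP[exy fxy] pr] [x2 xg] sub.
  have xq : x \in b :: q by apply: sub; rewrite mem_head.
  have yq : y \in b :: q by apply: sub; rewrite !inE eqxx orbT.
  have eyx : e y x by rewrite esym.
  have xy0 : bd g2 x y = false by rewrite g2E // np // wpar_notin.
  have g20 : g2 y x = false by move: xy0; rewrite /bd xg.
  apply: IHr => // [|z zr]; last by apply: sub; rewrite inE zr orbT.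
  (* At a vertex of [w2] off [p] the set [g1] vanishes. An edge from outside [g2] into [w2] would
     thus have both sides outside the disc. *)
  have [y2|y2] := boolP (y \in c :: w2).
    have g1y := cls2 y yq y2 x eyx.
    have fyx : f y x = false by move: g1y; rewrite /g1 g20 addbF.
    have : bd f x y = false by rewrite fE // cparE (wpar_notin _ x2) addbF wpar_sym wpar_notin ?w12.
    by move: fxy; rewrite /bd fyx; case: (f x y).
  split=> // z eyz; rewrite -g20; apply: (face_fun_at esym (pg_rot G)) => //.
  by move=> t eyt; rewrite g2E // np // wpar_notin.
have [//|+ _] := Cq q b pq Cb; by rewrite lq /w2 !(inE, mem_cat) eqxx !orbT.
Qed.

Lemma is_graph_cycle_rot n X : is_graph_cycle e X -> is_graph_cycle e (rot n X).
Proof. by rewrite /is_graph_cycle size_rot rot_uniq rot_cycle. Qed.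

Lemma is_bd_rot n f X : is_bd f X -> is_bd f (rot n X).
Proof. by case=> ff fE; split=> // a b eab; rewrite cpar_rot fE. Qed.

Lemma split_index4 X (a b c d : T) : d \in X ->
  index a X < index b X -> index b X < index c X -> index c X < index d X ->
  exists X0 X1 X2 X3 X4, X = X0 ++ a :: X1 ++ b :: X2 ++ c :: X3 ++ d :: X4.
Proof.
have step (Y : seq T) (x y : T) : y \in Y -> index x Y < index y Y ->
    exists Y1 Y2, [/\ Y = Y1 ++ y :: Y2, x \in Y1 &
      forall z, index z Y < index x Y -> index z Y1 < index x Y1].
  case/splitPr=> Y1 Y2 xy.
  have xY1 : x \in Y1.
    apply: contraTT xy => xY1; rewrite !index_cat (negbTE xY1) /= eqxx addn0 -leqNgt.
    by apply: leq_trans (leq_addr _ _); case: ifP => // _; apply: index_size.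
  exists Y1, Y2; split=> // z; rewrite !index_cat xY1.
  case: ifP => // _ lt; move: (leq_ltn_trans (leq_addr _ _) lt).
  by rewrite ltnNge index_size.
move=> dX ab bc cd; have [Y1 [X4 [EX cY1 mono1]]] := step X c d dX cd.
have bc1 := mono1 b bc.
have ab1 : index a Y1 < index b Y1.
  have bY1 : b \in Y1 by rewrite -index_mem (ltn_trans bc1) ?index_mem.
  have aY : index a X < size Y1.
    by apply: ltn_trans ab _; rewrite EX index_cat bY1 index_mem.
  have aY1 : a \in Y1.
    by move: aY; rewrite EX index_cat; case: ifP => // _; rewrite ltnNge leq_addr.
  by move: ab; rewrite EX !index_cat aY1 bY1.
have [Y2 [X3 [EY1 bY2 mono2]]] := step Y1 b c cY1 bc1.
have [Y3 [X2 [EY2 aY3 _]]] := step Y2 a b bY2 (mono2 a ab1).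
exists (take (index a Y3) Y3), (drop (index a Y3).+1 Y3), X2, X3, X4.
have EY3 : Y3 = take (index a Y3) Y3 ++ a :: drop (index a Y3).+1 Y3.
  by rewrite -{1}(cat_take_drop (index a Y3) Y3) (drop_nth a) ?index_mem // nth_index.
by rewrite EX EY1 EY2 {1}EY3 -!catA /= -?catA /= -?catA.
Qed.

Lemma noncross X f a b c d p q : is_graph_cycle e X -> is_bd f X ->
  d \in X ->
  index a X < index b X -> index b X < index c X -> index c X < index d X ->
  path (inside f) a p -> last a p = c ->
  path (inside f) b q -> last b q = d ->
  (forall z, z \in a :: p -> z \notin b :: q) -> False.
Proof.
move=> cyX fX dX ab bc cd.
have [X0 [X1 [X2 [X3 [X4 EX]]]]] := split_index4 dX ab bc cd.
apply: (@noncross_head (rot (size X0) X) f a b c d X1 X2 X3 (X4 ++ X0)).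
- exact: is_graph_cycle_rot.
- exact: is_bd_rot.
- by rewrite EX rot_size_cat /= -!catA /= -?catA /= -?catA.
Qed.

Lemma noncross_sets X f (A B : {set T}) a b c d :
  is_graph_cycle e X -> is_bd f X -> d \in X ->
  index a X < index b X -> index b X < index c X -> index c X < index d X ->
  conn e A -> conn e B -> [disjoint A & B] ->
  (forall x y, x \in A -> y \in A -> e x y -> inside f x y) ->
  (forall x y, x \in B -> y \in B -> e x y -> inside f x y) ->
  a \in A -> c \in A -> b \in B -> d \in B -> False.
Proof.
move=> cyX fX dX ab bc cd cA cB AB iA iB aA cA' bB dB.
have [p [pp lp sp _]] := conn_path cA aA cA'.
have [q [pq lq sq _]] := conn_path cB bB dB.
have ins (S : {set T}) x r : (forall x y, x \in S -> y \in S -> e x y -> inside f x y) ->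
    path e x r -> {subset x :: r <= S} -> path (inside f) x r.
  move=> iS; elim: r x => //= y r IHr x /andP[exy pr] sub.
  rewrite iS ?sub ?inE ?eqxx ?orbT // IHr // => z zr.
  by apply: sub; rewrite inE zr orbT.
apply: (noncross cyX fX dX ab bc cd (ins _ _ _ iA pp sp) lp (ins _ _ _ iB pq sq) lq).
by move=> z /sp zA; apply: contraL zA => /sq zB; apply/negP => zA; move/pred0P/(_ z): AB; rewrite /= zA zB.
Qed.

Lemma two_walks_bd x p q : path e x p -> path e x q -> last x p = last x q ->
  exists2 f, face f & forall a b, e a b -> bd f a b = wpar x p a b (+) wpar x q a b.
Proof.
move=> pp pq lpq; have [||f ff fE] := pg_fill G (x := x) (p := p ++ rev (belast x q)).
- rewrite cat_path pp lpq rev_path /=.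
  by apply: sub_path pq => u v; rewrite /= esym.
- rewrite last_cat lpq; case: (q) => //= y r; rewrite rev_cons last_rcons //.
- by exists f => // a b eab; rewrite fE // wpar_cat lpq wpar_rev.
Qed.

Lemma face_fun_conn f (S : {set T}) r y0 : face f -> conn e S ->
  (forall z y, z \in S -> e z y -> bd f z y = false) -> r \in S -> e r y0 ->
  forall z y, z \in S -> e z y -> f z y = f r y0.
Proof.
move=> ff cS S0 rS er.
have at_ z y y' : z \in S -> e z y -> e z y' -> f z y = f z y'.
  move=> zS; apply: (face_fun_at esym (pg_rot G)) => // t ezt.
  by rewrite (S0 z t).
suff /subsetP sub : S \subset [set z in S | [forall y, e z y ==> (f z y == f r y0)]].
  move=> z y /sub; rewrite inE => /andP[_ /forallP/(_ y)/implyP zy] /zy.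
  by move/eqP.
apply: (conn_sub_closed cS rS) => [|z t zS tS].
  by rewrite inE rS; apply/forallP => y; apply/implyP => ery; apply/eqP/at_.
rewrite !inE zS tS /= => /forallP zf ezt; apply/forallP => y; apply/implyP => ety.
have etz : e t z by rewrite esym.
rewrite (at_ t y z) //; have := zf t; rewrite ezt /= => /eqP <-; apply/eqP.
by move: (S0 z t zS ezt); rewrite /bd; case: (f z t); case: (f t z).
Qed.

Lemma wpar_middle (a b x u v : T) (p : seq T) : wpar a (rcons (x :: p) b) u v ->
  (u \in x :: p) || (v \in x :: p).
Proof.
rewrite rcons_cons [wpar _ _ _ _]/= wpar_rcons.
have [/wpar_mem/andP[-> _]//|_] := boolP (wpar x p u v).
rewrite /same_edge; move: (mem_last x p) (mem_head x p) => lp xp.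
have [/orP[]/andP[/eqP-> /eqP->]|_] := boolP (_ || _); rewrite ?xp ?orbT //.
by case/orP=> /andP[/eqP-> /eqP->]; rewrite ?lp ?orbT.
Qed.

(** Walks from [a] to [b] through the three sets form a theta graph, with [c] off it. Let [f] be
    bounded by [wA] and [wB], and [g] by [wB] and [wC], both vanishing at [c]. Then [f && g] has the
    single walk [wB] as its boundary, which has odd degree at [a]. *)
Lemma no_K33 (A B C : {set T}) a b c :
  uniq [:: a; b; c] -> conn e A -> conn e B -> conn e C ->
  [disjoint A & B] -> [disjoint A & C] -> [disjoint B & C] ->
  (forall z, z \in [:: a; b; c] -> z \notin A :|: B :|: C) ->
  (forall z S, z \in [:: a; b; c] -> S \in [:: A; B; C] -> exists2 x, x \in S & e x z) ->
  False.
Proof.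
move=> uabc cA cB cC AB AC BC abcS adj.
have disj (S S' : {set T}) z : [disjoint S & S'] -> z \in S -> z \notin S'.
  by move=> SS' zS; rewrite (disjointFr SS' zS).
have abcm z : (z \notin A :|: B :|: C) = [&& z \notin A, z \notin B & z \notin C].
  by rewrite !inE !negb_or andbA.
have [a3 b3 c3] : [/\ a \in [:: a; b; c], b \in [:: a; b; c] & c \in [:: a; b; c]].
  by rewrite !inE !eqxx !orbT.
have /and3P[aA aB aC] : [&& a \notin A, a \notin B & a \notin C] by rewrite -abcm abcS.
have /and3P[bA bB bC] : [&& b \notin A, b \notin B & b \notin C] by rewrite -abcm abcS.
have /and3P[cA' cB' cC'] : [&& c \notin A, c \notin B & c \notin C] by rewrite -abcm abcS.
have /and3P[+ bc _] := uabc; rewrite !inE negb_or => /andP[ab ac].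
rewrite inE in bc.
have walk S : S \in [:: A; B; C] -> conn e S ->
    exists p, [/\ path e a p, last a p = b,
      forall z, z \in a :: p -> [|| z == a, z == b | z \in S] &
      forall u v, wpar a p u v -> (u \in S) || (v \in S)].
  move=> S3 cS; have [x xS exa] := adj a S a3 S3; have [y yS eyb] := adj b S b3 S3.
  have [p [pp lp sub _]] := conn_path cS xS yS.
  exists (rcons (x :: p) b); split.
  - by rewrite /= rcons_path pp lp eyb esym exa.
  - by rewrite last_rcons.
  - move=> z; rewrite inE mem_rcons in_cons => /or3P[->//|->|/sub->]; rewrite ?orbT //.
  - by move=> u v /wpar_middle/orP[/sub->|/sub->]; rewrite ?orbT.
have [wA [pA lA mA eA]] := walk A (mem_head _ _) cA.
have [wB [pB lB mB eB]] := walk B ltac:(by rewrite !inE eqxx orbT) cB.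
have [wC [pC lC mC eC]] := walk C ltac:(by rewrite !inE eqxx !orbT) cC.
have out (S : {set T}) w z u : (forall z, z \in a :: w -> [|| z == a, z == b | z \in S]) ->
    z != a -> z != b -> z \notin S -> wpar a w z u = false.
  move=> mw za zb zS; apply: wpar_notin; apply/negP => /mw.
  by rewrite (negbTE za) (negbTE zb) (negbTE zS).
have [x0 x0A ex0c] := adj c A c3 (mem_head _ _).
have ecx0 : e c x0 by rewrite esym.
have normal p q : path e a p -> path e a q -> last a p = b -> last a q = b ->
    exists f, [/\ face f, f c x0 = false &
      forall u v, e u v -> bd f u v = wpar a p u v (+) wpar a q u v].
  move=> pp pq lp lq; have [|f ff fE] := two_walks_bd pp pq; first by rewrite lp.
  exists (fun u v => f u v (+) f c x0); split=> [x y exy||u v euv].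
  - by rewrite ff.
  - by rewrite addbb.
  - by rewrite -fE // /bd addbACA addbb addbF.
have [f [ff fc fE]] := normal _ _ pA pB lA lB.
have [g [fg gc gE]] := normal _ _ pB pC lB lC.
pose k u v := f u v (+) g u v.
have fk : face k by apply: face_fun_add.
have kc : k c x0 = false by rewrite /k fc gc.
have kE u v : e u v -> bd k u v = wpar a wA u v (+) wpar a wC u v.
  move=> euv; have -> : bd k u v = bd f u v (+) bd g u v by rewrite /k /bd addbACA.
  by rewrite fE // gE //; case: (wpar a wB u v); case: (wpar a wA u v); case: (wpar a wC u v).
have ca : c != a by rewrite eq_sym.
have cb : c != b by rewrite eq_sym.
(* A set bounded by the walks through the two other sets has no boundary at [c] or in [S]. These are
   joined, so it vanishes around [S] as it does at [c]. *)
have zero S h (w1 w2 : seq T) (S1 S2 : {set T}) :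
    S \in [:: A; B; C] -> conn e S -> face h -> h c x0 = false ->
    (forall u v, e u v -> bd h u v = wpar a w1 u v (+) wpar a w2 u v) ->
    (forall z, z \in a :: w1 -> [|| z == a, z == b | z \in S1]) ->
    (forall z, z \in a :: w2 -> [|| z == a, z == b | z \in S2]) ->
    [disjoint S & S1] -> [disjoint S & S2] ->
    c \notin S1 -> c \notin S2 ->
    forall u v, e u v -> (u \in S) || (v \in S) -> [/\ h u v = false, h v u = false, wpar a w1 u v = false & wpar a w2 u v = false].
  move=> S3 cS fh hc hE m1 m2 D1 D2 cS1 cS2.
  have nS z : z \in S -> (z != a) && (z != b).
    move=> zS; have zABC : z \in A :|: B :|: C.
      by move: S3; rewrite !inE => /or3P[]/eqP<-; rewrite zS ?orbT.
    by apply/andP; split; apply: contraTneq zABC => ->; apply: abcS.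
  have [y yS eyc] := adj c S c3 S3.
  have cSc : conn e (c |: S) by apply: (connU1 esym cS yS).
  have S0 z t : z \in c |: S -> e z t -> bd h z t = false.
    move=> zS ezt; rewrite hE //; case/setU1P: zS => [->|zS].
      by rewrite (out S1) ?(out S2).
    have /andP[za zb] := nS z zS.
    by rewrite (out S1) ?(out S2) ?(disj S S1) ?(disj S S2).
  have h0 z t : z \in S -> e z t -> h z t = false.
    by move=> zS ezt; rewrite -hc; apply: (face_fun_conn fh cSc S0) => //; rewrite !inE ?eqxx ?zS ?orbT.
  have h0' z t : z \in S -> e z t -> h t z = false.
    move=> zS ezt; have := S0 z t; rewrite !inE zS orbT => /(_ isT ezt).
    by rewrite /bd h0.
  have w0 z t : z \in S -> wpar a w1 z t = false /\ wpar a w2 z t = false.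
    move=> zS; have /andP[za zb] := nS z zS.
    by rewrite (out S1) ?(out S2) ?(disj S S1) ?(disj S S2).
  move=> u v euv; have evu : e v u by rewrite esym.
  case/orP=> S'; have [W1 W2] := w0 _ (if u \in S then v else u) S'.
    by rewrite S' in W1 W2; split=> //; [apply: h0 | apply: h0'].
  have [{}W1 {}W2] := w0 v u S'; rewrite wpar_sym in W1; rewrite wpar_sym in W2.
  by split=> //; [apply: h0' | apply: h0].
have zA := zero A g wB wC B C (mem_head _ _) cA fg gc gE mB mC AB AC cB' cC'.
have BA : [disjoint B & A] by rewrite disjoint_sym.
have CA : [disjoint C & A] by rewrite disjoint_sym.
have CB : [disjoint C & B] by rewrite disjoint_sym.
have zB := zero B k wA wC A C ltac:(by rewrite !inE eqxx orbT) cB fk kc kE mA mC BA BC cA' cC'.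
have zC := zero C f wA wB A B ltac:(by rewrite !inE eqxx !orbT) cC ff fc fE mA mB CA CB cA' cB'.
(* On the edges through [A] the set [g] vanishes, and through [C] the set [f]; through [B] they
   agree, since their sum [k] vanishes. *)
pose h u v := f u v && g u v.
have hE u v : e u v -> bd h u v = wpar a wB u v.
  move=> euv; have := fE u v euv; have := gE u v euv; rewrite /h /bd.
  have [/eA uvA|_] := boolP (wpar a wA u v).
    by have [-> -> -> _] := zA u v euv uvA; rewrite !andbF.
  have [/eC uvC|_] := boolP (wpar a wC u v).
    by have [-> -> _ ->] := zC u v euv uvC.
  have [/eB uvB|_] := boolP (wpar a wB u v).
    have [+ + _ _] := zB u v euv uvB; rewrite /k.
    by case: (f u v); case: (g u v); case: (f v u); case: (g v u).
  by case: (f u v); case: (g u v); case: (f v u); case: (g v u).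
have := bd_even esym (pg_rot G) (face_fun_and ff fg) a.
rewrite -/h; under eq_bigr => y eay do rewrite hE //.
by rewrite (wpar_degree esym eirr) // lB eqxx (negbTE ab).
Qed.

End Crossing.

(** * Outer cycles *)

Section Outer.
Variables (T : finType) (e : rel T) (rho : T -> T -> T).
Hypothesis G : plane_graph e rho.
Variables a0 b0 : T.
Hypothesis e0 : e a0 b0.
Local Notation face := (face_fun e rho).
Local Notation is_bd := (is_bd e rho).
Local Notation inside := (inside e).
Let esym := pg_sym G.
Let eirr := pg_irr G.
Implicit Types (X : seq T) (H K P B : {set T}).

(* The face of the fixed dart [(a0, b0)] plays the role of the outer face. *)
Definition interior (f : T -> T -> bool) X : Prop := is_bd f X /\ f a0 b0 = false.

Lemma interior_exists X : cycle e X -> exists f, interior f X.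
Proof.
move=> /(cycle_bd G)[f [ff fE]]; exists (fun x y => f x y (+) f a0 b0).
split; last exact: addbb.
split=> [x y exy|x y exy]; first by rewrite ff.
by rewrite -fE // /bd addbACA addbb addbF.
Qed.

(** The outer dart settles the constant left open in [below_simple]. *)
Lemma interior_below X f g : is_graph_cycle e X -> interior f X -> face g ->
  g a0 b0 = false ->
  (forall a b, e a b -> bd g a b -> inside f a b || cpar X a b) ->
  forall a b, e a b -> g a b -> f a b.
Proof.
move=> cyX [fX f0] fg g0 gX a b eab; have [c gc] := below_simple G cyX fX fg gX.
by apply: contraTT => /(gc _ _ eab) ->; rewrite -(gc _ _ e0) ?g0 ?f0.
Qed.

(* [w] lies on the outer face of the subgraph induced by [H]. *)
Definition exposed H w : Prop := forall X f, is_graph_cycle e X ->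
  {subset X <= H} -> interior f X -> w \notin X -> forall y, e w y -> f w y = false.

Definition exposed_edge H x y : Prop := forall X f, is_graph_cycle e X ->
  {subset X <= H} -> interior f X -> ~~ cpar X x y -> f x y = false.

Lemma exposedS H H' w : H' \subset H -> exposed H w -> exposed H' w.
Proof. by move=> /subsetP sH xw X f cyX XH; apply: xw => // z /XH/sH. Qed.

Lemma exposed_edgeS H H' x y :
  H' \subset H -> exposed_edge H x y -> exposed_edge H' x y.
Proof. by move=> /subsetP sH xw X f cyX XH; apply: xw => // z /XH/sH. Qed.

(** The size of a disc, maximised in [outer_cycle]. *)
Definition num_inside (f : T -> T -> bool) := #|[set d : T * T | e d.1 d.2 && f d.1 d.2]|.

Lemma off_cycle f X x y : is_bd f X -> x \notin X -> e x y -> bd f x y = false.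
Proof.
by move=> [_ fE] xX exy; rewrite fE //; apply: contraNF xX => /cpar_mem/andP[].
Qed.

(** The edges outside the closed disc, of which ears consist. *)
Let ear_rel f : rel T := [rel u v | [&& e u v, ~~ f u v & ~~ f v u]].

Lemma ear_cycle p q X1 r : uniq (p :: X1 ++ q :: rev r) ->
  path e p (X1 ++ [:: q]) -> path e p (rcons r q) ->
  (X1 != [::]) || (r != [::]) -> is_graph_cycle e (p :: X1 ++ q :: rev r).
Proof.
move=> u1 pX1 pr ne; apply/and3P; split=> //.
  by rewrite /= size_cat /= size_rev; case: X1 r ne {u1 pX1 pr} => [|? ?] [|? ?] //=; rewrite ?addnS.
rewrite /= rcons_cat rcons_cons cat_path /=.
move: pX1; rewrite cat_path /= => /and3P[-> -> _] /=.
have : path e (last p (rcons r q)) (rev (belast p (rcons r q))).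
  by rewrite rev_path; apply: sub_path pr => u v; rewrite /= esym.
by rewrite last_rcons belast_rcons rev_cons.
Qed.

Lemma cpar_ear p q X1 r a b : cpar (p :: X1 ++ q :: rev r) a b =
  wpar p (X1 ++ [:: q]) a b (+) wpar p (rcons r q) a b.
Proof.
rewrite /cpar rcons_cat rcons_cons -cat_rcons wpar_cat cats1 last_rcons.
congr (_ (+) _); rewrite -(wpar_rev p (rcons r q)) last_rcons belast_rcons.
by rewrite rev_cons.
Qed.

(** The first edge of the ear has both sides outside [f] and one of them in [g], so the inclusion is
    strict. *)
Lemma ear_half p q X1 r f g H :
  uniq (p :: X1 ++ q :: rev r) -> {subset p :: X1 ++ q :: rev r <= H} ->
  path e p (X1 ++ [:: q]) -> path (ear_rel f) p (rcons r q) ->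
  (X1 != [::]) || (r != [::]) ->
  interior g (p :: X1 ++ q :: rev r) ->
  (forall x y, e x y -> f x y -> g x y) ->
  exists X' f', [/\ is_graph_cycle e X', {subset X' <= H}, interior f' X'
    & num_inside f < num_inside f'].
Proof.
move=> uZ ZH pX1 pr ne gZ fg.
have pe : path e p (rcons r q) by apply: sub_path pr => u v /and3P[].
exists (p :: X1 ++ q :: rev r), g; split=> //; first exact: ear_cycle.
pose y := head q r.
have /and3P[epy fpy fyp] : ear_rel f p y.
  by move: pr; rewrite /y; case: (r) => [|z r'] /= /andP[].
have Zpy : cpar (p :: X1 ++ q :: rev r) p y.
  have yl : y = last q (rev r) by rewrite /y; case: (r) => //= z r'; rewrite rev_cons last_rcons.
  move: uZ; case E: (X1 ++ q :: rev r) => [|b s]; first by case: (X1) E.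
  have sl : s != [::] -> last b s = y.
    by move=> s0; have := last_cat p X1 (q :: rev r); rewrite E /= yl => <-.
  have s0 : s != [::].
    move: ne E; case: (X1) => [|t X1'] /=; last by move=> _ [_ <-]; case: X1'.
    by rewrite -(size_eq0 r) -(size_rev r) size_eq0 => s0 [_ <-].
  by move=> uZ; rewrite cpar_head // sl // eqxx orbT.
have [[_ gE] _] := gZ; have := gE _ _ epy; rewrite Zpy /bd => gpy.
apply: proper_card; apply/properP; split.
  by apply/subsetP => [[u v]]; rewrite !inE /= => /andP[euv /(fg _ _ euv)->]; rewrite euv.
have [gt|gf] := boolP (g p y).
  by exists (p, y); rewrite !inE /= epy ?gt // negb_and fpy orbT.
exists (y, p); rewrite !inE /= esym epy /= ?fyp //.
by move: gpy; rewrite (negbTE gf).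
Qed.

(** The ear and the two arcs of [X] form two cycles, whose discs [f1] and [f2] add up to [f]. By
    [cycle_simple] for [f1 && f] and the value at the outer dart, one of the two discs contains
    [f]. *)
Lemma ear_enlarge p q X1 X2 r f H : let X := p :: X1 ++ q :: X2 in
  is_graph_cycle e X -> interior f X -> {subset X <= H} ->
  path (ear_rel f) p (rcons r q) -> uniq r ->
  (forall z, z \in r -> (z \in H) && (z \notin X)) ->
  exists X' f', [/\ is_graph_cycle e X', {subset X' <= H}, interior f' X'
    & num_inside f < num_inside f'].
Proof.
move=> X cyX fX XH pr ur rX; have [[ff fE] f0] := fX; have /and3P[sX uX cX] := cyX.
have pe : path e p (rcons r q) by apply: sub_path pr => u v /and3P[].
pose X' := q :: X2 ++ p :: X1.
have uX' : uniq (q :: X2 ++ p :: X1) by rewrite -cat_cons uniq_catC.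
have XX' z : (z \in X') = (z \in X) by rewrite /X /X' -!cat_cons !mem_cat orbC.
have uZ (Y1 Y2 : seq T) (a b : T) (t : seq T) : uniq (a :: Y1 ++ b :: Y2) -> uniq t ->
    (forall z, z \in t -> z \notin a :: Y1 ++ b :: Y2) -> uniq (a :: Y1 ++ b :: t).
  move=> uY ut tY; rewrite -cat_rcons -cat_cons cat_uniq ut andbT.
  move: uY; rewrite -cat_rcons -cat_cons cat_uniq => /and3P[-> _ _] /=.
  by apply/hasPn => z /tY; rewrite -cat_rcons -cat_cons mem_cat negb_or => /andP[].
have rrX z : z \in rev r -> z \notin X by rewrite mem_rev => /rX/andP[].
have u1 : uniq (p :: X1 ++ q :: rev r) by apply: uZ uX _ rrX; rewrite rev_uniq.
have u2 : uniq (q :: X2 ++ p :: rev (rev r)).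
  by apply: (uZ X2 X1 q p _ uX'); rewrite ?revK // => z /rX/andP[_]; rewrite XX'.
have pX1 : path e p (X1 ++ [:: q]).
  by move: cX; rewrite /X /= rcons_cat rcons_cons -cat_rcons cat_path cats1 => /andP[].
have pX2 : path e q (X2 ++ [:: p]).
  by move: cX; rewrite /X /= rcons_cat rcons_cons -cat_rcons cat_path last_rcons cats1 => /andP[].
have sub1 : {subset p :: X1 ++ q :: rev r <= H}.
  move=> z; rewrite -cat_rcons -cat_cons mem_cat => /orP[zX|].
    by apply: XH; rewrite /X -cat_rcons -cat_cons mem_cat zX.
  by rewrite mem_rev => /rX/andP[].
have sub2 : {subset q :: X2 ++ p :: rev (rev r) <= H}.
  move=> z; rewrite -cat_rcons -cat_cons mem_cat => /orP[zX|].
    by apply: XH; rewrite -XX' /X' -cat_rcons -cat_cons mem_cat zX.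
  by rewrite revK => /rX/andP[].
have pr2 : path (ear_rel f) q (rcons (rev r) p).
  have := rev_path (ear_rel f) p (rcons r q); rewrite last_rcons belast_rcons rev_cons.
  by move=> ->; apply: sub_path pr => u v /and3P[euv fu fv]; rewrite /ear_rel /= esym euv fu fv.
have nchord : r = [::] -> ~~ cpar X p q.
  move=> r0; have /andP[/and3P[epq fpq fqp] _] : path (ear_rel f) p (rcons [::] q).
    by rewrite -r0.
  by rewrite -fE // /bd (negbTE fpq) (negbTE fqp).
have ne1 : (X1 != [::]) || (r != [::]).
  rewrite -negb_and; apply/negP => /andP[/eqP X10 /eqP/nchord/negP[]].
  have EX : X = p :: q :: X2 by rewrite /X X10.
  rewrite EX cpar_head -?EX ?eqxx //.
  by apply: contraTneq sX => X20; rewrite EX X20.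
have ne2 : (X2 != [::]) || (rev r != [::]).
  rewrite -(size_eq0 (rev r)) size_rev size_eq0.
  rewrite -negb_and; apply/negP => /andP[/eqP X20 /eqP/nchord/negP[]].
  have EX : rot (size (p :: X1)) X = q :: p :: X1.
    by rewrite /X -cat_cons rot_size_cat X20.
  rewrite cpar_sym -(cpar_rot (size (p :: X1))) EX cpar_head ?eqxx //.
    by rewrite -EX rot_uniq.
  by apply: contraTneq sX => X10; rewrite -(size_rot (size (p :: X1))) EX X10.
have [f1 [[ff1 f1E] f10]] : exists f1, interior f1 (p :: X1 ++ q :: rev r).
  by apply: interior_exists; case/and3P: (ear_cycle u1 pX1 pe ne1).
pose f2 x y := f x y (+) f1 x y.
have ff2 : face f2 by apply: face_fun_add.
have f20 : f2 a0 b0 = false by rewrite /f2 f0 f10.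
have f2X : interior f2 (q :: X2 ++ p :: rev (rev r)).
  split=> //; split=> // x y exy.
  have -> : bd f2 x y = bd f x y (+) bd f1 x y by rewrite /f2 /bd addbACA.
  rewrite fE // f1E // !cpar_ear /X /cpar rcons_cat rcons_cons -cat_rcons.
  rewrite wpar_cat last_rcons !cats1.
  have := wpar_rev p (rcons r q) x y; rewrite last_rcons belast_rcons rev_cons => <-.
  by case: (wpar p _ _ _); case: (wpar q _ _ _); case: (wpar q _ _ _).
pose h x y := f1 x y && f x y.
have fh : face h by apply: face_fun_and.
have earout u v : wpar p (rcons r q) u v -> ear_rel f u v.
  apply: wpar_rel pr => x y; rewrite /ear_rel /= esym; congr (_ && _); exact: andbC.
have pc1 : path (cpar X) p (X1 ++ [:: q]).
  have : path (cpar X) p (rcons (X1 ++ q :: X2) p) by apply: (cycle_cpar cyX).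
  by rewrite rcons_cat rcons_cons -cat_rcons cat_path cats1 => /andP[].
have [|h0|h1] := cycle_simple G cyX fh.
- move=> a b eab; rewrite -fE //; apply: contraTT => nfab.
  have fab : f a b = f b a by move: nfab; rewrite /bd; case: (f a b); case: (f b a).
  rewrite /bd /h -fab; case Ef: (f a b); rewrite ?andbF // !andbT.
  rewrite -/(bd f1 a b) f1E // cpar_ear.
  have -> : wpar p (rcons r q) a b = false.
    by apply/negP => /earout/and3P[_]; rewrite Ef.
  rewrite addbF; apply: contra nfab => /(wpar_rel (@cpar_sym _ X) pc1).
  by rewrite fE.
- have [|c hc] := face_fun_const esym (pg_rot G) (pg_con G) fh.
    by move=> x y exy; rewrite h0.
  apply: (ear_half u2 sub2 pX2 pr2 ne2 f2X) => x y exy fxy.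
  have := hc x y exy; rewrite -(hc _ _ e0) /h f10 fxy andbT /= => f1xy.
  by rewrite /f2 fxy f1xy.
- have [|c hc] := face_fun_const esym (pg_rot G) (pg_con G) (face_fun_add fh ff).
    move=> x y exy; have := h1 x y exy; rewrite -fE // /bd.
    by case: (h x y); case: (h y x); case: (f x y); case: (f y x).
  apply: (ear_half u1 sub1 pX1 pr ne1 (conj (conj ff1 f1E) f10)) => x y exy fxy.
  have := hc x y exy; rewrite -(hc _ _ e0) /h f10 f0 fxy andbT /=.
  by case: (f1 x y).
Qed.

(** Two neighbours of a vertex [x] in [H] are joined without [x]. *)
Lemma exists_cycle H : conn e H -> (forall w, w \in H -> conn e (H :\ w)) ->
  2 < #|H| -> exists2 X, is_graph_cycle e X & {subset X <= H}.
Proof.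
move=> cH cHw cardH.
have nbr S x y : conn e S -> x \in S -> y \in S -> x != y ->
    exists2 z, z \in S & e x z && (z != x).
  move=> cS xS yS nxy; have [[|z p] [/= pp lp sub up]] := conn_path cS xS yS.
    by rewrite lp eqxx in nxy.
  move: pp up => /andP[exz _] /andP[]; rewrite inE negb_or eq_sym => /andP[nzx _] _.
  by exists z; rewrite ?exz // sub // !inE eqxx orbT.
have /card_gt0P[x xH] : 0 < #|H| by apply: ltn_trans cardH.
have /card_gt0P[y] : 0 < #|H :\ x| by move: cardH; rewrite (cardsD1 x H) xH; case: #|_ :\ _|.
rewrite !inE => /andP[nyx yH].
have [b bH /andP[exb nbx]] : exists2 z, z \in H & e x z && (z != x).
  by apply: (nbr H x y) => //; rewrite eq_sym.
have /card_gt0P[c] : 0 < #|(H :\ x) :\ b|.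
  by move: cardH; rewrite (cardsD1 x H) xH (cardsD1 b (H :\ x)) !inE nbx bH.
rewrite !inE => /and3P[ncb ncx cH'].
have [b' + /andP[exb' _]] : exists2 z, z \in H :\ b & e x z && (z != x).
  apply: (nbr _ x c (cHw b bH)); rewrite ?inE ?xH ?cH' ?andbT //; by rewrite eq_sym.
rewrite !inE => /andP[nb'b b'H].
have nxb' : b' != x by apply: contraTneq exb' => ->; rewrite eirr.
have [||p [pp lp sub up]] := conn_path (cHw x xH) (x := b) (y := b').
- by rewrite !inE nbx.
- by rewrite !inE nxb'.
exists (x :: b :: p).
  apply/and3P; split=> //=.
  - by case: (p) lp => //= bb'; rewrite bb' eqxx in nb'b.
  - move: up => /= -> ; rewrite andbT; apply/negP => /sub.
    by rewrite !inE eqxx.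
  - by rewrite exb rcons_path pp lp esym.
by move=> z; rewrite inE => /predU1P[-> // | /sub]; rewrite inE => /andP[].
Qed.

Lemma component_attached H X S x z : conn e S -> S \subset H -> x \in S -> x \notin X ->
  z \in S -> z \in X -> component e (H :\: [set t in X]) x \subset S ->
  exists k t, [/\ k \in component e (H :\: [set t in X]) x, t \in S, t \in X & e k t].
Proof.
move=> cS /subsetP SH xS xX zS zX KS; set K := component _ _ _.
have [/exists_inP[k kK /exists_inP[t /andP[tS tX] ekt]]|no] :=
    boolP [exists k in K, [exists t in [pred t | (t \in S) && (t \in X)], e k t]].
  by exists k, t.
have xK : x \in K by apply: component_id; rewrite !inE xX SH.
have /subsetP/(_ z zS) : S \subset K.
  apply: (conn_sub_closed cS xS xK) => u v uS vS uK euv.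
  have [vX|vX] := boolP (v \in X).
    case/negP: no; apply/exists_inP; exists u => //; apply/exists_inP; exists v => //.
    by rewrite inE vS.
  by apply: component_closed uK _ euv; rewrite !inE vX SH.
by rewrite !inE zX.
Qed.

(** Take a cycle with a largest disc. An edge of [H] outside the disc is an ear or lies at a
    component off the cycle, which contains the inside of an ear since by 2-connectivity it reaches
    the cycle at two vertices. *)
Lemma outer_cycle H : conn e H -> (forall w, w \in H -> conn e (H :\ w)) ->
  2 < #|H| -> exists X f, [/\ is_graph_cycle e X, {subset X <= H}, interior f X
    & forall x y, x \in H -> y \in H -> e x y -> inside f x y].
Proof.
move=> cH cHw cardH.
have [X0 cyX0 X0H] := exists_cycle cH cHw cardH.
have [f0 f0X] : exists f, interior f X0.
  by apply: interior_exists; case/and3P: cyX0.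
pose m f := #|[set: T * T]| - num_inside f.
have [n] := ubnP (m f0); elim: n X0 f0 cyX0 X0H f0X => // n IHn X f cyX XH fX ltn.
have enlarge : (exists X' f', [/\ is_graph_cycle e X', {subset X' <= H}, interior f' X'
    & num_inside f < num_inside f']) -> exists X f, [/\ is_graph_cycle e X, {subset X <= H}, interior f X
    & forall x y, x \in H -> y \in H -> e x y -> inside f x y].
  move=> [X' [f' [cyX' X'H f'X' lt]]]; apply: (IHn X' f') => //.
  rewrite -ltnS; apply: leq_trans ltn; rewrite ltnS /m ltn_sub2l //.
  by apply: (leq_trans lt); apply/subset_leq_card/subsetT.
have [/forallP allin|] := boolP [forall x, forall y, [&& x \in H, y \in H & e x y] ==> inside f x y].
  exists X, f; split=> // x y xH yH exy.
  by have /forallP/(_ y)/implyP := allin x; apply; rewrite xH yH.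
rewrite negb_forall => /existsP[x]; rewrite negb_forall => /existsP[y].
rewrite negb_imply => /andP[/and3P[xH yH exy]]; rewrite /inside /= exy /= negb_or => /andP[nxy nyx].
apply: enlarge; have [[ff fE] fa0] := fX; have /and3P[sX uX cX] := cyX.
have ear p q r : p \in X -> q \in X -> p != q -> path (ear_rel f) p (rcons r q) ->
    uniq r -> (forall z, z \in r -> (z \in H) && (z \notin X)) ->
    exists X' f', [/\ is_graph_cycle e X', {subset X' <= H}, interior f' X'
    & num_inside f < num_inside f'].
  move=> pX qX npq pr ur rX; have [i s E] := rot_to pX.
  have qs : q \in s by move: qX; rewrite -(mem_rot i) E inE eq_sym (negbTE npq).
  case/splitPr: qs E => X1 X2 E.
  apply: (@ear_enlarge p q X1 X2 r f H) => //.
  - by rewrite -E is_graph_cycle_rot.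
  - by rewrite -E; split=> //; apply: is_bd_rot.
  - by rewrite -E => z; rewrite mem_rot; apply: XH.
  - by rewrite -E => z; rewrite mem_rot; apply: rX.
(* No edge of the cycle meets the component [K] of [x'] off the cycle, so all of it lies outside the
   disc with [x']. *)
have earK x' y' : x' \in H -> x' \notin X -> e x' y' -> f x' y' = false ->
    exists X' f', [/\ is_graph_cycle e X', {subset X' <= H}, interior f' X'
    & num_inside f < num_inside f'].
  move=> x'H x'X exy' nf; set K := component e (H :\: [set t in X]) x'.
  have x'D : x' \in H :\: [set t in X] by rewrite !inE x'X.
  have cK : conn e K by apply: component_conn.
  have x'K : x' \in K by apply: component_id.
  have KH z : z \in K -> (z \in H) && (z \notin X).
    by move/(subsetP (component_sub _ _ _)); rewrite !inE andbC.
  have K0 z t : z \in K -> e z t -> bd f z t = false.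
    by move=> /KH/andP[_ zX]; apply: off_cycle zX; case: fX.
  have fK z t : z \in K -> e z t -> f z t = false.
    by move=> zK ezt; rewrite (face_fun_conn G ff cK K0 x'K exy').
  have fK' z t : z \in K -> e z t -> f t z = false.
    by move=> zK ezt; move: (K0 z t zK ezt); rewrite /bd fK.
  have [z zX] : exists z, z \in X by case: (X) sX => // z ? _; exists z; rewrite mem_head.
  have [k [p [kK pH pX ekp]]] : exists k t, [/\ k \in K, t \in H, t \in X & e k t].
    apply: (component_attached cH (subxx _) x'H x'X (XH z zX) zX).
    by apply/subsetP => t /KH/andP[].
  have [z' z'X nz'p] : exists2 z', z' \in X & z' != p.
    case: (X) sX uX => [|u [|v ?]] //= _ /andP[]; rewrite !inE negb_or => /andP[nuv _] _.
    have [<-|nup] := eqVneq u p; last by exists u; rewrite ?inE ?eqxx.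
    by exists v; rewrite 1?eq_sym // !inE eqxx orbT.
  (* Deleting the first attachment [p] from [H] yields a second one. *)
  have [l [q [lK qH qX elq]]] : exists k t, [/\ k \in K, t \in H :\ p, t \in X & e k t].
    apply: (component_attached (cHw p pH) (subsetDl _ _) _ x'X (z := z')).
    - by rewrite !inE x'H andbT; apply: contraNneq x'X => ->.
    - by rewrite !inE nz'p XH.
    - exact: z'X.
    - apply/subsetP => t /KH/andP[tH tX]; rewrite !inE tH andbT.
      by apply: contraNneq tX => ->.
  have npq : p != q by move: qH; rewrite !inE eq_sym => /andP[].
  have [r [rr lr subr ur]] := conn_path cK kK lK.
  apply: (ear p q (k :: r)) => //; last by move=> t /subr/KH.
  have er : path (ear_rel f) k r.
    elim: (r) (k) rr subr kK => //= t r' IHr u /andP[eut pr'] sub uK.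
    have tK : t \in K by apply: sub; rewrite !inE eqxx orbT.
    rewrite /ear_rel /= eut fK ?fK' //= IHr // => w wr; apply: sub.
    by rewrite inE wr orbT.
  by rewrite /= rcons_path er lr /ear_rel /= (esym p) ekp elq (fK k p) // (fK' k p) // (fK l q) // (fK' l q).
have [xX|xX] := boolP (x \in X); last by apply: earK xH xX exy (negbTE nxy).
have [yX|yX] := boolP (y \in X); last first.
  by apply: earK yH yX _ (negbTE nyx); rewrite esym.
apply: (ear x y [::]) => //; last by rewrite /= /ear_rel /= exy nxy nyx.
by apply: contraTneq exy => ->; rewrite eirr.
Qed.

End Outer.

(** * Tutte paths *)

Section Hits.
Variable T : finType.
Implicit Types (K N : {set T}).

(** Boolean, so that a label counts as at most one unit in the bounds below. *)
Definition hits K N : bool := [exists x in K, x \in N].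

Lemma hitsP K N : reflect (exists2 x, x \in K & x \in N) (hits K N).
Proof. exact: exists_inP. Qed.

Lemma hitsS K K' N N' : K \subset K' -> N \subset N' -> hits K N -> hits K' N'.
Proof.
move=> /subsetP sK /subsetP sN /hitsP[x xK xN].
by apply/hitsP; exists x; [apply: sK | apply: sN].
Qed.

Lemma leq_hits K K' N N' : (hits K N -> hits K' N') -> hits K N <= hits K' N'.
Proof. by case: (hits K N) => // /(_ isT) ->. Qed.

End Hits.

Section Tutte.
Variables (T : finType) (e : rel T) (rho : T -> T -> T).
Hypothesis G : plane_graph e rho.
Variables a0 b0 : T.
Hypothesis e0 : e a0 b0.
Local Notation face := (face_fun e rho).
Local Notation is_bd := (is_bd e rho).
Local Notation inside := (inside e).
Local Notation interior := (interior e rho a0 b0).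
Local Notation exposed := (exposed e rho a0 b0).
Local Notation exposed_edge := (exposed_edge e rho a0 b0).
Local Notation conn := (conn e).
Local Notation component := (component e).
Let esym := pg_sym G.
Let eirr := pg_irr G.
Implicit Types (X : seq T) (H K P B N : {set T}).

(* [r] is a path along the outer face from [v]; the vertices of [N2] and [N3] are further marked
   vertices of the outer face, which occur, going round it from [v], in the order
   [N3], [N2], [last v r], [r], up to a common vertex. *)
Record labelled H v (r : seq T) N2 N3 : Prop := Labelled {
  lab_conn : conn H;
  lab_path : path e v r;
  lab_uniq : uniq (v :: r);
  lab_sub : {subset v :: r <= H};
  lab_edge : forall a b, wpar v r a b -> exposed_edge H a b;
  lab_exp : forall w, w \in H -> w \in N2 :|: N3 -> exposed H w;
  lab_cross1 : forall A A', conn A -> conn A' -> A \subset H -> A' \subset H ->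
    [disjoint A & A'] -> v \in A -> last v r \in A ->
    hits A' [set z in v :: r] -> hits A' (N2 :|: N3) -> False;
  lab_cross2 : forall A A', conn A -> conn A' -> A \subset H -> A' \subset H ->
    [disjoint A & A'] -> v \in A -> last v r \in A' ->
    hits A N2 -> hits A' N3 -> False }.

(** The bound is monotone in [K], so asking it of all connected sets off the path amounts to asking
    it of the bridges. Each label counts as a possible attachment outside [H]. *)
Definition tutte_path H v r N2 N3 : Prop := exists p : seq T,
  [/\ path e v p, last v p = last v r, uniq (v :: p), {subset v :: p <= H}
    & forall K, conn K -> K \subset H :\: [set z in v :: p] ->
      #|attached e K [set z in v :: p]| + hits K [set z in v :: r]
      + hits K N2 + hits K N3 <= 3].

Lemma component_link H w x : conn H -> w \in H -> x \in H :\ w ->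
  exists2 k, k \in component (H :\ w) x & e k w.
Proof.
move=> cH wH xH; set K := component _ _.
have [/exists_inP[k kK ekw]|no] := boolP [exists k in K, e k w]; first by exists k.
have xK : x \in K by apply: component_id.
have xH' : x \in H by move: xH; rewrite inE => /andP[].
have /subsetP/(_ w wH) : H \subset K.
  apply: (conn_sub_closed cH xH' xK) => u t uH tH uK eut.
  have [E|ntw] := eqVneq t w.
    by case/negP: no; apply/exists_inP; exists u; rewrite // -E.
  by apply: component_closed uK _ eut; rewrite !inE ntw.
by move/(subsetP (component_sub _ _ _)); rewrite !inE eqxx.
Qed.

Lemma component_link_conn H w x : conn H -> w \in H -> x \in H :\ w ->
  conn (w |: component (H :\ w) x).
Proof.
move=> cH wH xH; have [k kK ekw] := component_link cH wH xH.
exact: connU1 (component_conn esym xH) kK ekw.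
Qed.

Lemma conn_minus_component H w z : conn H -> w \in H -> z \in H :\ w ->
  conn (H :\: component (H :\ w) z).
Proof.
move=> cH wH zH; set K := component _ _.
have wK : w \notin K.
  by apply/negP => /(subsetP (component_sub _ _ _)); rewrite !inE eqxx.
have wH' : w \in H :\: K by rewrite inE wK.
apply: (conn_from esym wH') => x; rewrite inE => /andP[xK xH].
have [->|nxw] := eqVneq x w; first exact: connect0.
have xHw : x \in H :\ w by rewrite !inE nxw.
have := component_link_conn cH wH xHw; set Kx := component _ x => cKx.
apply: sub_connect_in (cKx w x _ _).
- apply/subsetP => t /setU1P[->//|tKx]; rewrite inE.
  move: (subsetP (component_sub _ _ _) t tKx); rewrite inE => /andP[_ ->].
  rewrite andbT; apply: contra xK => tK.
  by rewrite /K -(component_eq esym tK) (component_eq esym tKx) component_id.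
- exact: setU11.
- by rewrite inE component_id ?orbT.
Qed.

(** To enter the component and to leave it again a path has to pass through [w] twice. *)
Lemma path_avoid_component H w z v r : path e v r -> uniq (v :: r) ->
  {subset v :: r <= H} ->
  v \notin component (H :\ w) z -> last v r \notin component (H :\ w) z ->
  forall t, t \in v :: r -> t \notin component (H :\ w) z.
Proof.
move=> pr ur sub vK uK t tr; apply/negP => tK; set K := component _ _ in vK uK tK.
have stay x s : path e x s -> {subset x :: s <= H} -> w \notin x :: s ->
    t \in x :: s -> {subset x :: s <= K}.
  move=> ps ss ws ts y ys.
  have sK : [set y in x :: s] \subset K.
    apply: (component_max (path_conn esym ps) _ _ tK); last by rewrite inE.
    apply/subsetP => c; rewrite inE => cs; rewrite !inE ss // andbT.
    by apply: contraNneq ws => <-.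
  by apply: (subsetP sK); rewrite inE.
have ntw : t != w.
  by apply: contraTneq (subsetP (component_sub _ _ _) t tK) => ->; rewrite !inE eqxx.
case/splitPl: tr pr ur sub uK => p1 p2 lp1; rewrite cat_path last_cat lp1.
move=> /andP[pp1 pp2] ur sub uK.
have w1 : w \in v :: p1.
  apply: contraR vK => w1; apply: (stay v p1) => //; last by rewrite mem_head.
    by move=> c cp; apply: sub; move: cp; rewrite !inE mem_cat => /orP[->|->]; rewrite ?orbT.
  by rewrite -lp1 mem_last.
have w2 : w \in t :: p2.
  apply: contraR uK => w2; apply: (stay t p2) => //; last by rewrite mem_last.
    move=> c; rewrite inE => /predU1P[->|cp]; apply: sub.
      by rewrite -cat_cons mem_cat -lp1 mem_last.
    by rewrite inE mem_cat cp !orbT.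
  by rewrite mem_head.
move: ur; rewrite -cat_cons cat_uniq => /and3P[_ /hasPn disj _].
move: w2; rewrite inE eq_sym (negbTE ntw) /= => /disj /=.
by rewrite w1.
Qed.

(** For the path with the single vertex [v], a bridge has at most one attachment and misses [r],
    which leaves room for both labels. *)
Lemma tutte_path_trivial H v r N2 N3 : last v r = v ->
  labelled H v r N2 N3 -> tutte_path H v r N2 N3.
Proof.
move=> lr L; have r0 : r = [::].
  have := lab_uniq L; move: lr; case: (r) => //= x r' lr /andP[].
  by rewrite -{1}lr mem_last.
exists [::]; split=> //=; first by move=> z; rewrite inE => /eqP->; apply: (lab_sub L); rewrite mem_head.
move=> K cK KH; rewrite r0.
have -> : hits K [set z in [:: v]] = false.
  apply/hitsP => -[x xK]; rewrite inE => xv.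
  by move: (subsetP KH x xK); rewrite inE inE xv.
have : #|attached e K [set z in [:: v]]| <= 1.
  rewrite -(cards1 v); apply: subset_leq_card; apply/subsetP => x /attachedP[].
  by rewrite !inE.
by case: (hits _ _); case: (hits _ _); case: #|_| => [|[|]].
Qed.

Section RemoveComponent.
Variables (H : {set T}) (v : T) (r : seq T) (N2 N3 : {set T}).
Hypothesis IH : forall H' v r N2 N3, #|H'| < #|H| ->
  labelled H' v r N2 N3 -> tutte_path H' v r N2 N3.
Hypothesis L : labelled H v r N2 N3.
Variables (w z : T).
Hypotheses (wH : w \in H) (zH : z \in H :\ w).
Let K0 := component (H :\ w) z.
Hypotheses (vK : v \notin K0) (uK : last v r \notin K0).
Let H' := H :\: K0.
(** The vertex [w] inherits the labels of the removed component. *)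
Let lab N := if hits K0 N then w |: N else N.

Let wK0 : w \notin K0.
Proof. by apply/negP => /(subsetP (component_sub _ _ _)); rewrite !inE eqxx. Qed.

Let wH' : w \in H'. Proof. by rewrite inE wK0. Qed.
Let K0H : K0 \subset H.
Proof. by apply/subsetP => x /(subsetP (component_sub _ _ _)); rewrite inE => /andP[]. Qed.
Let H'H : H' \subset H. Proof. exact: subsetDl. Qed.
Let cH := lab_conn L.

Let cK0 : conn K0. Proof. exact: component_conn. Qed.

Let K0_closed x y : x \in K0 -> y \in H -> e x y -> y \in w |: K0.
Proof.
move=> xK yH exy; rewrite !inE; have [//|nyw] /= := eqVneq y w.
by have := component_closed xK _ exy; rewrite !inE nyw; apply.
Qed.

(** A set that meets a new label only in [w] meets the old one after [K0] is added. A set without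
    [w] stays as it is, so of two disjoint sets at most one grows. *)
Lemma lab_extend A N : conn A -> A \subset H' -> hits A (lab N) ->
  exists A', [/\ conn A', A \subset A', A' \subset A :|: K0, hits A' N & w \notin A -> A' = A].
Proof.
move=> cA AH; rewrite /lab; case: ifP => [hK|_ hA]; last first.
  by exists A; split=> //; apply: subsetUl.
move=> /hitsP[x xA /setU1P[xw|xN]]; last first.
  by exists A; split=> //; [apply: subsetUl | apply/hitsP; exists x].
rewrite {}xw in xA; have [k kK ekw] := component_link cH wH zH.
exists (A :|: K0); split=> //; last by rewrite xA.
- by apply: connU xA kK _ => //; rewrite esym ekw orbT.
- exact: subsetUl.
by apply: hitsS hK => //; apply: subsetUr.
Qed.

Lemma labelled_remove : labelled H' v r (lab N2) (lab N3).
Proof.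
have rK0 := path_avoid_component (lab_path L) (lab_uniq L) (@lab_sub _ _ _ _ _ L) vK uK.
have subr : {subset v :: r <= H'}.
  by move=> t tr; rewrite inE rK0 // (lab_sub L).
have AH (A A' : {set T}) : A \subset H' -> A' \subset A :|: K0 -> A' \subset H.
  move=> sA sA'; apply: (subset_trans sA'); rewrite subUset K0H andbT.
  exact: subset_trans sA H'H.
have D (A A' B : {set T}) : A \subset H' -> [disjoint A & A'] -> B \subset A' :|: K0 -> [disjoint A & B].
  move=> /subsetP sA AA' /subsetP sB; apply/pred0P => t /=; apply/negP => /andP[tA /sB].
  by rewrite inE (disjointFr AA' tA) /=; have := sA t tA; rewrite inE => /andP[/negbTE->].
split=> //.
- exact: conn_minus_component.
- exact: lab_path L.
- exact: lab_uniq L.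
- by move=> a b /(lab_edge L); apply: exposed_edgeS.
- move=> x xH'; have xH : x \in H := subsetP H'H x xH'.
  have base : x \in N2 :|: N3 -> exposed H' x by move/(lab_exp L xH); apply: exposedS.
  (* A cycle in [H'] that misses [w] misses all of [w |: K0], so [w] is on the same side of it as a
     labelled vertex of [K0]. *)
  have wexp N : N \subset N2 :|: N3 -> hits K0 N -> exposed H' w.
    move=> sN /hitsP[k kK kN] X f cyX XH fX wX y ewy.
    have kexp := lab_exp L (subsetP K0H k kK) (subsetP sN k kN).
    have Koff t : t \in w |: K0 -> t \notin X.
      case/setU1P=> [->//|tK]; apply/negP => /XH.
      by rewrite inE tK.
    have cKw := component_link_conn cH wH zH.
    have kX : k \notin X by apply: Koff; rewrite inE kK orbT.
    have XH2 : {subset X <= H} by move=> t /XH/(subsetP H'H).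
    have [t ekt] : exists t, e k t.
      have [s [ps ls _ _]] := conn_path cH (subsetP K0H k kK) wH.
      case: s ps ls => [_ /= kw|t s /= /andP[ekt _] _]; last by exists t.
      by case/negP: wK0; rewrite -kw.
    rewrite -(kexp X f cyX XH2 fX kX t ekt).
    apply: (face_fun_conn G fX.1.1 cKw) => //; rewrite ?setU11 ?setU1r //.
    by move=> c d /Koff cX ecd; apply: (off_cycle fX.1 cX ecd).
  case/setUP; rewrite /lab; case: ifP => hK.
  + case/setU1P=> [->|xN]; first exact: (wexp N2 (subsetUl _ _) hK).
    by apply: base; rewrite inE xN.
  + by move=> xN; apply: base; rewrite inE xN.
  + case/setU1P=> [->|xN]; first exact: (wexp N3 (subsetUr _ _) hK).
    by apply: base; rewrite inE xN orbT.
  + by move=> xN; apply: base; rewrite inE xN orbT.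
- move=> A A' cA cA' sA sA' AA' vA uA hR hN.
  have [N [sN hN']] : exists N, N \subset N2 :|: N3 /\ hits A' (lab N).
    case/hitsP: hN => x xA; rewrite inE => /orP[]xN.
      by exists N2; split; [apply: subsetUl | apply/hitsP; exists x].
    by exists N3; split; [apply: subsetUr | apply/hitsP; exists x].
  have [B [cB AB BA hB _]] := lab_extend cA' sA' hN'.
  apply: (lab_cross1 L cA cB _ _ _ vA uA).
  + exact: subset_trans sA H'H.
  + exact: AH sA' BA.
  + exact: D sA AA' BA.
  + exact: hitsS AB (subxx _) hR.
  + exact: hitsS (subxx _) sN hB.
- move=> A A' cA cA' sA sA' AA' vA uA h2 h3.
  have [B [cB AB BA hB Bw]] := lab_extend cA sA h2.
  have [B' [cB' AB' BA' hB' Bw']] := lab_extend cA' sA' h3.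
  have BB' : [disjoint B & B'].
    have [wA|/Bw->] := boolP (w \in A); last exact: D sA AA' BA'.
    rewrite Bw' ?(disjointFr AA') // disjoint_sym.
    by apply: D sA' _ BA; rewrite disjoint_sym.
  apply: (lab_cross2 L cB cB' _ _ BB' _ _ hB hB').
  + exact: AH sA BA.
  + exact: AH sA' BA'.
  + exact: (subsetP AB).
  + exact: (subsetP AB').
Qed.

(** Consider a bridge that meets [K0]. If [w] is on the path, the bridge lies in [K0] and has at
    most the attachment [w]. Otherwise the bridge of [w] in [H'] has all its attachments and, by
    inheritance, all its labels. *)
Lemma tutte_path_remove : tutte_path H v r N2 N3.
Proof.
have ltH : #|H'| < #|H|.
  apply: proper_card; apply/properP; split=> //; exists z; last by rewrite inE component_id.
  by move: zH; rewrite inE => /andP[].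
have [p [pp lp up sp bp]] := IH ltH labelled_remove.
exists p; split=> // [t /sp/(subsetP H'H)//|K cK KH].
set P := [set t in v :: p] in bp KH *.
have PH' : P \subset H' by apply/subsetP => t; rewrite inE => /sp.
have KsubH x : x \in K -> (x \in H) && (x \notin P).
  by move/(subsetP KH); rewrite inE andbC.
have N0 N : hits K N -> K \subset H' -> hits K (lab N).
  move=> hK _; apply: hitsS hK => //; rewrite /lab; case: ifP => // _; exact: subsetUr.
have [KK0|/pred0Pn[k0 /andP[/= k0K k0K0]]] := boolP [disjoint K & K0].
  have KH' : K \subset H'.
    by apply/subsetP => x xK; rewrite inE (disjointFr KK0 xK); case/andP: (KsubH x xK).
  have KP : K \subset H' :\: P.
    by apply/subsetP => x xK; have /andP[_ xP] := KsubH x xK; rewrite inE xP (subsetP KH').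
  apply: leq_trans (bp K cK KP).
  rewrite !leq_add // leq_hits // => h; exact: N0.
have rK0 := path_avoid_component (lab_path L) (lab_uniq L) (@lab_sub _ _ _ _ _ L) vK uK.
have [wP|wP] := boolP (w \in P).
  have sK : K \subset K0.
    apply: (conn_sub_closed cK k0K k0K0) => x y xK yK xK0 exy.
    have /andP[yH yP] := KsubH y yK.
    have := K0_closed xK0 yH exy; rewrite in_setU1 => /predU1P[yw|//].
    by rewrite yw wP in yP.
  have att1 : #|attached e K P| <= 1.
    rewrite -(cards1 w); apply: subset_leq_card; apply/subsetP => y /attachedP[yP [x xK exy]].
    have yH' := subsetP PH' y yP; move: yH'; rewrite in_setD => /andP[yK0 yH].
    have := K0_closed (subsetP sK x xK) yH exy.
    by rewrite in_setU1 (negbTE yK0) orbF => /eqP->; rewrite set11.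
  have -> : hits K [set t in v :: r] = false.
    apply/hitsP => -[x xK]; rewrite inE => /rK0/negP[]; exact: (subsetP sK).
  by move: att1; case: (hits _ _); case: (hits _ _); case: #|_| => [|[|]].
have wD : w \in H' :\: P by rewrite inE wP.
pose K1 := component (H' :\: P) w.
have cK1 : conn K1 by apply: component_conn.
have K1s : K1 \subset H' :\: P by apply: component_sub.
have wK1 : w \in K1 by apply: component_id.
have sK : K \subset K1 :|: K0.
  apply: (conn_sub_closed cK k0K); first by rewrite inE k0K0 orbT.
  move=> x y xK yK xU exy; have /andP[yH yP] := KsubH y yK; rewrite inE.
  have [yK0|yK0] := boolP (y \in K0); first by rewrite orbT.
  have yD : y \in H' :\: P by rewrite in_setD yP in_setD yK0.
  rewrite orbF; case/setUP: xU => [xK1|xK0]; first exact: component_closed xK1 yD exy.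
  by have := K0_closed xK0 yH exy; rewrite in_setU1 (negbTE yK0) orbF => /eqP->.
apply: leq_trans (bp K1 cK1 K1s).
have hK1 N : hits K N -> hits K1 (lab N).
  move=> /hitsP[x xK xN]; case/setUP: (subsetP sK x xK) => [xK1|xK0].
    by apply/hitsP; exists x; rewrite // /lab; case: ifP => //; rewrite !inE xN orbT.
  have hK0 : hits K0 N by apply/hitsP; exists x.
  by apply/hitsP; exists w; rewrite // /lab hK0 setU11.
have hKR : hits K [set t in v :: r] -> hits K1 [set t in v :: r].
  move=> /hitsP[x xK xr]; apply/hitsP; exists x => //.
  case/setUP: (subsetP sK x xK) => // xK0.
  by move: xr; rewrite inE => /rK0; rewrite xK0.
rewrite !leq_add // ?leq_hits //; try exact: hK1.
apply: subset_leq_card; apply/subsetP => y /attachedP[yP [x xK exy]].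
apply/attachedP; split=> //; case/setUP: (subsetP sK x xK) => [xK1|xK0]; first by exists x.
have := subsetP PH' y yP; rewrite in_setD => /andP[yK0 yH].
have := K0_closed xK0 yH exy; rewrite in_setU1 (negbTE yK0) orbF => /eqP yw.
by rewrite -yw yP in wP.
Qed.

End RemoveComponent.

(** Every component of [H :\ w] contains an end of [r] and the ends are separated, so [H] consists
    of [w |: V1] and [w |: V2], and [r] passes through [w]. Paths of the two pieces are joined at
    [w], and each bridge stays in one piece. *)
Lemma tutte_path_split H v r N2 N3 w :
  (forall H' v r N2 N3, #|H'| < #|H| ->
     labelled H' v r N2 N3 -> tutte_path H' v r N2 N3) ->
  labelled H v r N2 N3 -> w \in H -> v != w -> last v r != w ->
  last v r \notin component (H :\ w) v ->
  (forall z, z \in H :\ w ->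
     (v \in component (H :\ w) z) || (last v r \in component (H :\ w) z)) ->
  tutte_path H v r N2 N3.
Proof.
move=> IH L wH nvw nuw uV1 cov; have cH := lab_conn L.
have pr := lab_path L; have ur := lab_uniq L; have sr := @lab_sub _ _ _ _ _ L.
set u := last v r in nuw uV1 cov.
have vH : v \in H by apply: sr; rewrite mem_head.
have uH : u \in H by apply: sr; rewrite mem_last.
have vHw : v \in H :\ w by rewrite !inE nvw.
have uHw : u \in H :\ w by rewrite !inE nuw.
pose V1 := component (H :\ w) v; pose V2 := component (H :\ w) u.
have V1V2 : [disjoint V1 & V2].
  apply/pred0P => t /=; apply/negP => /andP[t1 t2]; case/negP: uV1.
  by rewrite -(component_eq esym t1) (component_eq esym t2) component_id.
have covV z : z \in H -> z != w -> (z \in V1) || (z \in V2).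
  move=> zH nzw; have zHw : z \in H :\ w by rewrite !inE nzw.
  by case/orP: (cov z zHw) => /(component_eq esym); rewrite /V1 /V2 => ->; rewrite component_id ?orbT.
have VH z t : t \in component (H :\ w) z -> (t \in H) && (t != w).
  by move/(subsetP (component_sub _ _ _)); rewrite !inE andbC.
have V_closed z x y : x \in component (H :\ w) z -> y \in H -> e x y ->
    y \in w |: component (H :\ w) z.
  move=> xK yH exy; rewrite in_setU1; have [//|nyw] /= := eqVneq y w.
  by apply: component_closed xK _ exy; rewrite !inE nyw.
have cW1 : conn (w |: V1) by apply: component_link_conn.
have cW2 : conn (w |: V2) by apply: component_link_conn.
have W1H : w |: V1 \subset H.
  by apply/subsetP => t /setU1P[->//|/VH/andP[]].
have W2H : w |: V2 \subset H.
  by apply/subsetP => t /setU1P[->//|/VH/andP[]].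
have wV1 : w \notin V1 by apply/negP => /VH/andP[_]; rewrite eqxx.
have wV2 : w \notin V2 by apply/negP => /VH/andP[_]; rewrite eqxx.
have stay x s z : path e x s -> {subset x :: s <= H} -> w \notin x :: s ->
    x \in component (H :\ w) z -> {subset x :: s <= component (H :\ w) z}.
  move=> ps ss ws xz y ys.
  have sK : [set y in x :: s] \subset component (H :\ w) z.
    apply: (component_max (path_conn esym ps) _ _ xz); last by rewrite inE mem_head.
    apply/subsetP => c; rewrite inE => cs; rewrite !inE ss // andbT.
    by apply: contraNneq ws => <-.
  by apply: (subsetP sK); rewrite inE.
have wr : w \in v :: r.
  apply: contraR uV1 => wr; apply: (stay v r v pr sr wr); first exact: component_id.
  by rewrite mem_last.
have [r1 [r2 [Er lr1]]] : exists r1 r2, r = r1 ++ r2 /\ last v r1 = w.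
  by case/splitPl: wr => r1 r2 lr1; exists r1, r2.
move: pr; rewrite Er cat_path lr1 => /andP[pr1 pr2].
have lr2 : last w r2 = u by rewrite /u Er last_cat lr1.
have u1 : uniq (v :: r1).
  by move: ur; rewrite Er -cat_cons cat_uniq => /and3P[].
have disj12 t : t \in v :: r1 -> t \in r2 -> False.
  move: ur; rewrite Er -cat_cons cat_uniq => /and3P[_ /hasPn D _] t1 /D /=.
  by rewrite t1.
have u2 : uniq (w :: r2).
  move: ur; rewrite Er -cat_cons cat_uniq => /and3P[_ _ ur2] /=; rewrite ur2 andbT.
  by apply/negP => /(disj12 w); apply; rewrite -lr1 mem_last.
have s1 : {subset v :: r1 <= H}.
  by move=> t t1; apply: sr; rewrite Er -cat_cons mem_cat t1.
have s2 : {subset w :: r2 <= H}.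
  move=> t; rewrite inE => /predU1P[->//|t2]; apply: sr.
  by rewrite Er -cat_cons mem_cat t2 orbT.
have sub1 : {subset v :: r1 <= w |: V1}.
  move: lr1 pr1 u1 s1; clear disj12 Er.
  case/lastP: r1 => [|r1 w']; first by move=> /= E; rewrite E eqxx in nvw.
  rewrite last_rcons => ->; rewrite rcons_path => /andP[p1 _].
  rewrite -rcons_cons rcons_uniq => /andP[w1 _] s1 t.
  rewrite mem_rcons in_cons in_setU1 => /orP[->//|t1].
  rewrite (stay v r1 v) ?orbT //; last exact: component_id.
  by move=> c c1; apply: s1; rewrite mem_rcons inE c1 orbT.
have sub2 : {subset w :: r2 <= w |: V2}.
  move: lr2 pr2 u2 s2; clear disj12 Er.
  case: r2 => [|x r2] /=; first by move=> E; rewrite E eqxx in nuw.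
  move=> l2 /andP[_ p2] /andP[w2 _] ss t.
  rewrite in_cons in_setU1 => /orP[->//|t2].
  have xu : u \in [set t in x :: r2] by rewrite inE -l2 mem_last.
  have sK : [set t in x :: r2] \subset V2.
    apply: (component_max (path_conn esym p2) _ xu); last exact: component_id.
    apply/subsetP => c; rewrite inE => cs; rewrite !inE ss ?andbT //.
      by apply: contraNneq w2 => <-.
    by rewrite inE cs orbT.
  by apply/orP; right; apply: (subsetP sK); rewrite inE.
have wpar1 a b : wpar v r1 a b -> exposed_edge H a b.
  move=> w1; apply: (lab_edge L); rewrite Er wpar_cat lr1.
  have -> : wpar w r2 a b = false; last by rewrite addbF w1.
  apply/negP => w2; have /andP[a1 b1] := wpar_mem w1; have /andP[a2 b2] := wpar_mem w2.
  have eqw t : t \in v :: r1 -> t \in w :: r2 -> t = w.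
    by move=> t1; rewrite inE => /predU1P[//|/(disj12 t t1)].
  have := wpar_rel esym pr1 w1; rewrite (eqw a) // (eqw b) // eirr //.
have wpar2 a b : wpar w r2 a b -> exposed_edge H a b.
  move=> w2; apply: (lab_edge L); rewrite Er wpar_cat lr1.
  have -> : wpar v r1 a b = false; last by [].
  apply/negP => w1; have /andP[a1 b1] := wpar_mem w1; have /andP[a2 b2] := wpar_mem w2.
  have eqw t : t \in v :: r1 -> t \in w :: r2 -> t = w.
    by move=> t1; rewrite inE => /predU1P[//|/(disj12 t t1)].
  have := wpar_rel esym pr1 w1; rewrite (eqw a) // (eqw b) // eirr //.
have setUx (A t : {set T}) : A \subset w |: t -> w \notin A -> A \subset t.
  move=> /subsetP sA wA; apply/subsetP => x xA; have := sA x xA.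
  by rewrite in_setU1 => /predU1P[xw|//]; rewrite -xw xA in wA.
(* In a crossing condition of one piece, the set that contains [w] is prolonged by the whole other
   piece to reach the far end of [r]. *)
have ext (A A' V V' : {set T}) : A \subset w |: V -> A' \subset w |: V -> w \in A ->
    [disjoint A & A'] -> [disjoint V & V'] -> [disjoint A :|: (w |: V') & A'].
  move=> sA sA' wA AA' VV'.
  have wA' : w \notin A' by rewrite (disjointFr AA' wA).
  have sV := setUx _ _ sA' wA'.
  apply/pred0P => t /=; apply/negP => /andP[]; rewrite !in_setU in_set1.
  case/or3P=> [tA|/eqP->|tV'] tA'; first by rewrite (disjointFr AA' tA) in tA'.
    by rewrite tA' in wA'.
  by have := subsetP sV t tA'; rewrite (disjointFl VV' tV').
have extc (A V' : {set T}) : conn A -> w \in A -> conn (w |: V') -> conn (A :|: (w |: V')).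
  by move=> cA wA cV'; apply: connU cA cV' wA (setU11 _ _) _ => //; rewrite eqxx.
have V2V1 : [disjoint V2 & V1] by rewrite disjoint_sym.
have L1 : labelled (w |: V1) v r1 N2 N3.
  split=> //.
  - by move=> a b /wpar1; apply: exposed_edgeS.
  - by move=> x /(subsetP W1H) xH /(lab_exp L xH); apply: exposedS.
  - move=> A A' cA cA' sA sA' AA' vA; rewrite lr1 => wA hR hN.
    apply: (lab_cross1 L (extc _ _ cA wA cW2) cA' _ _ (ext _ _ _ _ sA sA' wA AA' V1V2)).
    + by rewrite subUset W2H andbT; apply: subset_trans sA W1H.
    + exact: subset_trans sA' W1H.
    + by rewrite inE vA.
    + by rewrite !in_setU component_id ?orbT.
    + apply: hitsS (subxx _) _ hR; apply/subsetP => t; rewrite !(inE, Er, mem_cat).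
      by case/orP=> ->; rewrite ?orbT.
    + exact: hN.
  - move=> A A' cA cA' sA sA' AA' vA; rewrite lr1 => wA h2 h3.
    have A'A : [disjoint A' & A] by rewrite disjoint_sym.
    have D := ext _ _ _ _ sA' sA wA A'A V1V2.
    apply: (lab_cross2 L cA (extc _ _ cA' wA cW2) _ _ _ _ _ h2).
    + exact: subset_trans sA W1H.
    + by rewrite subUset W2H andbT; apply: subset_trans sA' W1H.
    + by rewrite disjoint_sym.
    + by [].
    + by rewrite !in_setU component_id ?orbT.
    + by apply: hitsS h3 => //; apply: subsetUl.
have L2 : labelled (w |: V2) w r2 N2 N3.
  split=> //.
  - by move=> a b /wpar2; apply: exposed_edgeS.
  - by move=> x /(subsetP W2H) xH /(lab_exp L xH); apply: exposedS.
  - move=> A A' cA cA' sA sA' AA' wA; rewrite lr2 => uA hR hN.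
    apply: (lab_cross1 L (extc _ _ cA wA cW1) cA' _ _ (ext _ _ _ _ sA sA' wA AA' V2V1)).
    + by rewrite subUset W1H andbT; apply: subset_trans sA W2H.
    + exact: subset_trans sA' W2H.
    + by rewrite !in_setU component_id ?orbT.
    + by rewrite inE uA.
    + case/hitsP: hR => t tA' tr; apply/hitsP; exists t => //.
      move: tr; rewrite !(inE, Er, mem_cat) => /predU1P[tw|->]; last by rewrite !orbT.
      by move: tA'; rewrite tw (disjointFr AA' wA).
    + exact: hN.
  - move=> A A' cA cA' sA sA' AA' wA; rewrite lr2 => uA h2 h3.
    apply: (lab_cross2 L (extc _ _ cA wA cW1) cA' _ _ (ext _ _ _ _ sA sA' wA AA' V2V1) _ _ _ h3).
    + by rewrite subUset W1H andbT; apply: subset_trans sA W2H.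
    + exact: subset_trans sA' W2H.
    + by rewrite !in_setU component_id ?orbT.
    + by [].
    + by apply: hitsS h2 => //; apply: subsetUl.
have lt1 : #|w |: V1| < #|H|.
  apply: proper_card; apply/properP; split=> //; exists u => //.
  by rewrite in_setU1 (negbTE nuw) (negbTE uV1).
have lt2 : #|w |: V2| < #|H|.
  apply: proper_card; apply/properP; split=> //; exists v => //.
  rewrite in_setU1 (negbTE nvw) /=; apply/negP => vV2.
  by move/pred0P/(_ v): V1V2; rewrite /= vV2 component_id.
have [p1 [pp1 lp1 up1 sp1 bp1]] := IH _ _ _ _ _ lt1 L1.
have [p2 [pp2 lp2 up2 sp2 bp2]] := IH _ _ _ _ _ lt2 L2.
rewrite lr1 in lp1; rewrite lr2 in lp2.
have w1P : w \in v :: p1 by rewrite -lp1 mem_last.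
exists (p1 ++ p2); split.
- by rewrite cat_path pp1 lp1.
- by rewrite !last_cat lp1 lp2 lr1.
- rewrite -cat_cons cat_uniq up1; move: up2 => /= /andP[w2 ->]; rewrite andbT /=.
  apply/hasPn => t t2; apply/negP => /= t1.
  have ntw : t != w by apply: contraNneq w2 => <-.
  have := sp1 t t1; have := sp2 t; rewrite inE t2 orbT => /(_ isT).
  rewrite !in_setU1 (negbTE ntw) /= => tV2 tV1.
  by rewrite (disjointFr V1V2 tV1) in tV2.
- move=> t; rewrite -cat_cons mem_cat => /orP[/sp1/(subsetP W1H)//|t2].
  by apply: (subsetP W2H); apply: sp2; rewrite inE t2 orbT.
move=> K cK KH; set P := [set z in v :: p1 ++ p2] in KH *.
have KsubH x : x \in K -> (x \in H) && (x \notin P).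
  by move/(subsetP KH); rewrite inE andbC.
have wP : w \in P by rewrite inE -cat_cons mem_cat w1P.
have wK : w \notin K by apply/negP => /KsubH; rewrite wP andbF.
have [->|/set0Pn[k kK]] := eqVneq K set0.
  have att0 : #|attached e set0 P| = 0.
    by apply: eq_card0 => y; apply/negP => /attachedP[_ [x]]; rewrite inE.
  have h0 N : hits set0 N = false by apply/hitsP => -[x]; rewrite inE.
  by rewrite att0 !h0.
have kw : k != w by apply: contraNneq wK => <-.
have /andP[kH _] := KsubH k kK.
have inV z : k \in component (H :\ w) z -> K \subset component (H :\ w) z.
  move=> kV; apply: (conn_sub_closed cK kK kV) => x y xK yK xV exy.
  have /andP[yH _] := KsubH y yK; have := V_closed _ _ _ xV yH exy.
  by rewrite in_setU1 => /predU1P[yw|//]; rewrite -yw yK in wK.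
have sp1' t : t \in v :: p1 -> t \in w |: V1 by apply: sp1.
have sp2' t : t \in w :: p2 -> t \in w |: V2 by apply: sp2.
case/orP: (covV k kH kw) => /inV sKV.
- have KD : K \subset (w |: V1) :\: [set z in v :: p1].
    apply/subsetP => x xK; rewrite in_setD setU1r ?(subsetP sKV) // andbT inE.
    have /andP[_] := KsubH x xK; apply: contra => xp.
    by rewrite inE -cat_cons mem_cat xp.
  apply: leq_trans (bp1 K cK KD); rewrite !leq_add //.
    apply: subset_leq_card; apply/subsetP => y /attachedP[yP [x xK exy]].
    apply/attachedP; split; last by exists x.
    have yH : y \in H.
      move: yP; rewrite /P !in_set -cat_cons mem_cat => /orP[/sp1'/(subsetP W1H)//|y2].
      by apply: (subsetP W2H); apply: sp2'; rewrite inE y2 orbT.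
    have yW := V_closed v _ _ (subsetP sKV x xK) yH exy.
    move: yP; rewrite /P !in_set -cat_cons mem_cat => /orP[//|y2].
    have := sp2' y; rewrite inE y2 orbT => /(_ isT); rewrite in_setU1.
    move=> /predU1P[->//|yV2]; move: yW; rewrite in_setU1 => /predU1P[->//|yV1].
    by rewrite (disjointFr V1V2 yV1) in yV2.
  apply: leq_hits => /hitsP[t tK tr]; apply/hitsP; exists t => //.
  move: tr; rewrite !inE mem_cat => /or3P[->//|->|t2]; rewrite ?orbT //.
  have := sub2 t; rewrite inE t2 orbT => /(_ isT); rewrite in_setU1 => /predU1P[tw|tV2].
    by rewrite -tw tK in wK.
  by rewrite (disjointFr V1V2 (subsetP sKV t tK)) in tV2.
- have KD : K \subset (w |: V2) :\: [set z in w :: p2].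
    apply/subsetP => x xK; rewrite in_setD setU1r ?(subsetP sKV) // andbT inE.
    have /andP[_] := KsubH x xK; apply: contra; rewrite inE => /predU1P[->|xp]; first by [].
    by rewrite inE -cat_cons mem_cat xp orbT.
  apply: leq_trans (bp2 K cK KD); rewrite !leq_add //.
    apply: subset_leq_card; apply/subsetP => y /attachedP[yP [x xK exy]].
    apply/attachedP; split; last by exists x.
    have yH : y \in H.
      move: yP; rewrite /P !in_set -cat_cons mem_cat => /orP[/sp1'/(subsetP W1H)//|y2].
      by apply: (subsetP W2H); apply: sp2'; rewrite inE y2 orbT.
    have yW := V_closed u _ _ (subsetP sKV x xK) yH exy.
    move: yP; rewrite /P !in_set -cat_cons mem_cat => /orP[/sp1'|y2]; last by rewrite inE y2 orbT.
    rewrite in_setU1 => /predU1P[->|yV1]; first by rewrite ?mem_head ?inE ?eqxx.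
    move: yW; rewrite in_setU1 => /predU1P[->|yV2]; first by rewrite ?mem_head ?inE ?eqxx.
    by rewrite (disjointFr V1V2 yV1) in yV2.
  apply: leq_hits => /hitsP[t tK tr]; apply/hitsP; exists t => //.
  move: tr; rewrite in_set -cat_cons mem_cat => /orP[/sub1|t2]; last by rewrite !inE t2 orbT.
  rewrite in_setU1 => /predU1P[tw|tV1]; first by rewrite -tw tK in wK.
  by move: (subsetP sKV t tK); rewrite (disjointFr V1V2 tV1).
Qed.

Lemma cpar_rev X a b : cpar (rev X) a b = cpar X a b.
Proof.
case: X => // x p; rewrite rev_cons -(cpar_rot (size (rev p))).
rewrite -cats1 rot_size_cat /= -(wpar_rev x (rcons p x)) last_rcons belast_rcons.
by rewrite rev_cons.
Qed.

Lemma is_graph_cycle_rev X : is_graph_cycle e X -> is_graph_cycle e (rev X).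
Proof.
rewrite /is_graph_cycle size_rev rev_uniq rev_cycle => /and3P[-> -> cX] /=.
by rewrite (eq_cycle (e' := e)) // => x y; rewrite /= esym.
Qed.

Lemma wpar_uniq_path (R : rel T) v r : uniq (v :: r) ->
  (forall a b, wpar v r a b -> R a b) -> path R v r.
Proof.
elim: r v => //= y r IHr v /andP[vr ur] Rw; apply/andP; split.
  by apply: Rw; rewrite (wpar_notin _ vr) addbF /same_edge !eqxx.
apply: IHr => // a b wab; apply: Rw; rewrite wab addbT.
have /andP[ar br] := wpar_mem wab; rewrite /same_edge.
have -> : a == v = false by apply: contraNF vr => /eqP<-.
have -> : b == v = false by apply: contraNF vr => /eqP<-.
by rewrite andbF.
Qed.

(** The first edge of [r] fixes the direction, by a reflection if necessary; afterwards a path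
    without repetitions can only go forward. *)
Lemma path_on_cycle X v r : is_graph_cycle e X -> uniq (v :: r) -> r != [::] ->
  path (cpar X) v r -> exists Y A, [/\ is_graph_cycle e Y, cpar Y =2 cpar X,
    Y =i X & Y = v :: r ++ A].
Proof.
move=> cyX; elim/last_ind: r => // r z IHr ur _; rewrite rcons_path => /andP[pr lz].
have ur' : uniq (v :: r) by move: ur; rewrite -rcons_cons rcons_uniq => /andP[].
have zr : z \notin v :: r by move: ur; rewrite -rcons_cons rcons_uniq => /andP[].
have /and3P[sX uX cX] := cyX.
have [r0|r0] := eqVneq r [::].
  rewrite {}r0 /= in lz zr *.
  have /andP[vX zX] := cpar_mem lz; have [i s E] := rot_to vX.
  have cyE : is_graph_cycle e (v :: s) by rewrite -E is_graph_cycle_rot.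
  case: s E cyE => [|b s] E cyE; first by case/and3P: cyE.
  have s0 : s != [::] by case/and3P: cyE; case: (s).
  have uE : uniq [:: v, b & s] by case/and3P: cyE.
  have: cpar [:: v, b & s] v z by rewrite -E cpar_rot.
  rewrite cpar_head // => /orP[]/eqP Ez.
    exists [:: v, b & s], s; split; rewrite ?Ez //.
      by move=> x y; rewrite -E cpar_rot.
    by move=> x; rewrite -E mem_rot.
  have E' : v :: rev (b :: s) = rot (size (rev (b :: s))) (rev (v :: b :: s)).
    by rewrite [rev (v :: _)]rev_cons -cats1 rot_size_cat.
  exists (v :: rev (b :: s)), (behead (rev (b :: s))); split.
  - by rewrite E'; apply/is_graph_cycle_rot/is_graph_cycle_rev.
  - by move=> x y; rewrite E' cpar_rot cpar_rev -E cpar_rot.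
  - by move=> x; rewrite E' mem_rot mem_rev -E mem_rot.
  - congr (_ :: _); rewrite Ez; case/lastP: s {E E' cyE uE Ez} s0 => // s t _.
    by rewrite last_rcons -rcons_cons rev_rcons.
have [Y [A [cyY YX YiX EY]]] := IHr ur' r0 pr.
have lY : cpar Y (last v r) z by rewrite YX.
have ErY : rot (size (belast v r)) Y = last v r :: A ++ belast v r.
  by rewrite EY -cat_cons lastI cat_rcons rot_size_cat.
have uY : uniq (last v r :: A ++ belast v r).
  by rewrite -ErY rot_uniq; case/and3P: cyY.
have br : belast v r != [::] by case: (r) r0.
have lb : last (head v A) (belast v r) \in v :: r.
  rewrite lastI mem_rcons in_cons; case: (belast v r) br => // c t _ /=.
  by rewrite mem_last orbT.
case: A EY ErY uY lb => [|b A] EY ErY uY lb.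
  have : z \in Y by case/andP: (cpar_mem lY).
  by rewrite EY cats0 (negbTE zr).
move: lY; rewrite -(cpar_rot (size (belast v r))) ErY cat_cons cpar_head -?cat_cons //; last first.
  by case: (A) br.
rewrite last_cat => /orP[]/eqP Ez; last first.
  case/negP: zr; rewrite Ez; case: (belast v r) br lb => // c t _ /=.
by exists Y, A; split=> //; rewrite EY Ez cat_rcons.
Qed.

(* Thomassen's form of Tutte's theorem: a path between the ends of an arc of the outer cycle,
   visiting both ends of a prescribed edge of the arc, whose bridges have at most three attachments, and at
   most two if they meet the outer cycle. *)
Definition disc_tutte B : Prop := forall v q y r S f,
  let X := (v :: q) ++ (y :: r) ++ S in
  is_graph_cycle e X -> {subset X <= B} -> interior f X ->
  (forall a b, a \in B -> b \in B -> e a b -> inside f a b) ->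
  exists p, [/\ path e v p, last v p = last y r, uniq (v :: p),
    {subset v :: p <= B} & [/\ last v q \in v :: p, y \in v :: p
    & forall K, conn K -> K \subset B :\: [set z in v :: p] ->
      #|attached e K [set z in v :: p]| + hits K [set z in X] <= 3]].

Lemma split_last_sat (a : pred T) (s : seq T) : exists s1 s2,
  [/\ s = s1 ++ s2, {in s2, forall x, ~~ a x} & s1 = [::] \/
      exists t x, s1 = rcons t x /\ a x].
Proof.
elim/last_ind: s => [|s x [s1 [s2 [-> H2 H1]]]]; first by exists [::], [::]; split=> //; left.
have [ax|ax] := boolP (a x).
  exists (rcons (s1 ++ s2) x), [::]; split; rewrite ?cats0 //.
  by right; exists (s1 ++ s2), x.
exists s1, (rcons s2 x); split=> //; first by rewrite rcons_cat.
by move=> z; rewrite mem_rcons inE => /predU1P[->|/H2].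
Qed.

(** As its edges are exposed, [r] runs along the outer cycle, and labelled vertices of a bridge lie
    on the complementary arc [W]. The prescribed edge for [disc_tutte] is chosen to follow the last
    vertex of [N3] on [W]. Then a bridge touches at most one of the three labels, and only if it
    meets the outer cycle. *)
Lemma tutte_path_block H v r N2 N3 : disc_tutte H -> labelled H v r N2 N3 ->
  v != last v r -> (forall w, w \in H -> conn (H :\ w)) -> tutte_path H v r N2 N3.
Proof.
move=> DT L nvu cHw; have cH := lab_conn L; have ur := lab_uniq L.
have sr := @lab_sub _ _ _ _ _ L; have pr := lab_path L.
have r0 : r != [::] by apply: contraNneq nvu => ->.
have [leH|ltH] := leqP #|H| 2.
  have HR : H \subset [set z in v :: r].
    have c2 : #|[set v; last v r]| = 2 by rewrite cards2 nvu.
    have EH : H = [set v; last v r].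
      apply/eqP; rewrite eq_sym; rewrite eqEcard c2 leH andbT.
      by apply/subsetP => t /set2P[]->; apply: sr; rewrite ?mem_head ?mem_last.
    by rewrite EH; apply/subsetP => t /set2P[]->; rewrite inE ?mem_head ?mem_last.
  exists r; split=> // K cK; rewrite (_ : _ :\: _ = set0); last first.
    by apply/eqP; rewrite setD_eq0.
  rewrite subset0 => /eqP->.
  have h0 N : hits set0 N = false by apply/hitsP => -[x]; rewrite inE.
  by rewrite !h0 (eq_card0 (A := attached _ _ _)) // => y; apply/negP => /attachedP[_ [x]]; rewrite inE.
have [X [f [cyX XH fX insH]]] := outer_cycle G e0 cH cHw ltH.
(* An exposed edge off the cycle would have no side in the disc, against [insH]. *)
have Redge : path (cpar X) v r.
  apply: wpar_uniq_path => // a b wab; apply: contraT => Xab.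
  have eab : e a b by apply: wpar_rel wab.
  have eba : e b a by rewrite esym.
  have fab := lab_edge L wab cyX XH fX Xab.
  have fba : f b a = false.
    have [[_ fE] _] := fX; have := fE b a eba.
    by rewrite cpar_sym (negbTE Xab) /bd fab addbF.
  have /andP[aR bR] := wpar_mem wab.
  by have := insH a b (sr _ aR) (sr _ bR) eab; rewrite /inside /= fab fba andbF.
have [Y [A [cyY YX YiX EY]]] := path_on_cycle cyX ur r0 Redge.
have uEr : exists T', r = rcons T' (last v r).
  by case/lastP: r r0 {L ur sr pr nvu Redge EY} => // T' u _; exists T'; rewrite last_rcons.
case: uEr; set u := last v r in nvu * => T' Er.
(* Turned around, the cycle reads [v], [W], [u], [T2], where [T2] is the inner part of [r]
   backwards. *)
pose W := rev A; pose T2 := rev T'.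
have [Z [cyZ ZX ZiX EZ]] : exists Z, [/\ is_graph_cycle e Z, cpar Z =2 cpar X, Z =i X
    & Z = v :: W ++ u :: T2].
  exists (rot (size (W ++ u :: T2)) (rev Y)); split.
  - exact/is_graph_cycle_rot/is_graph_cycle_rev.
  - by move=> a b; rewrite cpar_rot cpar_rev YX.
  - by move=> a; rewrite mem_rot mem_rev YiX.
  - rewrite EY Er -cat_cons rev_cat rev_cons rev_rcons -cats1 -cat_cons catA.
    by rewrite -/W -/T2 rot_size_cat.
have fZ : interior f Z.
  by case: fX => [[ff fE] f0]; split=> //; split=> // a b eab; rewrite fE // ZX.
have uZ : uniq Z by case/and3P: cyZ.
have ZH : {subset Z <= H} by move=> t; rewrite ZiX => /XH.
have [W1 [W2 [EW N3W2 W1l]]] := split_last_sat (mem N3) W.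
pose y := head u W2.
have [ry Ey] : exists ry, W2 ++ [:: u] = y :: ry.
  by rewrite /y; case: (W2) => [|c s]; [exists [::] | exists (s ++ [:: u])].
have ly : last y ry = u.
  by have := congr1 (last v) Ey; rewrite /= last_cat /= => ->.
have EZ' : Z = (v :: W1) ++ (y :: ry) ++ T2.
  by rewrite -Ey EZ EW -!catA /= -?catA.
have [||||p [pp lp up sp [xp yp bp]]] := DT v W1 y ry T2 f; rewrite -?EZ' //.
rewrite ly in lp; exists p; split=> // K cK KH.
apply: leq_trans (bp K cK KH); rewrite -EZ' -!addnA leq_add2l.
set P := [set z in v :: p] in KH; set x := last v W1 in xp.
have cP : conn P by apply: path_conn.
have PH : P \subset H by apply/subsetP => t; rewrite inE => /sp.
have KsubH t : t \in K -> (t \in H) && (t \notin P).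
  by move/(subsetP KH); rewrite inE andbC.
have PK : [disjoint P & K].
  by apply/pred0P => t /=; apply/negP => /andP[tP /KsubH]; rewrite tP andbF.
have vP : v \in P by rewrite inE mem_head.
have uP : u \in P by rewrite inE -lp mem_last.
have xP : x \in P by rewrite inE.
have insS (S : {set T}) : S \subset H -> forall a b, a \in S -> b \in S -> e a b -> inside f a b.
  by move=> /subsetP sS a b /sS aH /sS bH; apply: insH.
have KHs : K \subset H by apply/subsetP => t /KsubH/andP[].
(* All faces at an exposed vertex off the cycle are outside the disc, yet it has an edge inside. *)
have onZ N t : N \subset N2 :|: N3 -> t \in H -> t \in N -> t \in Z.
  move=> sN tH tN; apply: contraT => tZ.
  have texp := lab_exp L tH (subsetP sN t tN) cyZ ZH fZ tZ.
  have [z zH ntz] : exists2 z, z \in H & z != t.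
    have [<-|nvt] := eqVneq v t; last by exists v => //; apply: sr; rewrite mem_head.
    by exists u; [apply: sr; rewrite mem_last | rewrite eq_sym].
  have [[|b s] [ps ls ss _]] := conn_path cH tH zH; first by rewrite -ls eqxx in ntz.
  move: ps => /= /andP[etb _].
  have bH : b \in H by apply: ss; rewrite !inE eqxx orbT.
  have := insH t b tH bH etb; rewrite /inside /= etb texp //=.
  by have := off_cycle fZ.1 tZ etb; rewrite /bd texp //= => ->.
have idx (s1 s2 : seq T) (a b : T) : a \in s1 -> b \notin s1 ->
    index a (s1 ++ s2) < index b (s1 ++ s2).
  move=> a1 b1; rewrite !index_cat a1 (negbTE b1).
  by apply: leq_trans (leq_addr _ _); rewrite index_mem.
have catN (s1 s2 : seq T) t : uniq (s1 ++ s2) -> t \in s2 -> t \notin s1.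
  by rewrite cat_uniq => /and3P[_ /hasPn D _] /D.
have EZ2 : Z = (v :: W) ++ (u :: T2) by rewrite EZ.
have EZ3 : Z = ((v :: W) ++ [:: u]) ++ T2 by rewrite EZ /= -catA.
have T2r t : t \in T2 -> t \in v :: r.
  by rewrite /T2 mem_rev Er inE mem_rcons inE => ->; rewrite !orbT.
have inW N t : N \subset N2 :|: N3 -> t \in K -> t \in N -> t \in W.
  move=> sN tK tN; have /andP[tH tP] := KsubH t tK.
  have := onZ N t sN tH tN; rewrite EZ inE mem_cat inE => /predU1P[tv|]; first by rewrite tv vP in tP.
  case/or3P=> [//|/eqP tu|tT]; first by rewrite tu uP in tP.
  have cA : conn [set z in v :: rcons W u].
    apply: (path_conn esym); have /and3P[_ _] := cyZ.
    by rewrite EZ /= rcons_cat /= -cat_rcons cat_path => /andP[].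
  case: (lab_cross1 L cA (@conn1 _ e t)).
  - by apply/subsetP => z; rewrite inE => zW; apply: ZH; rewrite EZ3 mem_cat cats1 rcons_cons zW.
  - by rewrite sub1set.
  - rewrite disjoint_sym disjoints1 inE -rcons_cons -cats1.
    by apply: (catN _ T2); rewrite -?EZ3.
  - by rewrite inE mem_head.
  - by rewrite inE -/u in_cons mem_rcons mem_head orbT.
  - by apply/hitsP; exists t; rewrite ?set11 // inE T2r.
  - by apply/hitsP; exists t; rewrite ?set11 // (subsetP sN).
have s2 : N2 \subset N2 :|: N3 by apply: subsetUl.
have s3 : N3 \subset N2 :|: N3 by apply: subsetUr.
(* A bridge with vertices on [W] and on [T2] would cross the path from [v] to [u]. *)
have RN N : N \subset N2 :|: N3 -> hits K [set z in v :: r] -> hits K N -> False.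
  move=> sN /hitsP[t tK tr] /hitsP[w wK wN].
  have wW := inW N w sN wK wN; have /andP[_ tP] := KsubH t tK.
  have /andP[_ wP] := KsubH w wK.
  have tT : t \in T2.
    move: tr; rewrite inE Er inE mem_rcons inE => /or3P[/eqP tv|/eqP tu|].
    - by rewrite tv vP in tP.
    - by rewrite tu uP in tP.
    - by rewrite /T2 mem_rev.
  apply: (noncross_sets G (X := Z) (a := v) (b := w) (c := u) (d := t) cyZ fZ.1 _ _ _ _ cP cK PK) => //.
  - by rewrite EZ3 mem_cat tT orbT.
  - rewrite EZ -cat1s; apply: idx; rewrite ?inE //.
    by apply: contraNneq wP => ->.
  - rewrite EZ2; apply: idx; first by rewrite inE wW orbT.
    by apply: (catN _ (u :: T2)); rewrite -?EZ2 ?mem_head.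
  - rewrite EZ3; apply: idx; first by rewrite mem_cat mem_head orbT.
    by apply: (catN _ T2); rewrite -?EZ3.
  - exact: insS.
  - exact: insS.
(* The path visits [x], the last vertex of [N3] on [W]. If [b] comes after [x], the bridge crosses
   the path, which joins [x] and [u]; if before, the arcs from [v] to [b] and from [x] to [u]
   contradict [lab_cross2]. *)
have N23 : hits K N2 -> hits K N3 -> False.
  move=> /hitsP[b bK b2] /hitsP[a aK a3].
  have bW := inW N2 b s2 bK b2; have aW := inW N3 a s3 aK a3.
  have /andP[_ aP] := KsubH a aK; have /andP[_ bP] := KsubH b bK.
  have aW1 : a \in W1.
    by move: aW; rewrite EW mem_cat => /orP[//|/N3W2]; rewrite /= a3.
  case: W1l => [W10|[t [x' [EW1 x'3]]]]; first by rewrite W10 in aW1.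
  have Ex : x' = x by rewrite /x EW1 last_rcons.
  rewrite {}Ex in EW1 x'3.
  have EZx : Z = (v :: t) ++ (x :: W2 ++ u :: T2).
    by rewrite EZ EW EW1 cat_rcons /= -catA.
  have at' : a \in t.
    move: aW1; rewrite EW1 mem_rcons inE => /predU1P[ax|//].
    by rewrite ax xP in aP.
  move: bW; rewrite EW mem_cat => /orP[bW1|bW2]; last first.
    apply: (noncross_sets G (X := Z) (a := a) (b := x) (c := b) (d := u) cyZ fZ.1 _ _ _ _ cK cP) => //.
    - by rewrite EZ2 mem_cat mem_head orbT.
    - rewrite EZx; apply: idx; first by rewrite inE at' orbT.
      by apply: (catN _ (x :: W2 ++ u :: T2)); rewrite -?EZx ?mem_head.
    - have EZx2 : Z = (v :: rcons t x) ++ (W2 ++ u :: T2) by rewrite EZx /= cat_rcons.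
      rewrite EZx2; apply: idx; first by rewrite inE mem_rcons mem_head orbT.
      by apply: (catN _ (W2 ++ u :: T2)); rewrite -?EZx2 // mem_cat bW2.
    - rewrite EZ2; apply: idx; first by rewrite inE EW mem_cat bW2 !orbT.
      by apply: (catN _ (u :: T2)); rewrite -?EZ2 ?mem_head.
    - by rewrite disjoint_sym.
    - exact: insS.
    - exact: insS.
  have bt : b \in t.
    move: bW1; rewrite EW1 mem_rcons inE => /predU1P[bx|//].
    by rewrite bx xP in bP.
  have [A1 [A2 Et]] : exists A1 A2, t = rcons A1 b ++ A2.
    by case/splitPr: bt => A1 A2; exists A1, A2; rewrite cat_rcons.
  have cZ : path e v (t ++ (x :: W2) ++ u :: rcons T2 v).
    by have /and3P[_ _] := cyZ; rewrite EZx /= rcons_cat /= rcons_cat.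
  have cA1 : conn [set z in v :: rcons A1 b].
    by apply: (path_conn esym); move: cZ; rewrite Et -catA cat_path => /andP[].
  have cA2 : conn [set z in x :: rcons W2 u].
    apply: (path_conn esym); move: cZ; rewrite cat_path /= => /and3P[_ _].
    by rewrite -cat_rcons cat_path => /andP[].
  apply: (lab_cross2 L cA1 cA2).
  - apply/subsetP => z; rewrite in_set => z1; apply: ZH; rewrite EZx Et mem_cat -cat_cons.
    by rewrite mem_cat z1.
  - apply/subsetP => z; rewrite in_set => z1; apply: ZH; rewrite EZx mem_cat -cat_rcons -cat_cons.
    by rewrite (mem_cat z (x :: _)) z1 orbT.
  - apply/pred0P => z /=; apply/negP => /andP[]; rewrite !in_set => z1 z2.
    have : z \notin v :: t.
      apply: (catN _ (x :: W2 ++ u :: T2)); rewrite -?EZx //.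
      by rewrite -cat_rcons -cat_cons mem_cat z2.
    by case/negP; rewrite Et -cat_cons mem_cat z1.
  - by rewrite inE mem_head.
  - by rewrite inE in_cons mem_rcons mem_head orbT.
  - by apply/hitsP; exists b => //; rewrite inE in_cons mem_rcons mem_head orbT.
  - by apply/hitsP; exists x => //; rewrite inE mem_head.
have KZ : hits K [set z in v :: r] || hits K N2 || hits K N3 -> hits K [set z in Z].
  have lab N : N \subset N2 :|: N3 -> hits K N -> hits K [set z in Z].
    move=> sN /hitsP[t tK tN]; apply/hitsP; exists t => //; rewrite inE.
    by apply: (onZ N); case/andP: (KsubH t tK).
  case/orP=> [/orP[]|]; [|exact: lab|exact: lab].
  apply: hitsS => //; apply/subsetP => t.
  rewrite !in_set Er EZ !in_cons mem_rcons mem_cat !in_cons /T2 (mem_rev T').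
  by case/or3P=> ->; rewrite ?orbT.
move: KZ (RN N2 s2) (RN N3 s3) N23.
case: (hits K [set z in v :: r]); case: (hits K N2); case: (hits K N3) => //=.
- by move=> _ H1; case: (H1 isT isT).
- by move=> _ H1; case: (H1 isT isT).
- by move=> _ _ H1; case: (H1 isT isT).
- by move=> -> //.
- by move=> _ _ _ H1; case: (H1 isT isT).
- by move=> -> //.
- by move=> -> //.
Qed.

End Tutte.

(** * Tutte's theorem in a disc, by induction on the size of the disc *)

Section Disc.
Variables (T : finType) (e : rel T) (rho : T -> T -> T).
Hypothesis G : plane_graph e rho.
Variables a0 b0 : T.
Hypothesis e0 : e a0 b0.
Local Notation face := (face_fun e rho).
Local Notation is_bd := (is_bd e rho).
Local Notation inside := (inside e).
Local Notation interior := (interior e rho a0 b0).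
Local Notation exposed := (exposed e rho a0 b0).
Local Notation exposed_edge := (exposed_edge e rho a0 b0).
Local Notation conn := (conn e).
Local Notation component := (component e).
Local Notation labelled := (labelled e rho a0 b0).
Local Notation tutte_path := (tutte_path e).
Local Notation disc_tutte := (disc_tutte e rho a0 b0).
Let esym := pg_sym G.
Let eirr := pg_irr G.
Implicit Types (X : seq T) (H K P B N A : {set T}).

Lemma connP A : reflect (conn A) [forall x in A, forall y in A, connect (rel_in e A) x y].
Proof.
apply: (iffP forall_inP) => [cA x y xA yA|cA x xA]; first by have /forall_inP := cA x xA; apply.
by apply/forall_inP => y yA; apply: cA.
Qed.

(** Reduction to a 2-connected [H]: a component of [H :\ w] without an end of [r] is removed, and a
    cut vertex that separates the ends splits [H]. *)
Lemma labelled_tutte_path n : (forall B, #|B| <= n -> disc_tutte B) ->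
  forall H v r N2 N3, #|H| <= n -> labelled H v r N2 N3 -> tutte_path H v r N2 N3.
Proof.
move=> DT H; have [k] := ubnP #|H|; elim: k H => // k IHk H ltk v r N2 N3 leH L.
have IH H' v' r' M2 M3 : #|H'| < #|H| -> labelled H' v' r' M2 M3 ->
    tutte_path H' v' r' M2 M3.
  move=> lt; apply: IHk; first exact: leq_trans lt ltk.
  exact: leq_trans (ltnW lt) leH.
have [uv|nvu] := eqVneq v (last v r); first exact: (tutte_path_trivial _ L).
have sr := @lab_sub _ _ _ _ _ _ _ _ _ _ L.
have vH : v \in H by apply: sr; rewrite mem_head.
have uH : last v r \in H by apply: sr; rewrite mem_last.
have [/exists_inP[w wH /exists_inP[z zH /andP[vK uK]]]|no] := boolP [exists w in H,
    [exists z in H :\ w, (v \notin component (H :\ w) z) && (last v r \notin component (H :\ w) z)]].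
  exact: (tutte_path_remove G IH L wH zH vK uK).
have cov w z : w \in H -> z \in H :\ w ->
    (v \in component (H :\ w) z) || (last v r \in component (H :\ w) z).
  move=> wH zH; apply: contraNT no; rewrite negb_or => vu.
  by apply/exists_inP; exists w => //; apply/exists_inP; exists z.
have [/forall_inP cHw|] := boolP [forall w in H, [forall x in H :\ w, forall y in H :\ w, connect (rel_in e (H :\ w)) x y]].
  by apply: (tutte_path_block G e0 (DT _ leH) L nvu) => w wH; apply/connP/cHw.
rewrite negb_forall_in => /exists_inP[w wH /connP ncw].
have all_in t : t \in H :\ w -> (forall z, z \in H :\ w -> t \in component (H :\ w) z) -> False.
  move=> tH tz; apply: ncw; apply: (conn_from esym tH) => z zH.
  have : z \in component (H :\ w) t.
    by rewrite (component_eq esym (tz z zH)) component_id.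
  by rewrite inE => /andP[].
have notin t : w \notin component (H :\ w) t.
  by apply/negP => /(subsetP (component_sub _ _ _)); rewrite !inE eqxx.
have nvw : v != w.
  apply/eqP => E; apply: (all_in (last v r)); first by rewrite !inE -E eq_sym nvu.
  by move=> z zH; have := cov w z wH zH; rewrite E (negbTE (notin z)).
have nuw : last v r != w.
  apply/eqP => E; apply: (all_in v); first by rewrite !inE nvw.
  by move=> z zH; have := cov w z wH zH; rewrite E (negbTE (notin z)) orbF.
apply: (tutte_path_split G IH L wH nvw nuw); last by move=> z; apply: cov.
apply/negP => uV; apply: (all_in v); first by rewrite !inE nvw.
move=> z zH; case/orP: (cov w z wH zH) => // uz.
have vH' : v \in H :\ w by rewrite !inE nvw.
by rewrite -(component_eq esym uz) (component_eq esym uV) component_id.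
Qed.

(** * The path along the second arc, from [y] to [u] *)

Section DiscStep.
Variables (B : {set T}) (v : T) (q : seq T) (y : T) (r S : seq T) (f : T -> T -> bool).
Let X := (v :: q) ++ (y :: r) ++ S.
Hypotheses (cyX : is_graph_cycle e X) (XB : {subset X <= B}) (fX : interior f X).
Hypothesis insB : forall a b, a \in B -> b \in B -> e a b -> inside f a b.
Hypothesis IH : forall H v r N2 N3, #|H| < #|B| -> labelled H v r N2 N3 ->
  tutte_path H v r N2 N3.
Let u := last y r.
Let uX : uniq X. Proof. by case/and3P: cyX. Qed.

Lemma disc_cross A A' a b c d : d \in X ->
  index a X < index b X -> index b X < index c X -> index c X < index d X ->
  conn A -> conn A' -> A \subset B -> A' \subset B -> [disjoint A & A'] ->
  a \in A -> c \in A -> b \in A' -> d \in A' -> False.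
Proof.
move=> dX ab bc cd cA cA' /subsetP sA /subsetP sA' D.
apply: (noncross_sets G cyX fX.1 dX ab bc cd cA cA' D) => z t.
  by move=> /sA zB /sA tB; apply: insB.
by move=> /sA' zB /sA' tB; apply: insB.
Qed.

Lemma disc_interior H X' g : H \subset B -> is_graph_cycle e X' -> {subset X' <= H} ->
  interior g X' -> forall a b, e a b -> g a b -> f a b.
Proof.
move=> /subsetP sH cyX' X'H gX'; have [[fg gE] g0] := gX'.
apply: (interior_below G e0 cyX fX fg g0) => a b eab; rewrite gE // => /cpar_mem/andP[aX' bX'].
by rewrite insB // sH // X'H.
Qed.

(** One side of an edge of [X] lies outside [f], hence outside every smaller disc, and a cycle that
    misses the edge does not separate its two sides. *)
Lemma disc_exposed_edge H a b : H \subset B -> cpar X a b -> e a b -> exposed_edge H a b.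
Proof.
move=> HB Xab eab X' g cyX' X'H gX' nab; have eba : e b a by rewrite esym.
have := disc_interior HB cyX' X'H gX' eab; have := disc_interior HB cyX' X'H gX' eba.
have [[fg gE] _] := gX'; have := gE a b eab; rewrite (negbTE nab) /bd.
have [[ff fE] _] := fX; have := fE a b eab; rewrite Xab /bd.
case: (f a b); case: (f b a); case: (g a b); case: (g b a) => //= _ _ H1 H2;
  (discriminate (H1 isT) || discriminate (H2 isT)).
Qed.

Lemma disc_exposed H w : H \subset B -> w \in X -> exposed H w.
Proof.
move=> HB wX X' g cyX' X'H gX' wX'.
have [[fg gE] g0] := gX'.
apply: (below_at_cycle G cyX fX.1 fg (disc_interior HB cyX' X'H gX') wX) => b ewb.
by rewrite (off_cycle gX'.1 wX' ewb).
Qed.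

(** The set [Y] avoids [H] and reaches the outer cycle, so no cycle in [H] encloses [Y] or a
    neighbour of it. *)
Lemma disc_exposed_conn H w Y k : H \subset B -> conn Y -> [disjoint Y & H] ->
  (exists2 t, t \in Y & t \in X) -> k \in Y -> e w k -> exposed H w.
Proof.
move=> HB cY YH [t tY tX] kY ewk X' g cyX' X'H gX' wX' z ewz.
have offY s : s \in Y -> s \notin X'.
  by move=> sY; apply/negP => /X'H sH; rewrite (disjointFr YH sY) in sH.
have [[fg gE] g0] := gX'.
have Y0 s s' : s \in Y -> e s s' -> bd g s s' = false.
  by move=> /offY sX' ess; apply: off_cycle gX'.1 sX' ess.
have [t' ett'] : exists t', e t t'.
  by have [t' [ett' _ _]] := bd_at_cycle cyX fX.1 tX; exists t'.
have gt : g t t' = false.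
  apply: (disc_exposed (subxx _) tX cyX' _ gX' (offY t tY)) ett' => s sX'.
  exact/(subsetP HB)/X'H.
have ekw : e k w by rewrite esym.
have gk : g k w = false by rewrite (face_fun_conn G fg cY Y0 tY ett').
have gw : g w k = false by move: (Y0 k w kY ekw); rewrite /bd gk.
rewrite -gw; apply: (face_fun_at esym (pg_rot G) fg) => // s ews.
by rewrite (off_cycle gX'.1 wX' ews).
Qed.

Let Qs := [set z in v :: q].
(** What remains around [y :: r] and [S] when the arc [v :: q] is deleted; a path from [y] to [u] is
    found here first. *)
Let L := component (B :\: Qs) u.

Lemma idx_cat (s1 s2 : seq T) (a b : T) : a \in s1 -> b \notin s1 ->
  index a (s1 ++ s2) < index b (s1 ++ s2).
Proof.
move=> a1 b1; rewrite !index_cat a1 (negbTE b1).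
by apply: leq_trans (leq_addr _ _); rewrite index_mem.
Qed.

Lemma notin_cat (s1 s2 : seq T) t : uniq (s1 ++ s2) -> t \in s2 -> t \notin s1.
Proof. by rewrite cat_uniq => /and3P[_ /hasPn D _] /D. Qed.

Lemma idx_QR a b : a \in v :: q -> b \in (y :: r) ++ S -> index a X < index b X.
Proof. by move=> aq br; apply: idx_cat => //; apply: (notin_cat uX br). Qed.

Lemma idx_RS a b : a \in y :: r -> b \in S -> index a X < index b X.
Proof.
move=> ar bS; have uX' := uX; rewrite /X catA in uX' *.
by apply: idx_cat; [rewrite mem_cat ar orbT | apply: (notin_cat uX' bS)].
Qed.

Lemma idx_y b : b \in r -> index y X < index b X.
Proof.
move=> br; have E : X = ((v :: q) ++ [:: y]) ++ (r ++ S) by rewrite /X -catA.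
have uX' := uX; rewrite E in uX' *.
apply: idx_cat; first by rewrite mem_cat mem_head orbT.
by apply: notin_cat uX' _; rewrite mem_cat br.
Qed.

Lemma idx_u b : b \in y :: r -> b != u -> index b X < index u X.
Proof.
rewrite /u => br nbu; have [s Es] : exists s, y :: r = rcons s (last y r).
  by rewrite lastI; exists (belast y r).
have E : X = ((v :: q) ++ s) ++ (u :: S) by rewrite /X Es -catA cat_rcons.
have uX' := uX; rewrite E in uX' *; rewrite -/u.
apply: idx_cat; last by apply: notin_cat uX' _; rewrite mem_head.
by move: br; rewrite Es mem_rcons in_cons -/u (negbTE nbu) orFb mem_cat => ->; rewrite orbT.
Qed.

Lemma y_le_u : (y == u) || (index y X < index u X).
Proof. by have [//|nyu] := eqVneq y u; rewrite idx_u ?mem_head. Qed.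

Let RS_path : path e y (r ++ S).
Proof.
case/and3P: cyX => _ _; rewrite /X [cycle _ _]/= rcons_cat cat_path => /andP[_].
by rewrite [rcons _ _]/= [path _ _ _]/= rcons_path => /and3P[].
Qed.

Let RS_conn : conn [set z in (y :: r) ++ S].
Proof. exact: (path_conn esym RS_path). Qed.

Let RS_notQ t : t \in (y :: r) ++ S -> t \notin v :: q.
Proof. exact: (notin_cat uX). Qed.

Let RS_X t : t \in (y :: r) ++ S -> t \in X.
Proof. by rewrite /X [in X in _ -> X]mem_cat => ->; rewrite orbT. Qed.

Let u_RS : u \in (y :: r) ++ S.
Proof. by rewrite mem_cat /u mem_last. Qed.

Let u_BQ : u \in B :\: Qs.
Proof. by rewrite inE inE RS_notQ // XB // RS_X. Qed.

Let RS_L t : t \in (y :: r) ++ S -> t \in L.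
Proof.
move=> tRS; suff /subsetP sub : [set z in (y :: r) ++ S] \subset L by apply: sub; rewrite inE.
have uS : u \in [set z in (y :: r) ++ S] by rewrite in_set.
apply: (component_max RS_conn _ uS (component_id _ u_BQ)).
by apply/subsetP => z; rewrite !in_set => zRS; rewrite RS_notQ // XB // RS_X.
Qed.

Let LB : L \subset B :\: Qs. Proof. exact: component_sub. Qed.
Let LB' : L \subset B. Proof. exact: subset_trans LB (subsetDl _ _). Qed.
Let QB : Qs \subset B.
Proof. by apply/subsetP => z; rewrite in_set => zQ; apply: XB; rewrite /X mem_cat zQ. Qed.
Let L_notQ t : t \in L -> t \notin v :: q.
Proof. by move/(subsetP LB); rewrite in_setD in_set => /andP[]. Qed.
Let Q_X t : t \in v :: q -> t \in X. Proof. by rewrite /X [in X in _ -> X]mem_cat => ->. Qed.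

(** Touching [NQ] stands for having an attachment on the deleted arc. *)
Let NQ := [set w | [exists c in Qs, e w c]].

Lemma cpar_R a b : wpar y r a b -> cpar X a b.
Proof.
move=> wab; apply: wpar_rel (@cpar_sym _ X) _ wab.
have : path (cpar X) v (rcons (q ++ (y :: r) ++ S) v) by apply: (cycle_cpar cyX).
by rewrite rcons_cat cat_path => /andP[_]; rewrite rcons_cat cat_path [path _ _ (y :: r)]/= => /andP[/andP[]].
Qed.

Lemma setU1_conn K k c : conn K -> k \in K -> e k c -> conn (c |: K).
Proof. by move=> cK kK ekc; apply: connU1 ekc. Qed.

(** Going round [L] from [y] one meets [NQ], then [S], then [u] and [r]. A vertex of [NQ] is
    prolonged by its edge to the arc [v :: q], so that every crossing becomes one between vertices
    of [X]. *)
Lemma labelled_L : labelled L y r [set z in S] NQ.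
Proof.
have RE a b : wpar y r a b -> e a b.
  apply: wpar_rel esym _; move: RS_path; rewrite cat_path; by case/andP.
split.
- exact: component_conn.
- by move: RS_path; rewrite cat_path => /andP[].
- move: uX; rewrite /X cat_uniq => /and3P[_ _]; rewrite cat_uniq; by case/and3P.
- by move=> t tr; apply: RS_L; rewrite mem_cat tr.
- by move=> a b wab; apply: disc_exposed_edge LB' (cpar_R wab) (RE _ _ wab).
- move=> w wL; rewrite in_setU => /orP[|].
    by rewrite in_set => wS; apply: disc_exposed LB' _; apply: RS_X; rewrite mem_cat wS orbT.
  rewrite in_set => /exists_inP[c]; rewrite in_set => cQ ewc.
  apply: (disc_exposed_conn LB' (@conn1 _ e c)) (set11 c) ewc.
    by rewrite disjoints1; apply: contraL cQ => /L_notQ.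
  by exists c; [apply: set11 | apply: Q_X].
- move=> A A' cA cA' sA sA' D yA uA /hitsP[r0 r0A']; rewrite in_set => r0r.
  have r0y : r0 != y by apply: contraTneq r0A' => ->; rewrite (disjointFr D yA).
  have r0u : r0 != u by apply: contraTneq r0A' => ->; rewrite (disjointFr D uA).
  have r0r' : r0 \in r by move: r0r; rewrite in_cons (negbTE r0y).
  have AB := subset_trans sA LB'; have A'B := subset_trans sA' LB'.
  have y_r0 := idx_y r0r'; have r0_u := idx_u r0r r0u.
  case/hitsP=> w wA'; rewrite in_setU !in_set => /orP[wS|/exists_inP[c]].
    apply: (disc_cross _ y_r0 r0_u _ cA cA' AB A'B D yA uA r0A' wA').
      by apply: RS_X; rewrite mem_cat wS orbT.
    by apply: idx_RS => //; apply: mem_last.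
  rewrite in_set => cQ ewc.
  have cA'' : conn (c |: A') by apply: setU1_conn ewc.
  have cN : c \notin A by apply: contraL cQ => /(subsetP sA)/L_notQ.
  apply: (disc_cross (a := c) (b := y) (c := r0) (d := u) (A := c |: A') (A' := A)) => //.
  - exact: RS_X.
  - by apply: idx_QR => //; apply: mem_head.
  - by rewrite subUset sub1set A'B andbT XB // Q_X.
  - by rewrite disjoint_sym; apply/pred0P => z /=; rewrite in_setU1; case: eqP => [->|_] /=; [rewrite (negbTE cN) | have /pred0P/(_ z) := D].
  - exact: setU11.
  - exact: setU1r.
- move=> A A' cA cA' sA sA' D yA uA' /hitsP[s sA0]; rewrite in_set => sS.
  case/hitsP=> w wA'; rewrite in_set => /exists_inP[c]; rewrite in_set => cQ ewc.
  have AB := subset_trans sA LB'; have A'B := subset_trans sA' LB'.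
  have cA'' : conn (c |: A') by apply: setU1_conn ewc.
  have cN : c \notin A by apply: contraL cQ => /(subsetP sA)/L_notQ.
  have nyu : y != u by apply: contraTneq uA' => E; rewrite -/u -E (disjointFr D yA).
  apply: (disc_cross (a := c) (b := y) (c := u) (d := s) (A := c |: A') (A' := A)) => //.
  - by apply: RS_X; rewrite mem_cat sS orbT.
  - by apply: idx_QR => //; apply: mem_head.
  - by case/orP: y_le_u => // /eqP yu; rewrite yu eqxx in nyu.
  - by apply: idx_RS => //; apply: mem_last.
  - by rewrite subUset sub1set A'B andbT XB // Q_X.
  - by rewrite disjoint_sym; apply/pred0P => z /=; rewrite in_setU1; case: eqP => [->|_] /=; [rewrite (negbTE cN) | have /pred0P/(_ z) := D].
  - exact: setU11.
  - exact: setU1r.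
Qed.

(** The bound extends to connected sets that miss [L]: they have no attachment on the path and meet
    neither [r] nor [S]. *)
Lemma first_path : exists p, [/\ path e y p, last y p = u, uniq (y :: p),
  {subset y :: p <= L} & forall K, conn K -> K \subset B :\: Qs :\: [set z in y :: p] ->
    #|attached e K [set z in y :: p]| + hits K [set z in y :: r]
    + hits K [set z in S] + hits K NQ <= 3].
Proof.
have ltL : #|L| < #|B|.
  apply: proper_card; apply/properP; split=> //; exists v.
    by apply: (subsetP QB); rewrite in_set mem_head.
  by apply/negP => /L_notQ; rewrite mem_head.
have [p [pp lp up sp bp]] := IH ltL labelled_L.
exists p; split=> // K cK KM; set P := [set z in y :: p] in bp KM *.
have KB k : k \in K -> (k \in B :\: Qs) && (k \notin P).
  by move/(subsetP KM); rewrite in_setD andbC.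
have [/hitsP[k kK kL]|nh] := boolP (hits K L).
  have KL : K \subset L.
    by apply: (component_max cK _ kK kL); apply/subsetP => z /KB/andP[].
  apply: bp => //; apply/subsetP => z zK; rewrite in_setD (subsetP KL z zK) andbT.
  by case/andP: (KB z zK).
have noL k : k \in K -> k \notin L.
  by move=> kK; apply: contra nh => kL; apply/hitsP; exists k.
have -> : #|attached e K P| = 0.
  apply: eq_card0 => z; apply/negP => /attachedP[zP [k kK ekz]]; case/negP: (noL k kK).
  have zL : z \in L by apply: sp; rewrite in_set in zP.
  by apply: component_closed zL _ _; rewrite 1?esym //; case/andP: (KB k kK).
have -> : hits K [set z in y :: r] = false.
  by apply/hitsP => -[k kK]; rewrite in_set => kr; case/negP: (noL k kK); apply: RS_L; rewrite mem_cat kr.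
have -> : hits K [set z in S] = false.
  by apply/hitsP => -[k kK]; rewrite in_set => kr; case/negP: (noL k kK); apply: RS_L; rewrite mem_cat kr orbT.
by case: (hits _ _).
Qed.

(** * Sweeping the first arc, from [v] to its last vertex *)

Section Sweep.
Variable p : seq T.
Hypotheses (pp : path e y p) (lp : last y p = u) (up : uniq (y :: p)).
Hypothesis sp : {subset y :: p <= L}.
Let P1 := [set z in y :: p].
Let M := B :\: Qs :\: P1.
Hypothesis bp : forall K, conn K -> K \subset M ->
  #|attached e K P1| + hits K [set z in y :: r] + hits K [set z in S] + hits K NQ <= 3.
Let J z := component M z.
Let m := size q.
(** The arc has [m + 1] vertices, since [m] counts [q] without [v]; indices run from [0] to [m]
    inclusive. *)
Let qv i := nth v (v :: q) i.
Definition adj K i : bool := [exists z in K, e z (qv i)].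

Let qv_in i : i <= m -> qv i \in v :: q. Proof. by move=> im; apply: mem_nth. Qed.
Let qv_X i : i <= m -> qv i \in X. Proof. by move=> /qv_in/Q_X. Qed.
Let qv_B i : i <= m -> qv i \in B. Proof. by move=> /qv_X/XB. Qed.
Let uQ : uniq (v :: q). Proof. by move: uX; rewrite /X cat_uniq => /and3P[]. Qed.

Let idx_qv i : i <= m -> index (qv i) X = i.
Proof. by move=> im; rewrite /X index_cat qv_in // index_uniq. Qed.

Let qv_inj i j : i <= m -> j <= m -> qv i = qv j -> i = j.
Proof. by move=> im jm E; rewrite -(idx_qv im) -(idx_qv jm) E. Qed.

Let qvP t : t \in v :: q -> exists2 i, i <= m & t = qv i.
Proof.
move=> tQ; exists (index t (v :: q)); last by rewrite /qv nth_index.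
by move: tQ; rewrite -index_mem.
Qed.

Let MP z : z \in M -> [/\ z \in B, z \notin v :: q & z \notin P1].
Proof. by rewrite in_setD in_setD => /and3P[zP zQ zB]; split=> //; move: zQ; rewrite in_set. Qed.

Let inM z : z \in B -> z \notin v :: q -> z \notin P1 -> z \in M.
Proof. by move=> zB zQ zP; rewrite in_setD zP in_setD zB andbT in_set. Qed.

Let JM z : J z \subset M. Proof. exact: component_sub. Qed.
Let J_M z t : t \in J z -> t \in M. Proof. exact: (subsetP (JM z)). Qed.
Let J_id z : z \in M -> z \in J z. Proof. exact: component_id. Qed.
Let J_conn z : z \in M -> conn (J z). Proof. exact: component_conn. Qed.
Let J_eq z t : t \in J z -> J t = J z. Proof. exact: component_eq. Qed.
Let J_step z t : z \in M -> t \in M -> e z t -> J t = J z.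
Proof. by move=> zM tM ezt; apply: J_eq; apply: component_closed (J_id zM) tM ezt. Qed.

Let J_disj z t : J z != J t -> [disjoint J z & J t].
Proof.
move=> ne; apply/pred0P => s /=; apply/negP => /andP[/J_eq Ez /J_eq Et].
by rewrite -Ez Et eqxx in ne.
Qed.

Let P1L : P1 \subset L. Proof. by apply/subsetP => t; rewrite in_set => /sp. Qed.
Let P1B : P1 \subset B. Proof. exact: subset_trans P1L LB'. Qed.
Let P1conn : conn P1. Proof. exact: path_conn. Qed.
Let yP1 : y \in P1. Proof. by rewrite in_set mem_head. Qed.
Let P1Q i : i <= m -> qv i \notin P1.
Proof. by move=> im; apply: contraL (qv_in im) => /(subsetP P1L)/L_notQ. Qed.
Let JQ z i : i <= m -> qv i \notin J z.
Proof. by move=> im; apply: contraL (qv_in im) => /J_M/MP[]. Qed.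
Let JP1 z : [disjoint J z & P1].
Proof. by apply/pred0P => t /=; apply/negP => /andP[/J_M/MP[_ _ /negbTE->]]. Qed.

Let idx_far i c : i <= m -> c \in (y :: r) ++ S -> i < index c X.
Proof. by move=> im cRS; rewrite -{1}(idx_qv im); apply: idx_QR => //; apply: qv_in. Qed.

Let adjP K i : reflect (exists2 z, z \in K & e z (qv i)) (adj K i).
Proof. exact: exists_inP. Qed.

Let J1 z i := qv i |: J z.
Let J1_conn z i : z \in M -> adj (J z) i -> conn (J1 z i).
Proof. by move=> zM /adjP[k kJ eki]; apply: setU1_conn (J_conn zM) kJ eki. Qed.

Let J1B z i : i <= m -> J1 z i \subset B.
Proof.
move=> im; rewrite subUset sub1set qv_B //; apply: subset_trans (JM z) _.
by apply/subsetP => t /MP[].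
Qed.

Let J2 z i j := qv i |: J1 z j.
Let J2_conn z i j : z \in M -> adj (J z) i -> adj (J z) j -> conn (J2 z i j).
Proof.
move=> zM /adjP[k kJ eki] zj; apply: setU1_conn (J1_conn zM zj) _ eki.
exact: setU1r.
Qed.
Let J2B z i j : i <= m -> j <= m -> J2 z i j \subset B.
Proof. by move=> im jm; rewrite subUset sub1set qv_B // J1B. Qed.

(** A component adjacent to [qv i] and [qv j] shields the vertices between them from the rest of
    [X]. *)
Let cross_span z i j A a c : z \in M -> adj (J z) i -> adj (J z) j ->
  i < a -> a < j -> j <= m -> conn A -> A \subset B -> [disjoint A & J2 z i j] ->
  qv a \in A -> c \in A -> c \in X -> (index c X < i) || (j < index c X) -> False.
Proof.
move=> zM zi zj ia aj jm cA AB D aA cA' cX.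
have im : i <= m by apply: leq_trans (ltnW ia) (leq_trans (ltnW aj) jm).
have am : a <= m by apply: leq_trans (ltnW aj) jm.
have D' : [disjoint J2 z i j & A] by rewrite disjoint_sym.
have iJ : qv i \in J2 z i j by apply: setU11.
have jJ : qv j \in J2 z i j by apply/setU1r/setU11.
have ia' : index (qv i) X < index (qv a) X by rewrite !idx_qv.
have aj' : index (qv a) X < index (qv j) X by rewrite !idx_qv.
case/orP=> ci.
  apply: (disc_cross (qv_X jm) _ ia' aj' cA (J2_conn zM zi zj) AB (J2B z im jm) D cA' aA iJ jJ).
  by rewrite idx_qv.
apply: (disc_cross cX ia' aj' _ (J2_conn zM zi zj) cA (J2B z im jm) AB D' iJ jJ aA cA').
by rewrite idx_qv.
Qed.

Let disj_J2 z i j A : (forall t, t \in A -> t \notin J z) -> qv i \notin A -> qv j \notin A ->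
  [disjoint A & J2 z i j].
Proof.
move=> AJ iA jA; apply/pred0P => t /=; apply/negP => /andP[tA].
rewrite !in_setU1 (negbTE (AJ t tA)) orbF => /orP[]/eqP E; rewrite -E in iA jA.
  by rewrite tA in iA.
by rewrite tA in jA.
Qed.

(* No component of the rest of the disc spans [qv i] along [v :: q]: the path can be built
   independently on both sides of [qv i]. *)
Definition milestone i := forall z a b, z \in M -> adj (J z) a -> adj (J z) b ->
  a < i -> i < b -> b <= m -> False.

Let qv_ne i j : i <= m -> j <= m -> i != j -> qv i != qv j.
Proof. by move=> im jm; apply: contra_neq; apply: qv_inj. Qed.

(** Take [j] as the farthest index that one component reaches from [i], and at least [i.+1]. A
    component spanning [j] starts before [i], against the milestone [i], or at [i], against the
    choice of [j], or in between, where it crosses the one from [i] to [j]. *)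
Lemma next_milestone i : i < m -> milestone i ->
  exists j, [/\ i < j, j <= m, milestone j
    & j = i.+1 \/ exists z, [/\ z \in M, adj (J z) i & adj (J z) j]].
Proof.
move=> im mi.
pose R b := (b <= m) && ((b == i.+1) || [exists z in M, adj (J z) i && adj (J z) b]).
have exR : exists b, R b by exists i.+1; rewrite /R im eqxx.
have boundR b : R b -> b <= m by case/andP.
case: (ex_maxnP exR boundR) => j /andP[jm Rj] maxj.
have ij : i < j by apply: maxj; rewrite /R im eqxx.
have spanj : j = i.+1 \/ exists z, [/\ z \in M, adj (J z) i & adj (J z) j].
  by case/orP: Rj => [/eqP->|/exists_inP[z zM /andP[zi zj]]]; [left | right; exists z].
exists j; split=> // z a b zM za zb aj jb bm.
have noi t : t \in M -> adj (J t) i -> adj (J t) b -> False.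
  move=> tM ti tb; have /maxj : R b; last by rewrite leqNgt jb.
  by rewrite /R bm; apply/orP; right; apply/exists_inP; exists t; rewrite ?ti.
have [ai|ia|E] := ltngtP a i.
- exact: (mi z a b zM za zb ai (ltn_trans ij jb) bm).
- case: spanj => [E|[t [tM ti tj]]]; first by move: ia aj; rewrite E; clear; lia.
  have ne : J z != J t by apply: contraTneq zb => E; apply/negP => zb; apply: (noi t) => //; rewrite -E.
  have am : a <= m by move: aj jm; clear; lia.
  apply: (cross_span tM ti tj ia aj jm (J2_conn zM za zb) (J2B z am bm)).
  + apply: disj_J2.
    * move=> s; rewrite !in_setU1 => /or3P[/eqP->|/eqP->|sz]; rewrite ?(JQ t) //.
      by rewrite (disjointFr (J_disj ne) sz).
    * by rewrite !in_setU1 !negb_or (JQ z) ?qv_ne //; move: im ia ij aj jb jm bm; clear; lia.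
    * by rewrite !in_setU1 !negb_or (JQ z) ?qv_ne //; move: im ia ij aj jb jm bm; clear; lia.
  + exact: setU11.
  + by apply: setU1r; apply: setU11.
  + exact: qv_X.
  + by rewrite idx_qv // jb orbT.
- by apply: (noi z) => //; rewrite -E.
Qed.

Let seg i j := [seq qv c | c <- iota i.+1 (j - i)].

Let segP i j t : i <= j ->
  reflect (exists2 c, i <= c <= j & t = qv c) (t \in qv i :: seg i j).
Proof.
move=> ij; have -> : qv i :: seg i j = [seq qv c | c <- iota i (j - i).+1] by [].
apply: (iffP mapP) => [[c]|[c cij ->]].
  by rewrite mem_iota => cij ->; exists c => //; move: cij ij; clear; lia.
by exists c => //; rewrite mem_iota; move: cij ij; clear; lia.
Qed.

Let Q_cycle (R : rel T) : cycle R X -> forall c, c < m -> R (qv c) (qv c.+1).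
Proof.
rewrite /X [cycle _ _]/= rcons_cat cat_path => /andP[/(pathP v) qR _] c cm.
exact: qR.
Qed.

Let seg_path (R : rel T) i j : (forall c, c < m -> R (qv c) (qv c.+1)) -> i <= j -> j <= m ->
  path R (qv i) (seg i j).
Proof.
move=> Rq ij jm; have H n k : k + n <= m -> path R (qv k) [seq qv c | c <- iota k.+1 n].
  elim: n k => //= n IHn k knm; rewrite Rq ?IHn //; first by rewrite addSnnS.
  by move: knm; clear; lia.
by apply: H; rewrite subnKC.
Qed.

Let seg_last i j : i <= j -> last (qv i) (seg i j) = qv j.
Proof.
move=> ij; have H n k : last (qv k) [seq qv c | c <- iota k.+1 n] = qv (k + n).
  by elim: n k => [k|n IHn k] /=; rewrite ?addn0 // IHn addSnnS.
by rewrite H subnKC.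
Qed.

(** The vertices whose component is attached to the arc only between [i] and [j], and not at a
    single end. *)
Let grp i j z := [&& z \in M,
  [exists c : 'I_m.+1, adj (J z) c && (val c != i)],
  [exists c : 'I_m.+1, adj (J z) c && (val c != j)]
  & [forall c : 'I_m.+1, adj (J z) c ==> (i <= c <= j)]].

Let grpP i j z : reflect [/\ z \in M, exists c, [/\ c <= m, adj (J z) c & c != i],
    exists c, [/\ c <= m, adj (J z) c & c != j]
    & forall c, c <= m -> adj (J z) c -> i <= c <= j] (grp i j z).
Proof.
apply: (iffP and4P) => -[zM].
  move=> /existsP[c /andP[zc ci]] /existsP[d /andP[zd dj]] /forallP all_c; split=> //.
  - by exists c; split=> //; rewrite -ltnS.
  - by exists d; split=> //; rewrite -ltnS.
  - by move=> b bm zb; have /implyP := all_c (Ordinal (n := m.+1) (m := b) bm); apply.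
move=> [c [cm zc ci]] [d [dm zd dj]] all_c; split=> //.
- by apply/existsP; exists (Ordinal (n := m.+1) (m := c) cm); rewrite /= zc.
- by apply/existsP; exists (Ordinal (n := m.+1) (m := d) dm); rewrite /= zd.
- by apply/forallP => b; apply/implyP; apply: all_c; rewrite -ltnS.
Qed.

Let grpJ i j z t : grp i j z -> t \in J z -> grp i j t.
Proof.
move=> gz tz; have tM := J_M tz; move: gz; rewrite /grp (J_eq tz) tM.
by move=> /andP[_ ->].
Qed.

(** Components that also have a connection to [S] or to the first path. *)
Let hub z := hits (J z) [set t in S] || (attached e (J z) P1 != set0).

Let hub_beyond z : z \in M -> hub z -> exists A c, [/\ conn A, J z \subset A,
  A \subset J z :|: P1, c \in A & c \in (y :: r) ++ S].
Proof.
move=> zM /orP[/hitsP[s sJ]|/set0Pn[w /attachedP[wP [s sJ esw]]]].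
  rewrite in_set => sS; exists (J z), s; split=> //; first exact: J_conn.
    exact: subsetUl.
  by rewrite mem_cat sS orbT.
exists (J z :|: P1), y; split=> //.
- by apply: connU (J_conn zM) P1conn sJ wP _; rewrite ?esw ?orbT.
- exact: subsetUl.
- by rewrite in_setU yP1 orbT.
- by rewrite mem_cat mem_head.
Qed.

Let JP1B z : J z :|: P1 \subset B.
Proof. by rewrite subUset P1B andbT; apply/subsetP => t /J_M/MP[]. Qed.

Let JP1Q z i : i <= m -> qv i \notin J z :|: P1.
Proof. by move=> im; rewrite in_setU negb_or (JQ z) // P1Q. Qed.

(** * One segment between consecutive milestones *)

Section Segment.
Variables i j : nat.
Hypotheses (ij : i < j) (jm : j <= m) (mi : milestone i) (mj : milestone j).
Hypothesis spanj : j = i.+1 \/ exists z, [/\ z \in M, adj (J z) i & adj (J z) j].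
Let Dg := [set z | grp i j z].
Let D := Dg :|: [set t in qv i :: seg i j].

Let im : i <= m. Proof. exact: leq_trans (ltnW ij) jm. Qed.

Let span_interior a : i < a -> a < j -> exists z, [/\ z \in M, adj (J z) i & adj (J z) j].
Proof. by case: spanj => // -> ia; rewrite ltnS leqNgt ia. Qed.

Let qvD a : i <= a -> a <= j -> qv a \in D.
Proof.
move=> ia aj; apply/setUP; right; rewrite in_set.
by apply/segP; [apply: ltnW | exists a; rewrite ?ia].
Qed.

Let DP t : t \in D -> grp i j t \/ exists2 a, i <= a <= j & t = qv a.
Proof.
case/setUP; first by rewrite in_set; left.
by rewrite in_set => /(segP _ (ltnW ij)); right.
Qed.

Let D_sub : D \subset B.
Proof.
apply/subsetP => t /DP[/grpP[/MP[]//]|[a /andP[_ aj] ->]].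
exact/qv_B/(leq_trans aj).
Qed.

Let DP1 : [disjoint D & P1].
Proof.
apply/pred0P => t /=; apply/negP => /andP[/DP[/grpP[/MP[_ _ /negbTE->]//]|[a /andP[_ aj] ->]]].
by rewrite (negbTE (P1Q _)) // (leq_trans aj).
Qed.

(** The spanning component shields the interior of the segment from [P1] and from the rest of the
    arc; any component reached from there is confined by the two milestones. *)
Lemma seg_interior a t : i < a -> a < j -> t \in B -> e (qv a) t -> t \in D.
Proof.
move=> ia aj tB eat; have [z [zM zi zj]] := span_interior ia aj.
have am : a <= m by apply: leq_trans (ltnW aj) jm.
have nai : qv i != qv a by apply: qv_ne => //; rewrite neq_ltn ia.
have naj : qv j != qv a by apply: qv_ne => //; rewrite neq_ltn aj orbT.
have [tQ|tQ] := boolP (t \in v :: q).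
  have [c cm Et] := qvP tQ; have [/andP[ic cj]|nc] := boolP (i <= c <= j).
    by rewrite Et; apply: qvD.
  case: (cross_span (A := qv a |: [set qv c]) (c := qv c) zM zi zj ia aj jm).
  - by apply: connU1 (@conn1 _ e _) (set11 _) _ => //; rewrite esym -Et.
  - by rewrite subUset !sub1set !qv_B.
  - apply: disj_J2.
    + by move=> s /set2P[]->; apply: JQ.
    + by rewrite !inE negb_or nai qv_ne //; move: nc ij; clear; lia.
    + by rewrite !inE negb_or naj qv_ne //; move: nc ij; clear; lia.
  - exact: setU11.
  - exact/setU1r/set11.
  - exact: qv_X.
  - by rewrite idx_qv //; move: nc; clear; lia.
have [tP|tP] := boolP (t \in P1).
  case: (cross_span (A := qv a |: P1) (c := y) zM zi zj ia aj jm).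
  - by apply: connU1 P1conn tP _ => //; rewrite esym.
  - by rewrite subUset sub1set qv_B.
  - apply: disj_J2.
    + move=> s /setU1P[->|sP]; first exact: JQ.
      by rewrite (disjointFl (JP1 z) sP).
    + by rewrite in_setU1 negb_or nai P1Q.
    + by rewrite in_setU1 negb_or naj P1Q.
  - exact: setU11.
  - exact: setU1r.
  - by apply: RS_X; rewrite mem_cat mem_head.
  - by rewrite idx_far ?orbT // mem_cat mem_head.
have tM := inM tB tQ tP.
have ta : adj (J t) a by apply/adjP; exists t; [apply: J_id | rewrite esym].
apply/setUP; left; rewrite in_set; apply/grpP; split=> //.
- by exists a; split=> //; rewrite neq_ltn ia orbT.
- by exists a; split=> //; rewrite neq_ltn aj.
- move=> c cm tc; apply/andP; split; rewrite leqNgt; apply/negP => lt.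
    exact: (mi tM tc ta lt ia am).
  exact: (mj tM ta tc aj lt cm).
Qed.

Lemma seg_closed k t : k \in D -> k != qv i -> k != qv j -> t \in B -> e k t ->
  (t \in D) || (t \in P1).
Proof.
move=> /DP[gk|[a /andP[ia aj] ->]] nki nkj tB ekt; last first.
  rewrite (seg_interior _ _ tB ekt) //; rewrite ltn_neqAle ?ia ?aj andbT.
    by apply: contra_neq nki => <-.
  by apply: contra_neq nkj => <-.
have [tP|tP] := boolP (t \in P1); first by rewrite orbT.
rewrite orbF; have [kM _ _ kc] := grpP _ _ _ gk.
have [tQ|tQ] := boolP (t \in v :: q).
  have [c cm Et] := qvP tQ; rewrite Et.
  have /andP[ic cj] : i <= c <= j.
    by apply: kc => //; apply/adjP; exists k; [apply: J_id | rewrite -Et].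
  exact: qvD.
have tM := inM tB tQ tP; apply/setUP; left; rewrite in_set (grpJ gk) //.
by rewrite -(J_step kM tM ekt) J_id.
Qed.

Let hub_not_interior z z3 a : z \in M -> hub z -> z3 \in M ->
  adj (J z3) i -> adj (J z3) j -> J z != J z3 -> i < a -> a < j -> adj (J z) a -> False.
Proof.
move=> zM hz z3M z3i z3j ne ia aj za; have am : a <= m by apply: leq_trans (ltnW aj) jm.
have [A [w [cA JA AJ wA wRS]]] := hub_beyond zM hz; have [s sJ esa] := adjP _ _ za.
have AQ b : b <= m -> qv b \notin A.
  by move=> bm; apply/negP => /(subsetP AJ); apply/negP; apply: JP1Q.
apply: (cross_span (A := qv a |: A) (c := w) z3M z3i z3j ia aj jm).
- by apply: setU1_conn cA _ esa; apply: (subsetP JA).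
- by rewrite subUset sub1set qv_B //= (subset_trans AJ).
- apply: disj_J2.
  + move=> t /setU1P[->|/(subsetP AJ)/setUP[tz|tP]]; first exact: JQ.
      by rewrite (disjointFr (J_disj ne)).
    by rewrite (disjointFl (JP1 z3) tP).
  + by rewrite in_setU1 negb_or AQ // qv_ne // neq_ltn ia.
  + by rewrite in_setU1 negb_or AQ // qv_ne // neq_ltn aj orbT.
- exact: setU11.
- exact: setU1r.
- exact: RS_X.
- by rewrite (idx_far jm wRS) orbT.
Qed.

(** Otherwise the hub is attached at an interior vertex, and its connection to the outside crosses
    the spanning component, which is then a different one. *)
Let hub_ends z : grp i j z -> hub z -> adj (J z) i && adj (J z) j.
Proof.
move=> gz hz; have [zM [c [cm zc ci]] [d [dm zd dj]] zall] := grpP _ _ _ gz.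
apply/negPn/negP => nij.
have [a [ia aj za]] : exists a, [/\ i < a, a < j & adj (J z) a].
  move: nij; rewrite negb_and => /orP[nzi|nzj].
    exists d; have /andP[id dj'] := zall d dm zd; split=> //; rewrite ltn_neqAle ?id ?dj' ?dj //= andbT.
    by apply: contraNneq nzi => ->.
  exists c; have /andP[ic cj'] := zall c cm zc; split=> //; rewrite ltn_neqAle ?ic ?cj' ?andbT //=.
    by rewrite eq_sym.
  by apply: contraNneq nzj => <-.
have [z3 [z3M z3i z3j]] := span_interior ia aj.
apply: (hub_not_interior zM hz z3M z3i z3j _ ia aj za).
by apply: contraNneq nij => ->; rewrite z3i.
Qed.

Let hub_cross z1 z2 A1 A2 c1 c2 : z1 \in M -> z2 \in M -> J z1 != J z2 ->
  adj (J z1) i -> adj (J z2) j -> conn A1 -> conn A2 -> J z1 \subset A1 -> J z2 \subset A2 ->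
  A1 \subset J z1 :|: P1 -> A2 \subset J z2 :|: P1 -> [disjoint A1 & A2] ->
  c1 \in A1 -> c2 \in A2 -> c1 \in (y :: r) ++ S -> c2 \in (y :: r) ++ S ->
  index c1 X < index c2 X -> False.
Proof.
move=> z1M z2M ne z1i z2j cA1 cA2 JA1 JA2 AJ1 AJ2 D12 c1A c2A c1RS c2RS lt12.
have AQ A z b : A \subset J z :|: P1 -> b <= m -> qv b \notin A.
  by move=> AJ bm; apply/negP => /(subsetP AJ); apply/negP; apply: JP1Q.
have [s1 s1J es1] := adjP _ _ z1i; have [s2 s2J es2] := adjP _ _ z2j.
apply: (disc_cross (a := qv i) (b := qv j) (c := c1) (d := c2)
  (A := qv i |: A1) (A' := qv j |: A2)) => //.
- exact: RS_X.
- by rewrite !idx_qv.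
- by rewrite idx_qv // idx_far.
- by apply: setU1_conn cA1 _ es1; apply: (subsetP JA1).
- by apply: setU1_conn cA2 _ es2; apply: (subsetP JA2).
- by rewrite subUset sub1set qv_B //= (subset_trans AJ1).
- by rewrite subUset sub1set qv_B //= (subset_trans AJ2).
- apply/pred0P => t /=; apply/negP => /andP[/setU1P[->|t1] /setU1P[E|t2]].
  + by move/qv_inj: E ij => -> //; rewrite ltnn.
  + by move: (AQ _ _ _ AJ2 im); rewrite t2.
  + by move: (AQ _ _ _ AJ1 jm); rewrite -E t1.
  + by rewrite (disjointFr D12 t1) in t2.
- exact: setU11.
- exact: setU1r.
- exact: setU11.
- exact: setU1r.
Qed.

(** Both hubs reach [qv i] and [qv j]. If one of them reached [S], its connection would cross that
    of the other to [S] or, through the first path, to [y]. *)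
Let hub_noS z1 z2 : grp i j z1 -> grp i j z2 -> hub z1 -> hub z2 -> J z1 != J z2 ->
  ~~ hits (J z1) [set t in S].
Proof.
move=> g1 g2 h1 h2 ne; apply/hitsP => -[s1 s1J]; rewrite in_set => s1S.
have /andP[z1i z1j] := hub_ends g1 h1; have /andP[z2i z2j] := hub_ends g2 h2.
have [z1M _ _ _] := grpP _ _ _ g1; have [z2M _ _ _] := grpP _ _ _ g2.
have ne' : J z2 != J z1 by rewrite eq_sym.
have s1RS : s1 \in (y :: r) ++ S by rewrite mem_cat s1S orbT.
have DJ := J_disj ne; have DJ' := J_disj ne'.
have [/set0Pn[w /attachedP[wP [s sJ esw]]]|] := boolP (attached e (J z2) P1 != set0).
  apply: (hub_cross z2M z1M ne' z2i z1j (A1 := J z2 :|: P1) (A2 := J z1) (c1 := y) (c2 := s1)) => //.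
  - by apply: connU (J_conn z2M) P1conn sJ wP _; rewrite ?esw ?orbT.
  - exact: J_conn.
  - exact: subsetUl.
  - exact: subsetUl.
  - apply/pred0P => t /=; apply/negP => /andP[/setUP[t2|tP] t1].
      by rewrite (disjointFr DJ t1) in t2.
    by rewrite (disjointFr (JP1 z1) t1) in tP.
  - by rewrite in_setU yP1 orbT.
  - by rewrite mem_cat mem_head.
  - by apply: idx_RS => //; apply: mem_head.
move=> no; move: h2; rewrite /hub (negbTE no) orbF => /hitsP[s2 s2J]; rewrite in_set => s2S.
have s2RS : s2 \in (y :: r) ++ S by rewrite mem_cat s2S orbT.
have [lt|lt|E] := ltngtP (index s1 X) (index s2 X).
- apply: (hub_cross z1M z2M ne z1i z2j (J_conn z1M) (J_conn z2M) _ _ _ _ DJ s1J s2J) => //;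
    exact: subsetUl.
- apply: (hub_cross z2M z1M ne' z2i z1j (J_conn z2M) (J_conn z1M) _ _ _ _ DJ' s2J s1J) => //;
    exact: subsetUl.
- have E' : s1 = s2 by rewrite -(nth_index y (RS_X s1RS)) E nth_index ?RS_X.
  by rewrite -E' (disjointFr DJ s1J) in s2J.
Qed.

(** If the attachments differed, the first path could be cut between them, and its parts would
    extend the hubs to disjoint sets reaching [y] and [u] that cross. *)
Let hub_same z1 z2 p1 p2 : grp i j z1 -> grp i j z2 -> J z1 != J z2 ->
  p1 \in attached e (J z1) P1 -> p2 \in attached e (J z2) P1 -> p1 = p2.
Proof.
have half z z' a b pre post : grp i j z -> grp i j z' -> J z != J z' ->
    a \in attached e (J z) P1 -> b \in attached e (J z') P1 ->
    y :: p = rcons pre a ++ post -> b \in post -> False.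
  move=> g g' ne aJ bJ Ep bpost.
  have h : hub z by apply/orP; right; apply/set0Pn; exists a.
  have h' : hub z' by apply/orP; right; apply/set0Pn; exists b.
  have /andP[zi _] := hub_ends g h; have /andP[_ zj'] := hub_ends g' h'.
  have [zM _ _ _] := grpP _ _ _ g; have [zM' _ _ _] := grpP _ _ _ g'.
  have [aP [s sJ esa]] := attachedP _ _ _ _ aJ; have [bP [s' sJ' esb]] := attachedP _ _ _ _ bJ.
  have [c [post' Epost]] : exists c post', post = c :: post' by case: (post) bpost => // c l _; exists c, l.
  have [pre' Epre] : exists pre', rcons pre a = y :: pre'.
    by case: pre Ep => [[-> _]|d l [-> _]]; [exists [::] | exists (rcons l a)].
  have Ep' : p = pre' ++ c :: post' by move: Ep; rewrite Epre Epost => -[].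
  have cpre : conn [set t in rcons pre a].
    by rewrite Epre; apply: (path_conn esym); move: pp; rewrite Ep' cat_path => /andP[].
  have cpost : conn [set t in post].
    by rewrite Epost; apply: (path_conn esym); move: pp; rewrite Ep' cat_path /= => /and3P[].
  have Dpp t : t \in rcons pre a -> t \in post -> False.
    by move=> t1 t2; move: up; rewrite Ep cat_uniq => /and3P[_ /hasPn/(_ t t2)/negP[]].
  have u_post : u \in post by rewrite -lp Ep' last_cat Epost /= mem_last.
  have y_pre : y \in rcons pre a by rewrite Epre mem_head.
  have subpre : [set t in rcons pre a] \subset P1.
    by apply/subsetP => t; rewrite !in_set Ep mem_cat => ->.
  have subpost : [set t in post] \subset P1.
    by apply/subsetP => t; rewrite !in_set Ep mem_cat => ->; rewrite orbT.
  have nyu : y != u by apply/eqP => E; apply: (Dpp y); rewrite // E.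
  have bpost' : b \in [set t in post] by rewrite in_set.
  have apre : a \in [set t in rcons pre a] by rewrite in_set mem_rcons mem_head.
  apply: (hub_cross zM zM' ne zi zj' (A1 := J z :|: [set t in rcons pre a])
     (A2 := J z' :|: [set t in post]) (c1 := y) (c2 := u)) => //.
  - by apply: connU (J_conn zM) cpre sJ apre _; rewrite ?esa ?orbT.
  - by apply: connU (J_conn zM') cpost sJ' bpost' _ => //; rewrite esb orbT.
  - exact: subsetUl.
  - exact: subsetUl.
  - exact: setUS.
  - exact: setUS.
  - apply/pred0P => t /=; apply/negP => /andP[/setUP[t1|t1] /setUP[t2|t2]].
    + by rewrite (disjointFr (J_disj ne) t1) in t2.
    + by move: (subsetP subpost t t2); rewrite (disjointFr (JP1 z) t1).
    + by move: (subsetP subpre t t1); rewrite (disjointFr (JP1 z') t2).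
    + by rewrite !in_set in t1 t2; apply: (Dpp t).
  - by apply/setUP; right; rewrite in_set.
  - by apply/setUP; right; rewrite in_set.
  - by rewrite mem_cat mem_head.
  - by case/orP: y_le_u => // /eqP yu; rewrite yu eqxx in nyu.
move=> g1 g2 ne a1 a2; apply/eqP/negPn/negP => np.
have [p1P _] := attachedP _ _ _ _ a1; have [p2P _] := attachedP _ _ _ _ a2.
rewrite !in_set in p1P p2P.
have [pre [post Ep]] : exists pre post, y :: p = rcons pre p1 ++ post.
  by case/splitPr: p1P => l1 l2; exists l1, l2; rewrite cat_rcons.
move: p2P; rewrite Ep mem_cat => /orP[p2pre|p2post]; last first.
  exact: (half _ _ _ _ _ _ g1 g2 ne a1 a2 Ep p2post).
have : p2 \in pre by move: p2pre; rewrite mem_rcons in_cons eq_sym (negbTE np).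
move=> /splitPr Hs; case: Hs Ep => l1 l2 Ep.
apply: (half z2 z1 p2 p1 l1 (l2 ++ p1 :: post)) => //; first by rewrite eq_sym.
  by rewrite Ep cat_rcons -catA /= cat_rcons.
by rewrite mem_cat mem_head orbT.
Qed.

Let DgM : Dg \subset M. Proof. by apply/subsetP => z; rewrite in_set => /grpP[]. Qed.

(** For a single hub, [bp] leaves two units, as one is taken by [NQ]. Several hubs all miss [S] and
    share one attachment on the first path. *)
Lemma hub_count : #|attached e Dg P1| + hits Dg [set t in S] <= 2.
Proof.
have Jcount z : grp i j z -> #|attached e (J z) P1| + hits (J z) [set t in S] <= 2.
  move=> gz; have [zM [c [cm zc _]] _ _] := grpP _ _ _ gz.
  have := bp (J_conn zM) (JM z); have -> : hits (J z) NQ.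
    have [s sJ esc] := adjP _ _ zc; apply/hitsP; exists s => //; rewrite in_set.
    by apply/exists_inP; exists (qv c); rewrite // in_set qv_in.
  by move: #|_| (hits (J z) [set t in S]) (hits _ _); clear; lia.
have [/exists_inP[z1 z1D /exists_inP[z2 z2D /and3P[h1 h2 ne]]]|no] := boolP
    [exists z1 in Dg, [exists z2 in Dg, [&& hub z1, hub z2 & J z1 != J z2]]].
  rewrite !in_set in z1D z2D; have ne' : J z2 != J z1 by rewrite eq_sym.
  have other z : grp i j z -> exists z', [/\ grp i j z', hub z' & J z != J z'].
    move=> gz; have [E|ne1] := eqVneq (J z) (J z1); last by exists z1.
    by exists z2; rewrite E.
  have noS : hits Dg [set t in S] = false.
    apply/hitsP => -[s gs sS]; rewrite in_set in gs.
    have [z' [g' h' ne1]] := other s gs.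
    have hs : hits (J s) [set t in S].
      by apply/hitsP; exists s => //; apply: J_id; case/grpP: gs.
    have h : hub s by rewrite /hub hs.
    by move: (hub_noS gs g' h h' ne1); rewrite hs.
  rewrite noS addn0; apply: (@leq_trans 1) => //.
  apply/card_le1P => a aD b.
  have att_hub t w : t \in Dg -> e t w -> w \in P1 -> w \in attached e (J t) P1.
    by rewrite in_set => gt etw wP; apply/attachedP; split=> //; exists t => //; apply: J_id; case/grpP: gt.
  have attJ w : w \in attached e Dg P1 -> exists2 t, grp i j t & w \in attached e (J t) P1.
    by move=> /attachedP[wP [t tD etw]]; exists t; [rewrite in_set in tD | apply: att_hub].
  have [t gt at_] := attJ a aD; rewrite [b \in pred1 a]inE; apply/idP/eqP => [bD|->//].
  have [t' gt' bt'] := attJ b bD.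
  have [E|ne1] := eqVneq (J t') (J t); last exact: (hub_same gt' gt ne1 bt' at_).
  have [z' [g' h' ne1]] := other t gt.
  have noS' : ~~ hits (J z') [set t in S].
    apply: (hub_noS g' gt h'); last by rewrite eq_sym.
    by apply/orP; right; apply/set0Pn; exists a.
  move: h'; rewrite /hub (negbTE noS') /= => /set0Pn[c cz'].
  rewrite (hub_same gt g' ne1 at_ cz').
  by apply: (hub_same gt' g' _ bt' cz'); rewrite E.
have same z1 z2 : grp i j z1 -> grp i j z2 -> hub z1 -> hub z2 -> J z1 = J z2.
  move=> g1 g2 h1 h2; apply/eqP; apply: contraNT no => ne.
  by apply/exists_inP; exists z1; rewrite ?in_set //; apply/exists_inP; exists z2; rewrite ?in_set // h1 h2.
have [/exists_inP[z zD hz]|nohub] := boolP [exists z in Dg, hub z].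
  rewrite in_set in zD; apply: leq_trans (Jcount z zD); apply: leq_add.
    apply: subset_leq_card; apply/subsetP => w /attachedP[wP [t tD etw]].
    rewrite in_set in tD; have tJ : t \in J t by apply: J_id; case/grpP: tD.
    have wt : w \in attached e (J t) P1 by apply/attachedP; split=> //; exists t.
    by rewrite -(same t z) //; apply/orP; right; apply/set0Pn; exists w.
  apply: leq_hits => /hitsP[s sD sS]; rewrite in_set in sD.
  have sJ : s \in J s by apply: J_id; case/grpP: sD.
  have hs : hits (J s) [set t in S] by apply/hitsP; exists s.
  by rewrite -(same s z) //; rewrite /hub hs.
have nh z : grp i j z -> ~~ hub z.
  by move=> gz; apply: contra nohub => hz; apply/exists_inP; exists z; rewrite ?in_set.
have -> : hits Dg [set t in S] = false.
  apply/hitsP => -[s sD sS]; rewrite in_set in sD; case/negP: (nh s sD).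
  by apply/orP; left; apply/hitsP; exists s => //; apply: J_id; case/grpP: sD.
rewrite eq_card0 // => w; apply/negP => /attachedP[wP [t tD etw]].
rewrite in_set in tD; case/negP: (nh t tD); apply/orP; right; apply/set0Pn; exists w.
by apply/attachedP; split=> //; exists t => //; apply: J_id; case/grpP: tD.
Qed.

Let D_S t : t \in D -> t \in (y :: r) ++ S -> grp i j t.
Proof.
move=> /DP[//|[a /andP[_ aj] ->]] /RS_notQ.
by rewrite qv_in // (leq_trans aj).
Qed.

(** [p0] is the first vertex of the first path with a neighbour in the group; if there is none, any
    splitting will do. *)
Lemma hub_split : exists pre p0 post, [/\ y :: p = pre ++ p0 :: post,
  forall w, w \in attached e Dg P1 -> w \in p0 :: post
  & p0 \in attached e Dg P1 \/ attached e Dg P1 = set0].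
Proof.
have [hA|nA] := boolP (has (mem (attached e Dg P1)) (y :: p)).
  set k := find (mem (attached e Dg P1)) (y :: p).
  have ks : k < size (y :: p) by rewrite -has_find.
  have Ep : y :: p = take k (y :: p) ++ nth y (y :: p) k :: drop k.+1 (y :: p).
    by rewrite -drop_nth // cat_take_drop.
  exists (take k (y :: p)), (nth y (y :: p) k), (drop k.+1 (y :: p)); split=> //.
    move=> w wA; have [wP _] := attachedP _ _ _ _ wA.
    move: wP; rewrite in_set {1}Ep mem_cat => /orP[wt|//].
    have ik : index w (take k (y :: p)) < k.
      by apply: leq_trans (_ : size (take k (y :: p)) <= k); rewrite ?index_mem // size_take; case: ifP => // /negbT; rewrite -leqNgt.
    have := before_find y ik; rewrite -(nth_take y ik) nth_index //.
    by rewrite /= wA.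
  by left; have := nth_find y hA.
exists [::], y, p; split=> //.
  by move=> w /attachedP[]; rewrite in_set.
right; apply/setP => w; rewrite [RHS]in_set0; apply/negP => wA.
by case/hasP: nA; exists w => //; have [] := attachedP _ _ _ _ wA; rewrite in_set.
Qed.

Let Dconn : conn D.
Proof.
have iD : qv i \in D by apply: qvD => //; apply: ltnW.
have segc : conn [set t in qv i :: seg i j].
  apply: (path_conn esym); apply: seg_path (ltnW ij) jm => c cm.
  by apply: (Q_cycle _ cm); case/and3P: cyX.
have iseg c : i <= c -> c <= j -> connect (rel_in e D) (qv i) (qv c).
  move=> ic cj; apply: (sub_connect_in (subsetUr Dg _)); apply: segc; rewrite in_set.
    by rewrite mem_head.
  by apply/segP; [apply: ltnW | exists c; rewrite ?ic].
apply: (conn_from esym iD) => t /DP[gt|[c /andP[ic cj] ->]]; last exact: iseg.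
have [tM [c [cm tc _]] _ all_c] := grpP _ _ _ gt.
have /andP[ic cj] := all_c c cm tc.
apply: connect_trans (iseg c ic cj) _.
apply: (sub_connect_in (A := J1 t c)).
  apply/subsetP => s /setU1P[->|sJ]; first exact: qvD.
  by apply/setUP; left; rewrite in_set (grpJ gt).
by apply: J1_conn => //; [apply: setU11 | apply/setU1r/J_id].
Qed.

(** The first path joins [y] to [u] and so separates the arc [v :: q] from the vertices of [r] off
    the path. *)
Let adj_noR z c : z \in M -> c <= m -> adj (J z) c -> z \notin y :: r.
Proof.
move=> zM cm zc; apply/negP => zr; have [_ _ zP] := MP zM.
have uP : u \in P1 by rewrite in_set -lp mem_last.
have zy : z != y by apply: contraNneq zP => ->.
have zu : z != u by apply: contraNneq zP => ->.
apply: (disc_cross (a := qv c) (b := y) (c := z) (d := u) (A := J1 z c) (A' := P1)) => //.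
- exact: RS_X.
- by rewrite idx_qv // idx_far // mem_cat mem_head.
- by apply: idx_y; move: zr; rewrite in_cons (negbTE zy).
- exact: idx_u.
- exact: J1_conn.
- exact: J1B.
- apply/pred0P => t /=; apply/negP => /andP[/setU1P[->|tJ] tP].
    by move: (P1Q cm); rewrite tP.
  by rewrite (disjointFr (JP1 z) tJ) in tP.
- exact: setU11.
- exact/setU1r/J_id.
Qed.

Section Labels.
Variables (pre : seq T) (p0 : T) (post : seq T).
Hypothesis Ep : y :: p = pre ++ p0 :: post.
(** [N2] stands for the attachment [p0] and [N3] for everything after it, which by [hub_count] is at
    most one more unit. *)
Let N2 := [set w | e w p0].
Let N3 := [set w | (w \in S) || has (e w) post].

Let p0P : p0 \in P1. Proof. by rewrite in_set Ep mem_cat mem_head orbT. Qed.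
Let postP t : t \in post -> t \in P1.
Proof. by rewrite in_set Ep mem_cat in_cons => ->; rewrite !orbT. Qed.

Let N23 k : k \in N2 :|: N3 -> k \in S \/ exists2 w, w \in P1 & e k w.
Proof.
case/setUP; rewrite in_set; first by right; exists p0.
by case/orP=> [|/hasP[w wp ekw]]; [left | right; exists w; rewrite // postP].
Qed.

(** Both labels lead to [X] through the first path or [S]. Where they compete, the first path is cut
    after [p0], and each label uses its own part. *)
Lemma labelled_segment : labelled D (qv i) (seg i j) N2 N3.
Proof.
have iD : qv i \in D by apply: qvD => //; apply: ltnW.
have jD : qv j \in D by apply: qvD => //; apply: ltnW.
have segR (R : rel T) : cycle R X -> path R (qv i) (seg i j).
  by move=> cR; apply: seg_path (ltnW ij) jm => c cm; apply: Q_cycle cR _ cm.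
have useg : uniq (qv i :: seg i j).
  have -> : qv i :: seg i j = [seq qv c | c <- iota i (j - i).+1] by [].
  rewrite map_inj_in_uniq ?iota_uniq // => a b; rewrite !mem_iota => ai bi.
  by apply: qv_inj; move: ai bi ij jm; clear; lia.
split.
- exact: Dconn.
- by apply: segR; case/and3P: cyX.
- exact: useg.
- by move=> t ts; apply/setUP; right; rewrite in_set.
- move=> a b wab; apply: disc_exposed_edge D_sub _ _.
    exact: wpar_rel (@cpar_sym _ X) (segR _ (cycle_cpar cyX)) wab.
  by apply: wpar_rel esym _ wab; apply: segR; case/and3P: cyX.
- move=> k kD /N23[kS|[w wP ekw]].
    by apply: disc_exposed D_sub _; apply: RS_X; rewrite mem_cat kS orbT.
  apply: (disc_exposed_conn D_sub P1conn _ _ wP ekw); first by rewrite disjoint_sym.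
  by exists y => //; apply: RS_X; rewrite mem_cat mem_head.
- move=> A A' cA cA' AD A'D AA' iA; rewrite seg_last ?(ltnW ij) // => jA.
  case/hitsP=> w wA'; rewrite in_set => /(segP _ (ltnW ij))[a /andP[ia aj] Ew].
  rewrite {}Ew in wA'; case/hitsP=> k kA' kN.
  have nai : a != i by apply: contraTneq wA' => ->; rewrite (disjointFr AA' iA).
  have naj : a != j by apply: contraTneq wA' => ->; rewrite (disjointFr AA' jA).
  have ia' : i < a by rewrite ltn_neqAle eq_sym nai.
  have aj' : a < j by rewrite ltn_neqAle naj.
  have am : a <= m by apply: leq_trans aj jm.
  have AB := subset_trans AD D_sub; have A'B := subset_trans A'D D_sub.
  have fin A'' c : conn A'' -> A'' \subset B -> [disjoint A & A''] -> qv a \in A'' ->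
      c \in A'' -> c \in (y :: r) ++ S -> False.
    move=> cA'' A''B D' aA cAA cRS.
    apply: (disc_cross (a := qv i) (b := qv a) (c := qv j) (d := c) (A := A) (A' := A'')) => //.
    - exact: RS_X.
    - by rewrite !idx_qv.
    - by rewrite !idx_qv.
    - by rewrite idx_qv // idx_far.
  case/N23: kN => [kS|[c cP ekc]].
    by apply: (fin A' k) => //; rewrite mem_cat kS orbT.
  apply: (fin (A' :|: P1) y) => //.
  - by apply: connU cA' P1conn kA' cP _; rewrite ?ekc ?orbT.
  - by rewrite subUset A'B P1B.
  - apply/pred0P => t /=; apply/negP => /andP[tA /setUP[tA'|tP]].
      by rewrite (disjointFr AA' tA) in tA'.
    by rewrite (disjointFr DP1 (subsetP AD t tA)) in tP.
  - by apply/setUP; left.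
  - by apply/setUP; right.
  - by rewrite mem_cat mem_head.
- move=> A A' cA cA' AD A'D AA' iA; rewrite seg_last ?(ltnW ij) // => jA'.
  case/hitsP=> k kA; rewrite in_set => ekp0; case/hitsP=> k' kA'; rewrite in_set => k'N.
  have AB := subset_trans AD D_sub; have A'B := subset_trans A'D D_sub.
  have [pre' Epre] : exists pre', rcons pre p0 = y :: pre'.
    by case: (pre) Ep => [[-> _]|d l [-> _]]; [exists [::] | exists (rcons l p0)].
  have Ep' : p = pre' ++ post by move: Ep; rewrite -cat_rcons Epre => -[].
  have cpre : conn [set t in rcons pre p0].
    by rewrite Epre; apply: (path_conn esym); move: pp; rewrite Ep' cat_path => /andP[].
  have Ep2 : y :: p = rcons pre p0 ++ post by rewrite cat_rcons.
  have Dpp t : t \in rcons pre p0 -> t \in post -> False.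
    by move=> t1 t2; move: up; rewrite Ep2 cat_uniq => /and3P[_ /hasPn/(_ t t2)/negP[]].
  have preP t : t \in rcons pre p0 -> t \in P1.
    by rewrite in_set Ep2 mem_cat => ->.
  have preA : [disjoint A' & [set t in rcons pre p0]].
    apply/pred0P => t /=; apply/negP => /andP[tA']; rewrite in_set => /preP.
    by rewrite (disjointFr DP1 (subsetP A'D t tA')).
  have p0pre : p0 \in [set t in rcons pre p0] by rewrite in_set mem_rcons mem_head.
  have y_pre : y \in rcons pre p0 by rewrite Epre mem_head.
  have fin A'' c : conn A'' -> A'' \subset B -> [disjoint A & A''] -> qv j \in A'' ->
      [disjoint A'' & [set t in rcons pre p0]] ->
      c \in A'' -> c \in (y :: r) ++ S -> index y X < index c X -> False.
    move=> cA'' A''B D' jA Dpre cAA cRS yc.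
    apply: (disc_cross (a := qv i) (b := qv j) (c := y) (d := c)
      (A := A :|: [set t in rcons pre p0]) (A' := A'')) => //.
    - exact: RS_X.
    - by rewrite !idx_qv.
    - by rewrite idx_qv // idx_far // mem_cat mem_head.
    - by apply: connU cA cpre kA p0pre _; rewrite ?ekp0 ?orbT.
    - rewrite subUset AB; apply/subsetP => t; rewrite in_set => /preP; exact: (subsetP P1B).
    - apply/pred0P => t /=; apply/negP => /andP[/setUP[tA|tp] tA''].
        by rewrite (disjointFr D' tA) in tA''.
      by rewrite (disjointFr Dpre tA'') in tp.
    - by apply/setUP; left.
    - by apply/setUP; right; rewrite in_set.
  case/orP: k'N => [kS|/hasP[c cpost ekc]].
    apply: (fin A' k') => //; first by rewrite mem_cat kS orbT.
    by apply: idx_RS => //; apply: mem_head.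
  have [c0 [post' Epost]] : exists c post', post = c :: post' by case: (post) cpost => // c' l _; exists c', l.
  have cpost' : conn [set t in post].
    by rewrite Epost; apply: (path_conn esym); move: pp; rewrite Ep' Epost cat_path /= => /and3P[].
  have u_post : u \in post by rewrite -lp Ep' Epost last_cat /= mem_last.
  have nyu : y != u by apply/eqP => E; apply: (Dpp y); rewrite // E.
  have cpset : c \in [set t in post] by rewrite in_set.
  apply: (fin (A' :|: [set t in post]) u) => //.
  - by apply: connU cA' cpost' kA' cpset _; rewrite ?ekc ?orbT.
  - rewrite subUset A'B; apply/subsetP => t; rewrite in_set => /postP; exact: (subsetP P1B).
  - apply/pred0P => t /=; apply/negP => /andP[tA /setUP[tA'|]].
      by rewrite (disjointFr AA' tA) in tA'.
    by rewrite in_set => /postP; rewrite (disjointFr DP1 (subsetP AD t tA)).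
  - by apply/setUP; left.
  - apply/pred0P => t /=; apply/negP => /andP[/setUP[tA'|t1] t2].
      by rewrite (disjointFr preA tA') in t2.
    by rewrite !in_set in t1 t2; apply: (Dpp t).
  - by apply/setUP; right; rewrite in_set.
  - by case/orP: y_le_u => // /eqP yu; rewrite yu eqxx in nyu.
Qed.

End Labels.

(** The labels are turned back into attachments on the first path and a meeting with [S]. *)
Lemma segment_path : exists p2, [/\ path e (qv i) p2, last (qv i) p2 = qv j,
  uniq (qv i :: p2), {subset qv i :: p2 <= D}
  & forall K, conn K -> K \subset D :\: [set z in qv i :: p2] ->
    #|attached e K [set z in qv i :: p2]| + #|attached e K P1| + hits K [set t in X] <= 3].
Proof.
have [pre [p0 [post [Ep postA p0A]]]] := hub_split.
have ltD : #|D| < #|B|.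
  apply: proper_card; apply/properP; split; first exact: D_sub.
  exists y; first by apply: (subsetP P1B).
  by apply/negP => yD; move: yP1; rewrite (disjointFr DP1 yD).
have [p2 [pp2 lp2 up2 sp2 bp2]] := IH ltD (labelled_segment Ep).
rewrite seg_last ?(ltnW ij) // in lp2.
exists p2; split=> // K cK KD; have := bp2 K cK KD.
set P2 := [set z in qv i :: p2] in KD *.
set N2 := [set w | e w p0]; set N3 := [set w | _ || _].
have KDP k : k \in K -> (k \in D) && (k \notin P2).
  by move/(subsetP KD); rewrite in_setD andbC.
have ends k : k \in K -> (k != qv i) && (k != qv j).
  move=> /KDP/andP[_]; rewrite in_set => kp; apply/andP; split; apply: contraNneq kp => ->.
    by rewrite mem_head.
  by rewrite -lp2 mem_last.
have attD : attached e K P1 \subset attached e Dg P1.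
  apply/subsetP => w /attachedP[wP [k kK ekw]]; apply/attachedP; split=> //.
  have /andP[kD _] := KDP k kK; have /andP[nki nkj] := ends k kK.
  case/DP: (kD) => [gk|[a /andP[ia aj] Ek]]; first by exists k; rewrite // in_set.
  have : w \in D.
    rewrite Ek in ekw nki nkj; apply: (@seg_interior a) ekw.
    - by rewrite ltn_neqAle ia andbT; apply: contra_neq nki => ->.
    - by rewrite ltn_neqAle aj andbT; apply: contra_neq nkj => ->.
    - exact: (subsetP P1B).
  by move=> wD; rewrite (disjointFr DP1 wD) in wP.
have KS : hits K [set t in S] -> hits Dg [set t in S].
  move=> /hitsP[k kK]; rewrite in_set => kS; apply/hitsP; exists k; rewrite in_set //.
  by apply: D_S; [case/andP: (KDP k kK) | rewrite mem_cat kS orbT].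
(* By [adj_noR] a bridge of the group misses [r], so on [X] it meets the segment or [S]. *)
have hX : hits K [set t in X] <= hits K [set z in qv i :: seg i j] + hits K [set t in S].
  have [/hitsP[k kK]|//] := boolP (hits K [set t in X]).
  have /andP[kD _] := KDP k kK; rewrite in_set.
  have segk : k \in v :: q -> hits K [set z in qv i :: seg i j].
    move=> kQ; apply/hitsP; exists k => //; case/DP: kD => [/grpP[/MP[_ + _]]|[a ija ->]].
      by rewrite kQ.
    by rewrite in_set; apply/segP; [apply: ltnW | exists a].
  rewrite /X mem_cat => /orP[/segk->//|kRS].
  have gk := D_S kD kRS; have [kM [c [cm kc _]] _ _] := grpP _ _ _ gk.
  move: kRS; rewrite mem_cat (negbTE (adj_noR kM cm kc)) /= => kS.
  have -> : hits K [set t in S] by apply/hitsP; exists k; rewrite // in_set.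
  by rewrite addn1.
(* One label pays for [p0], the other for what is left of [hub_count]. *)
have main : #|attached e K P1| + hits K [set t in S] <= hits K N2 + hits K N3.
  rewrite (cardsD1 p0) -addnA; apply: leq_add.
    have [/attachedP[_ [k kK ekp]]|//] := boolP (p0 \in _).
    by rewrite lt0b; apply/hitsP; exists k; rewrite // in_set.
  have [h3|nh3] := boolP (hits K N3).
    case: p0A => [p0D|D0].
      have := hub_count; rewrite (cardsD1 p0) p0D add1n addSn ltnS.
      apply: leq_trans; apply: leq_add; last exact: leq_hits.
      exact/subset_leq_card/setSD.
    have -> : attached e K P1 = set0 by apply/eqP; rewrite -subset0 -D0.
    by rewrite set0D cards0; case: (hits _ _).
  have -> : hits K [set t in S] = false.
    apply: contraNF nh3 => /hitsP[k kK]; rewrite in_set => kS.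
    by apply/hitsP; exists k; rewrite // in_set kS.
  rewrite addn0 leqn0 cards_eq0; apply/eqP/setP => w; rewrite [RHS]in_set0.
  apply: contraNF nh3 => /setD1P[nw wA]; have [_ [k kK ekw]] := attachedP _ _ _ _ wA.
  apply/hitsP; exists k => //; rewrite in_set; apply/orP; right; apply/hasP; exists w => //.
  by have := postA w (subsetP attD w wA); rewrite in_cons (negbTE nw).
move: hX main; move: #|attached e K P2| #|attached e K P1| (hits K N2) (hits K N3).
move: (hits K [set z in qv i :: seg i j]) (hits K [set t in S]) (hits K [set t in X]).
by clear; lia.
Qed.

End Segment.

(** What remains to be swept from [qv i] on: the rest of the arc and the components attached to the
    arc there only. *)
Let zone i := [set t | [exists c : 'I_m.+1, (i <= c) && (t == qv c)]
  || [&& t \in M, [exists c : 'I_m.+1, adj (J t) c]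
       & [forall c : 'I_m.+1, adj (J t) c ==> (i <= c)]]].

Let zoneP i t : t \in zone i -> (exists2 c, i <= c <= m & t = qv c) \/
  [/\ t \in M, exists2 c, c <= m & adj (J t) c & forall c, c <= m -> adj (J t) c -> i <= c].
Proof.
rewrite in_set => /orP[/existsP[c /andP[ic /eqP->]]|/and3P[tM /existsP[c tc] /forallP all_c]].
  by left; exists c; rewrite // ic -ltnS /=.
right; split=> //; first by exists c; rewrite // -ltnS.
by move=> b bm tb; have /implyP := all_c (Ordinal (n := m.+1) (m := b) bm); apply.
Qed.

Let zoneQ i c : i <= c -> c <= m -> qv c \in zone i.
Proof.
move=> ic cm; rewrite in_set; apply/orP; left; apply/existsP.
by exists (Ordinal (n := m.+1) (m := c) cm); rewrite /= ic eqxx.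
Qed.

Let zoneM i t c : t \in M -> c <= m -> adj (J t) c ->
  (forall c, c <= m -> adj (J t) c -> i <= c) -> t \in zone i.
Proof.
move=> tM cm tc all_c; rewrite in_set; apply/orP; right; rewrite tM /=.
apply/andP; split; first by apply/existsP; exists (Ordinal (n := m.+1) (m := c) cm).
by apply/forallP => b; apply/implyP; apply: all_c; rewrite -ltnS.
Qed.

Let zoneJ i z t : z \in M -> z \in zone i -> t \in J z -> t \in zone i.
Proof.
move=> zM /zoneP[[c /andP[_ cm] E]|[_ [c cm zc] all_c]] tz.
  by have [_ + _] := MP zM; rewrite E qv_in.
by have Jt := J_eq tz; apply: (zoneM (J_M tz) cm); rewrite Jt.
Qed.

Let zoneS i j : i <= j -> zone j \subset zone i.
Proof.
move=> ij; apply/subsetP => t /zoneP[[c /andP[jc cm] ->]|[tM [c cm tc] all_c]].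
  by apply: zoneQ => //; apply: leq_trans jc.
by apply: (zoneM tM cm tc) => b bm tb; apply: leq_trans ij (all_c b bm tb).
Qed.

Let adj_of z t c : z \in M -> t \in J z -> c <= m -> e t (qv c) -> adj (J z) c.
Proof. by move=> zM tJ cm etc; apply/adjP; exists t. Qed.

Let empty_bound K (P : {set T}) N : K = set0 -> #|attached e K P| + hits K N <= 3.
Proof.
move=> ->; have -> : hits set0 N = false by apply/hitsP => -[x]; rewrite in_set0.
by rewrite addn0 eq_card0 // => t; apply/negP => /attachedP[_ [x]]; rewrite in_set0.
Qed.

Let K_in_J K k : conn K -> K \subset M -> k \in K -> K \subset J k.
Proof.
move=> cK KM kK; apply: (component_max cK KM kK).
by apply: J_id; apply: (subsetP KM).
Qed.

Let hits_X K : K \subset M -> hits K [set t in X] ->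
  hits K [set t in y :: r] || hits K [set t in S].
Proof.
move=> /subsetP KM /hitsP[k kK]; rewrite in_set /X mem_cat.
have [_ /negbTE-> _] := MP (KM k kK); rewrite orFb mem_cat => /orP[kr|kS].
  by apply/orP; left; apply/hitsP; exists k; rewrite // in_set.
by apply/orP; right; apply/hitsP; exists k; rewrite // in_set.
Qed.

(** Its one attachment on the arc uses the unit that [bp] reserves for [NQ]. *)
Let single_bound K (P : {set T}) z i : conn K -> z \in M -> K \subset J z -> i <= m ->
  adj (J z) i -> (forall c, c <= m -> adj (J z) c -> c = i) -> P \subset B ->
  [disjoint J z & P] -> #|attached e K (P :|: P1)| + hits K [set t in X] <= 3.
Proof.
move=> cK zM KJ im zi only PB JP.
have KM : K \subset M := subset_trans KJ (JM z).
have := bp (J_conn zM) (JM z).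
have -> : hits (J z) NQ.
  have [s sJ esc] := adjP _ _ zi; apply/hitsP; exists s => //; rewrite in_set.
  by apply/exists_inP; exists (qv i); rewrite // in_set qv_in.
have att : #|attached e K (P :|: P1)| <= 1 + #|attached e (J z) P1|.
  rewrite -(cards1 (qv i)); apply: leq_trans (leq_card_setU _ _).
  apply: subset_leq_card; apply/subsetP => t /attachedP[tPP [k kK ekt]].
  have kJ := subsetP KJ k kK.
  have [tP1|tP1] := boolP (t \in P1).
    by apply/setUP; right; apply/attachedP; split=> //; exists k.
  have tP : t \in P by case/setUP: tPP tP1 => // ->.
  apply/setUP; left; rewrite in_set1.
  have [tQ|tQ] := boolP (t \in v :: q).
    have [c cm Et] := qvP tQ; rewrite Et (only c) //.
    by apply: (adj_of zM kJ cm); rewrite -Et.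
  have tM := inM (subsetP PB t tP) tQ tP1.
  have tJ : t \in J z by apply: component_closed kJ tM ekt.
  by rewrite (disjointFr JP tJ) in tP.
have hX : hits K [set t in X] <= hits (J z) [set t in y :: r] + hits (J z) [set t in S].
  have [/(hits_X KM)/orP[h|h]|//] := boolP (hits K _).
    by rewrite (hitsS KJ (subxx _) h).
  by rewrite (hitsS KJ (subxx _) h) addn1.
move: att hX; move: #|attached e K _| #|attached e (J z) _| (hits K _).
by move: (hits (J z) _) (hits (J z) _); clear; lia.
Qed.

(** The path of the segment up to the next milestone [j] is put before the path in the zone of [j];
    they share [qv j] only. A bridge lies in the segment, in the zone of [j], or in a component
    attached to the arc at [qv i] alone. *)
Lemma sweep i : i <= m -> milestone i -> exists s,
  [/\ path e (qv i) s, last (qv i) s = qv m, uniq (qv i :: s),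
    {subset qv i :: s <= zone i} &
    (forall k t, k \in zone i -> k \notin qv i :: s -> t \in B -> e k t ->
      (t \in zone i) || (t \in P1)) /\
    (forall K, conn K -> K \subset zone i :\: [set t in qv i :: s] ->
      #|attached e K ([set t in qv i :: s] :|: P1)| + hits K [set t in X] <= 3)].
Proof.
have [n] := ubnP (m - i); elim: n i => // n IHn i lt_n im mi.
have zoneB k : k \in zone i -> k \in B.
  by case/zoneP=> [[c /andP[_ cm] ->]|[/MP[]//]]; apply: qv_B.
have [Em|nm] := eqVneq i m.
  exists [::]; split=> //=; first by rewrite Em.
    by move=> t; rewrite inE => /eqP->; apply: zoneQ.
  have onlyi k : k \in zone i -> k \notin [:: qv i] ->
      [/\ k \in M, adj (J k) i & forall c, c <= m -> adj (J k) c -> c = i].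
    case/zoneP=> [[c /andP[ic cm] ->]|[kM [c cm kc] all_c]].
      have -> : c = i by apply/eqP; rewrite eqn_leq ic Em cm.
      by rewrite inE eqxx.
    have all_i b : b <= m -> adj (J k) b -> b = i.
      by move=> bm kb; apply/eqP; rewrite eqn_leq {1}Em bm all_c.
    by split=> //; rewrite -(all_i c cm kc).
  split.
    move=> k t kz kp tB ekt; have [kM ki only] := onlyi k kz kp.
    have [tP|tP] := boolP (t \in P1); first by rewrite orbT.
    rewrite orbF; have [tQ|tQ] := boolP (t \in v :: q).
      have [c cm Et] := qvP tQ; rewrite Et (only c) ?zoneQ //.
      by apply: (adj_of kM (J_id kM) cm); rewrite -Et.
    apply: (zoneJ kM kz); rewrite -(J_step kM _ ekt); first exact/J_id/inM.
    exact: inM.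
  move=> K cK KZ; have [K0|/set0Pn[k kK]] := eqVneq K set0; first exact: empty_bound.
  have KZ' t : t \in K -> (t \in zone i) && (t \notin [:: qv i]).
    by move/(subsetP KZ); rewrite in_setD in_set andbC.
  have KM : K \subset M by apply/subsetP => t /KZ'/andP[tz tp]; have [] := onlyi t tz tp.
  have /andP[kz kp] := KZ' k kK; have [kM ki only] := onlyi k kz kp.
  apply: (single_bound cK kM (K_in_J cK KM kK) im ki only).
    by apply/subsetP => t; rewrite in_set inE => /eqP->; apply: qv_B.
  by apply/pred0P => t /=; apply/negP => /andP[tJ]; rewrite in_set inE => /eqP E; move: (JQ k im); rewrite -E tJ.
have im' : i < m by rewrite ltn_neqAle nm.
have [j [ij jm mj spanj]] := next_milestone im' mi.
have [|s [ps ls us ss [cls bds]]] := IHn j _ jm mj.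
  by move: lt_n ij jm; clear; lia.
have [p2 [pp2 lp2 up2 sp2 bp2]] := segment_path ij jm mi mj spanj.
set D := _ :|: _ in sp2 bp2.
have closed := @seg_closed i j ij jm mi mj spanj; rewrite -/D in closed.
have DP t : t \in D -> grp i j t \/ exists2 a, i <= a <= j & t = qv a.
  case/setUP; first by rewrite in_set; left.
  by rewrite in_set => /(segP _ (ltnW ij)); right.
have qvD a : i <= a -> a <= j -> qv a \in D.
  move=> ia aj; apply/setUP; right; rewrite in_set.
  by apply/segP; [apply: ltnW | exists a; rewrite ?ia].
have DB t : t \in D -> t \in B.
  case/DP=> [/grpP[/MP[]//]|[a /andP[_ aj] ->]].
  exact/qv_B/(leq_trans aj).
have Dzone t : t \in D -> t \in zone i.
  case/DP=> [/grpP[tM [c [cm tc _]] _ all_c]|[a /andP[ia aj] ->]].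
    by apply: (zoneM tM cm tc) => b bm tb; case/andP: (all_c b bm tb).
  by apply: zoneQ => //; apply: leq_trans jm.
have DP1 t : t \in D -> t \notin P1.
  case/DP=> [/grpP[/MP[]//]|[a /andP[_ aj] ->]].
  by apply: P1Q; apply: leq_trans jm.
have Dzj t : t \in D -> t \in zone j -> t = qv j.
  case/DP=> [/grpP[tM _ [c [cm tc cj]] all_c]|[a /andP[ia aj] ->]] /zoneP[[b /andP[jb bm] E]|[tM' _ all_b]].
  - by have [_ + _] := MP tM; rewrite E qv_in.
  - have /andP[_ cj'] := all_c c cm tc.
    by move: cj; rewrite eqn_leq cj' (all_b c cm tc).
  - have am : a <= m := leq_trans aj jm.
    by rewrite (_ : a = j) //; apply/eqP; rewrite eqn_leq aj (qv_inj am bm E).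
  - by have [_ + _] := MP tM'; rewrite qv_in // (leq_trans aj).
have zsplit t : t \in zone i -> [\/ t \in D, t \in zone j |
    [/\ t \in M, adj (J t) i & forall c, c <= m -> adj (J t) c -> c = i]].
  case/zoneP=> [[c /andP[ic cm] ->]|[tM [c cm tc] all_c]].
    have [cj|jc] := leqP c j; first by constructor 1; apply: qvD.
    by constructor 2; apply: zoneQ => //; apply: ltnW.
  have [/forallP allj|] := boolP [forall b : 'I_m.+1, adj (J t) b ==> (j <= b)].
    constructor 2; apply: (zoneM tM cm tc) => b bm tb.
    by have /implyP := allj (Ordinal (n := m.+1) (m := b) bm); apply.
  rewrite negb_forall => /existsP[[a am] /=]; rewrite negb_imply -ltnNge => /andP[ta aj].
  have below b : b <= m -> adj (J t) b -> b <= j.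
    move=> bm tb; rewrite leqNgt; apply/negP => jb.
    exact: (mj t a b).
  have [/forallP alli|] := boolP [forall b : 'I_m.+1, adj (J t) b ==> (b == i :> nat)].
    have only b : b <= m -> adj (J t) b -> b = i.
      move=> bm tb; have /implyP := alli (Ordinal (n := m.+1) (m := b) bm).
      by move=> /(_ tb)/eqP.
    by constructor 3; split=> //; rewrite -(only c cm tc).
  rewrite negb_forall => /existsP[[b bm] /=]; rewrite negb_imply => /andP[tb nbi].
  constructor 1; apply/setUP; left; rewrite in_set; apply/grpP; split=> //.
  - by exists b; rewrite -ltnS.
  - by exists a; split=> //; rewrite ?neq_ltn ?aj // -ltnS.
  - by move=> d dm td; rewrite all_c // below.
have nij : qv i != qv j by apply: qv_ne => //; rewrite neq_ltn ij.
pose P2 := [set t in qv i :: p2]; pose Pj := [set t in qv j :: s].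
have memP t : (t \in qv i :: p2 ++ s) = (t \in P2) || (t \in Pj).
  have -> : (t \in P2) = (t \in qv i :: p2) by rewrite in_set.
  have -> : (t \in Pj) = (t \in qv j :: s) by rewrite in_set.
  rewrite -cat_cons mem_cat (in_cons (qv j) s).
  by have [->|//] := eqVneq t (qv j); rewrite /= orbT -lp2 mem_last.
have iP2 : qv i \in P2 by rewrite in_set mem_head.
have jP2 : qv j \in P2 by rewrite in_set -lp2 mem_last.
have jPj : qv j \in Pj by rewrite in_set mem_head.
have P2D t : t \in P2 -> t \in D by rewrite in_set => /sp2.
have Pjz t : t \in Pj -> t \in zone j by rewrite in_set => /ss.
have Dj_P t : t \in D -> t \in Pj -> t \in P2.
  by move=> tD /Pjz tz; rewrite (Dzj t tD tz).
have zj_P t : t \in zone j -> t \in P2 -> t \in Pj.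
  by move=> tz /P2D tD; rewrite (Dzj t tD tz).
have PB : P2 :|: Pj \subset B.
  apply/subsetP => t /setUP[/P2D/DB//|/Pjz]; move/(subsetP (zoneS (ltnW ij))); exact: zoneB.
have EP : [set t in qv i :: p2 ++ s] = P2 :|: Pj.
  by apply/setP => t; rewrite in_set memP in_setU.
have onlyP z : z \in M -> (forall c, c <= m -> adj (J z) c -> c = i) -> adj (J z) i ->
    [disjoint J z & P2 :|: Pj].
  move=> zM only zi; apply/pred0P => t /=; apply/negP => /andP[tz].
  have tM := J_M tz; have Jt := J_eq tz.
  case/setUP=> [/P2D/DP[/grpP[_ [c [cm tc ci]] _ _]|[a /andP[_ aj] E]]|/Pjz/zoneP[[c /andP[_ cm] E]|[_ [c cm tc] all_c]]].
  - by move: ci; rewrite (only c cm) ?eqxx // -Jt.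
  - by have [_ + _] := MP tM; rewrite E qv_in // (leq_trans aj).
  - by have [_ + _] := MP tM; rewrite E qv_in.
  - by have := all_c i im; rewrite Jt leqNgt ij => /(_ zi).
exists (p2 ++ s); split.
- by rewrite cat_path pp2 lp2.
- by rewrite last_cat lp2.
- rewrite -cat_cons cat_uniq up2; move: us => /= /andP[js ->]; rewrite andbT /=.
  apply/hasPn => t ts; apply/negP => /= t2; have tD := sp2 t t2.
  have tz : t \in zone j by apply: ss; rewrite in_cons ts orbT.
  by rewrite -(Dzj t tD tz) ts in js.
- move=> t; rewrite memP => /orP[/P2D/Dzone//|/Pjz].
  exact: (subsetP (zoneS (ltnW ij))).
split.
  move=> k t kz; rewrite memP negb_or => /andP[k2 kj] tB ekt.
  case: (zsplit k kz) => [kD|kzj|[kM ki only]].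
  - have := closed k t kD _ _ tB ekt; rewrite -!/D.
    have -> : k != qv i by apply: contraNneq k2 => ->.
    have -> : k != qv j by apply: contraNneq k2 => ->.
    by move=> /(_ isT isT)/orP[/Dzone->|->]; rewrite ?orbT.
  - have kj' : k \notin qv j :: s by move: kj; rewrite in_set.
    case/orP: (cls k t kzj kj' tB ekt) => [|->]; rewrite ?orbT //.
    by move/(subsetP (zoneS (ltnW ij))) => ->.
  - have [tP|tP] := boolP (t \in P1); first by rewrite orbT.
    rewrite orbF; have [tQ|tQ] := boolP (t \in v :: q).
      have [c cm Et] := qvP tQ; rewrite Et (only c) ?zoneQ //.
      by apply: (adj_of kM (J_id kM) cm); rewrite -Et.
    apply: (zoneJ kM kz); rewrite -(J_step kM _ ekt); first exact/J_id/inM.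
    exact: inM.
move=> K cK; rewrite EP => KZ.
have [K0|/set0Pn[k0 k0K]] := eqVneq K set0; first exact: empty_bound.
have KZ' t : t \in K -> [/\ t \in zone i, t \notin P2 & t \notin Pj].
  by move/(subsetP KZ); rewrite in_setD in_setU negb_or => /andP[/andP[-> ->] ->].
have KP1 t : t \in K -> t \notin P1.
  move=> /KZ'[/zoneP[[c /andP[_ cm] ->]|[/MP[]//]] _ _]; exact: P1Q.
have [/exists_inP[k kK kD]|noD] := boolP [exists k in K, k \in D].
  have inner t : t \in D -> t \in K -> (t != qv i) && (t != qv j).
    by move=> _ /KZ'[_ t2 _]; apply/andP; split; apply: contraNneq t2 => ->.
  have KD : K \subset D.
    apply: (conn_sub_closed cK kK kD) => a b aK bK aD eab.
    have /andP[ai aj] := inner a aD aK; have [bz _ _] := KZ' b bK.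
    by have := closed a b aD ai aj (zoneB b bz) eab; rewrite (negbTE (KP1 b bK)) orbF.
  have KD2 : K \subset D :\: P2.
    by apply/subsetP => t tK; have [_ t2 _] := KZ' t tK; rewrite in_setD t2 (subsetP KD).
  apply: leq_trans (bp2 K cK KD2); rewrite leq_add2r.
  apply: leq_trans (leq_card_setU _ _); apply: subset_leq_card.
  apply/subsetP => t /attachedP[tP [a aK eat]].
  have aD := subsetP KD a aK; have /andP[ai aj] := inner a aD aK.
  have [tP1|tP1] := boolP (t \in P1).
    by apply/setUP; right; apply/attachedP; split=> //; exists a.
  move: tP; rewrite in_setU (negbTE tP1) orbF => tP; have tB := subsetP PB t tP.
  have tD : t \in D by have := closed a t aD ai aj tB eat; rewrite (negbTE tP1) orbF.
  apply/setUP; left; apply/attachedP; split; last by exists a.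
  by case/setUP: tP => // /(Dj_P t tD).
have nD t : t \in K -> t \notin D.
  by move=> tK; apply: contra noD => tD; apply/exists_inP; exists t.
have [/exists_inP[k kK kz]|noz] := boolP [exists k in K, k \in zone j].
  have KZj : K \subset zone j.
    apply: (conn_sub_closed cK kK kz) => a b aK bK az eab.
    have [bz _ _] := KZ' b bK; have [_ _ aj] := KZ' a aK; rewrite in_set in aj.
    by have := cls a b az aj (zoneB b bz) eab; rewrite (negbTE (KP1 b bK)) orbF.
  have KZj2 : K \subset zone j :\: Pj.
    by apply/subsetP => t tK; have [_ _ tj] := KZ' t tK; rewrite in_setD tj (subsetP KZj).
  apply: leq_trans (bds K cK KZj2); rewrite leq_add2r.
  apply: subset_leq_card; apply/subsetP => t /attachedP[tP [a aK eat]].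
  apply/attachedP; split; last by exists a.
  have [tP1|tP1] := boolP (t \in P1); first by rewrite in_setU tP1 orbT.
  move: tP; rewrite in_setU (negbTE tP1) orbF => tP; have tB := subsetP PB t tP.
  have az := subsetP KZj a aK; have [_ _ aj] := KZ' a aK; rewrite in_set in aj.
  have tz : t \in zone j by have := cls a t az aj tB eat; rewrite (negbTE tP1) orbF.
  by rewrite in_setU; case/setUP: tP => [/(zj_P t tz)->|->].
have Konly t : t \in K -> [/\ t \in M, adj (J t) i & forall c, c <= m -> adj (J t) c -> c = i].
  move=> tK; have [tz _ _] := KZ' t tK; case: (zsplit t tz) => //.
    by rewrite (negbTE (nD t tK)).
  by move=> tzj; case/negP: noz; apply/exists_inP; exists t.
have KM : K \subset M by apply/subsetP => t /Konly[].
have [kM ki only] := Konly k0 k0K.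
exact: (single_bound cK kM (K_in_J cK KM k0K) im ki only PB (onlyP k0 kM only ki)).
Qed.

(** The swept path and the first path are joined by the prescribed edge from [last v q] to [y]. For
    a component without attachments on the arc, [bp] suffices. *)
Lemma disc_path : exists p',
  [/\ path e v p', last v p' = u, uniq (v :: p'), {subset v :: p' <= B} &
   [/\ last v q \in v :: p', y \in v :: p' & forall K, conn K ->
     K \subset B :\: [set z in v :: p'] ->
     #|attached e K [set z in v :: p']| + hits K [set z in X] <= 3]].
Proof.
have m0 : milestone 0 by [].
have [s [ps ls us ss [cls bds]]] := sweep (leq0n m) m0.
have Em : qv m = last v q by rewrite /qv /m -[size q]/((size (v :: q)).-1) nth_last.
rewrite -[qv 0]/v in ps ls us ss cls bds.
have zoneB k : k \in zone 0 -> k \in B.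
  by case/zoneP=> [[c /andP[_ cm] ->]|[/MP[]//]]; apply: qv_B.
have zoneP1 k : k \in zone 0 -> k \notin P1.
  by case/zoneP=> [[c /andP[_ cm] ->]|[/MP[]//]]; apply: P1Q.
have EP : [set z in v :: s ++ y :: p] = [set z in v :: s] :|: P1.
  by apply/setP => t; rewrite in_setU !in_set -cat_cons mem_cat.
exists (s ++ y :: p); split; [| | | | split].
- rewrite cat_path ps ls Em /= pp andbT.
  case/and3P: cyX => _ _; rewrite /X [cycle _ _]/= rcons_cat cat_path => /andP[_].
  by rewrite [rcons _ _]/= => /andP[].
- by rewrite last_cat.
- rewrite -cat_cons cat_uniq us up andbT; apply/hasPn => t tP; apply/negP => /= /ss/zoneP1.
  by rewrite in_set tP.
- move=> t; rewrite -cat_cons mem_cat => /orP[/ss/zoneB//|tP].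
  by apply: (subsetP P1B); rewrite in_set.
- by rewrite -Em -ls -cat_cons mem_cat mem_last.
- by rewrite -cat_cons mem_cat mem_head orbT.
move=> K cK; rewrite EP => KP.
have KZ' t : t \in K -> [/\ t \in B, t \notin v :: s & t \notin P1].
  by move/(subsetP KP); rewrite in_setD in_setU negb_or in_set => /andP[/andP[-> ->] ->].
have [/exists_inP[k kK kz]|noz] := boolP [exists k in K, k \in zone 0].
  have KZ : K \subset zone 0.
    apply: (conn_sub_closed cK kK kz) => a b aK bK az eab.
    have [bB _ bP] := KZ' b bK; have [_ as' _] := KZ' a aK.
    by have := cls a b az as' bB eab; rewrite (negbTE bP) orbF.
  apply: bds => //; apply/subsetP => t tK; have [_ ts _] := KZ' t tK.
  by rewrite in_setD in_set ts (subsetP KZ).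
have nz t : t \in K -> t \notin zone 0.
  by move=> tK; apply: contra noz => tz; apply/exists_inP; exists t.
have KM : K \subset M.
  apply/subsetP => t tK; have [tB _ tP] := KZ' t tK; apply: inM => //.
  by apply: contra (nz t tK) => /qvP[c cm ->]; apply: zoneQ.
have [K0|/set0Pn[k0 k0K]] := eqVneq K set0; first exact: empty_bound.
have noadj c : c <= m -> ~~ adj (J k0) c.
  move=> cm; apply/negP => kc; case/negP: (nz k0 k0K).
  by apply: (zoneM _ cm kc) => //; apply: (subsetP KM).
have KJ := K_in_J cK KM k0K; have k0M := subsetP KM k0 k0K.
have attE : attached e K ([set z in v :: s] :|: P1) \subset attached e K P1.
  apply/subsetP => t /attachedP[tP [a aK eat]]; apply/attachedP; split; last by exists a.
  have aJ := subsetP KJ a aK.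
  case/setUP: tP => //; rewrite in_set => /ss tz.
  have [tP1|tP1] := boolP (t \in P1) => //.
  have [tQ|tQ] := boolP (t \in v :: q).
    have [c cm Et] := qvP tQ; case/negP: (noadj c cm).
    by apply: (adj_of k0M aJ cm); rewrite -Et.
  have tM := inM (zoneB t tz) tQ tP1.
  have tJ : t \in J k0 by apply: component_closed aJ tM eat.
  case/negP: (nz k0 k0K); apply: (zoneJ tM tz).
  by rewrite (J_eq tJ) J_id.
have := bp cK KM; have := subset_leq_card attE.
have hX : hits K [set t in X] <= hits K [set t in y :: r] + hits K [set t in S].
  have [/(hits_X KM)/orP[->|->]|//] := boolP (hits K [set t in X]); by rewrite ?addn1.
move: hX; move: #|attached e K _| #|attached e K _| (hits K _) (hits K _) (hits K _) (hits K _).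
by clear; lia.
Qed.

End Sweep.

End DiscStep.

(** Both paths are found in proper subsets of the disc, whose blocks are smaller discs. *)
Lemma disc_tutteT B : disc_tutte B.
Proof.
have [n] := ubnP #|B|; elim: n B => // n IHn B ltB v q y r S f X cyX XB fX insB.
have IH H v' r' N2 N3 : #|H| < #|B| -> labelled H v' r' N2 N3 -> tutte_path H v' r' N2 N3.
  move=> ltH; apply: (@labelled_tutte_path #|H|) => // B' leB'.
  by apply: IHn; apply: leq_ltn_trans leB' (leq_trans ltH _).
have [p [pp lp up sp bp]] := first_path cyX XB fX insB IH.
exact: (disc_path cyX XB fX insB IH pp lp up sp bp).
Qed.

End Disc.

(** * Cycles with an independent complement *)

Section Connectivity.
Variables (T : finType) (e : rel T).
Hypotheses (simpl : simple_graph e) (tri : three_connected e).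
Implicit Types (K S : {set T}).
Let esym : symmetric e. Proof. by case: simpl. Qed.
Let eirr : irreflexive e. Proof. by case: simpl. Qed.

Lemma conn_minus S : connected_minus e S <-> conn e (~: S).
Proof.
have E : del_rel e S =2 rel_in e (~: S) by move=> x y; rewrite /del_rel /rel_in /= !in_setC.
split=> cS x y xS yS.
  by rewrite -(eq_connect E); apply: cS; rewrite -in_setC.
by rewrite (eq_connect E); apply: cS; rewrite in_setC.
Qed.

(** Otherwise [S] would separate [K] from [z]. *)
Lemma closed_small K S z : K != set0 -> #|S| < 3 ->
  (forall x y, x \in K -> e x y -> (y \in K) || (y \in S)) ->
  [disjoint K & S] -> (z \in K) || (z \in S).
Proof.
move=> /set0Pn[x xK] S3 cl KS; have [_ /(_ S S3)/conn_minus cS] := tri.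
have [zS|zS] := boolP (z \in S); first by rewrite orbT.
rewrite orbF.
apply: (subsetP (conn_sub_closed cS (x := x) _ xK _)); rewrite ?in_setC //.
  by rewrite (disjointFr KS xK).
move=> a b _; rewrite in_setC => bS aK eab.
by have := cl a b aK eab; rewrite (negbTE bS) orbF.
Qed.

(** Otherwise, by [closed_small], [x] and its at most two neighbours would be all vertices. *)
Lemma degree_ge3 x : 2 < #|[set y | e x y]|.
Proof.
rewrite ltnNge; apply/negP => le2; have [T4 _] := tri.
set N := [set y | _] in le2.
have : [set: T] \subset x |: N.
  apply/subsetP => z _; rewrite in_setU1 -(in_set1 z).
  apply: closed_small => //.
  - by apply/set0Pn; exists x; rewrite set11.
  - by move=> a b /set1P-> eab; rewrite [b \in N]in_set eab orbT.
  - by rewrite disjoints1 in_set eirr.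
move=> /subset_leq_card; rewrite cardsT cardsU1 => le.
by move: T4 le le2; case: (_ \notin _); move: #|T| #|N|; clear; lia.
Qed.

Lemma three_connected_connect x y : connect e x y.
Proof.
have [_ /(_ set0)] := tri; rewrite cards0 => /(_ isT x y); rewrite !in_set0 => /(_ isT isT).
by apply: connect_sub => a b /and3P[eab _ _]; apply: connect1.
Qed.

(** There is one component and no isolated vertex, which brings Euler's formula to its usual
    form. *)
Lemma planar_plane : planar e -> exists rho, plane_graph e rho.
Proof.
move=> [rho [rot euler]]; exists rho; apply: euler_plane_graph => //.
  exact: three_connected_connect.
have iso : num_isolated e = 0.
  apply/eqP; rewrite cards_eq0 -subset0; apply/subsetP => x; rewrite in_set => /forallP no.
  have := degree_ge3 x; rewrite (_ : [set y | e x y] = set0) ?cards0 //.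
  by apply/setP => y; rewrite in_set in_set0; apply/negbTE.
have comp : num_components e = 1.
  have [T4 _] := tri; have /card_gt0P[x _] : 0 < #|T| by apply: leq_trans T4.
  rewrite -(n_comp_connect (sym_connect_sym esym) x); apply: eq_n_comp_r => y.
  by rewrite in_setT; symmetry; apply: three_connected_connect.
by move: euler; rewrite iso comp addn0.
Qed.

Lemma conn_del o : conn e (~: [set o]).
Proof. by have [_ h] := tri; apply/conn_minus/h; rewrite cards1. Qed.

Lemma conn_del2 o w : conn e (~: [set o] :\ w).
Proof.
have [_ h] := tri; rewrite setDE -setCU; apply/conn_minus/h.
by apply: leq_ltn_trans (leq_card_setU _ _) _; rewrite !cards1.
Qed.

End Connectivity.

Section OuterIndependent.
Variables (T : finType) (e : rel T) (rho : T -> T -> T).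
Hypotheses (simpl : simple_graph e) (ess : essentially_4_connected e).
Hypothesis G : plane_graph e rho.
Implicit Types (K S : {set T}) (s X : seq T).
Let tri : three_connected e. Proof. by case: ess. Qed.
Let esym := pg_sym G.
Let eirr := pg_irr G.
Local Notation nbrs x := [set y | e x y].

(* An outer-independent cycle all of whose outer vertices are cubic. *)
Definition oi3 s : Prop := is_graph_cycle e s /\
  forall x, x \notin s -> #|nbrs x| = 3 /\ forall y, e x y -> y \in s.

(** By 3-connectivity [K], [K'] and the component of [y] are each adjacent to all of [S], a K33
    minor. *)
Lemma three_closed_sets S K K' y : #|S| = 3 -> conn e K -> conn e K' ->
  (forall a b, a \in K -> e a b -> (b \in K) || (b \in S)) ->
  (forall a b, a \in K' -> e a b -> (b \in K') || (b \in S)) ->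
  K != set0 -> K' != set0 -> [disjoint K & S] -> [disjoint K' & S] -> [disjoint K & K'] ->
  ~~ [|| y \in K, y \in K' | y \in S] -> False.
Proof.
move=> S3 cK cK' clK clK' K0 K'0 DKS DKS' DKK.
rewrite !negb_or => /and3P[yK yK' yS]; have yS' : y \in ~: S by rewrite in_setC.
set Y := component e (~: S) y.
have cY : conn e Y := component_conn esym yS'.
have yY : y \in Y := component_id e yS'.
have YS z : z \in Y -> z \notin S by move/(subsetP (component_sub _ _ _)); rewrite in_setC.
have DYS : [disjoint Y & S].
  by apply/pred0P => t /=; apply/negP => /andP[/YS/negbTE->].
have clY a b : a \in Y -> e a b -> (b \in Y) || (b \in S).
  move=> aY eab; have [bS|bS] := boolP (b \in S); first by rewrite orbT.
  by rewrite (component_closed aY _ eab) ?in_setC.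
have DY (M : {set T}) : (forall a b, a \in M -> e a b -> (b \in M) || (b \in S)) -> y \notin M ->
    [disjoint M & Y].
  move=> clM yM; apply/pred0P => z /=; apply/negP => /andP[zM zY].
  case/negP: yM; apply: (subsetP (conn_sub_closed cY zY zM _)) => // a b aY bY aM eab.
  by have := clM a b aM eab; rewrite (negbTE (YS b bY)) orbF.
have adj (M : {set T}) x : (forall a b, a \in M -> e a b -> (b \in M) || (b \in S)) -> M != set0 ->
    [disjoint M & S] -> x \notin M -> x \notin S -> forall z, z \in S -> exists2 k, k \in M & e k z.
  move=> clM M0 DMS xM xS z zS; have [lt|ge] := ltnP #|attached e M S| 3.
    have /orP[|/attachedP[]] : (x \in M) || (x \in attached e M S); last by rewrite (negbTE xS).
      apply: (closed_small tri _ M0 lt).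
        move=> a b aM eab; case/orP: (clM a b aM eab) => [->//|bS].
        by apply/orP; right; apply/attachedP; split=> //; exists a.
      by apply/pred0P => t /=; apply/negP => /andP[tM /attachedP[]]; rewrite (disjointFr DMS tM).
    by rewrite (negbTE xM).
  have sub : attached e M S \subset S by apply/subsetP => t /attachedP[].
  have /eqP E : attached e M S == S by rewrite eqEcard sub S3.
  by move: zS; rewrite -{1}E => /attachedP[].
have [a [b [c [ES uabc]]]] : exists a b c, S =i [:: a; b; c] /\ uniq [:: a; b; c].
  move: S3; rewrite cardE; case E : (enum S) => [|a [|b [|c [|]]]] //= _.
  exists a, b, c; split; last by have := enum_uniq S; rewrite E.
  by move=> t; rewrite -mem_enum E.
have /set0Pn[k kK] := K0.
apply: (no_K33 G uabc cK cK' cY DKK (DY K clK yK) (DY K' clK' yK')).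
  move=> z; rewrite -ES => zS; rewrite !in_setU !negb_or.
  by rewrite (disjointFl DKS zS) (disjointFl DKS' zS) (disjointFl DYS zS).
move=> z S'; rewrite -ES !in_cons orbF => zS /or3P[]/eqP->.
- exact: (adj K y).
- exact: (adj K' y).
apply: (adj Y k) => //; first by apply/set0Pn; exists y.
  by rewrite (disjointFr (DY K clK yK) kK).
by rewrite (disjointFr DKS kK).
Qed.

(** A sixth vertex exists besides the two and their common neighbours, so [three_closed_sets]
    applies. *)
Lemma twins v v' : 5 < #|T| -> #|nbrs v| = 3 -> nbrs v = nbrs v' -> v = v'.
Proof.
move=> T6 d3 E; apply/eqP/negPn/negP => vv'.
have vN : v \notin nbrs v by rewrite in_set eirr.
have vN' : v' \notin nbrs v by rewrite E in_set eirr.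
have [y] : exists y, y \in ~: (v |: (v' |: nbrs v)).
  apply/set0Pn; rewrite -card_gt0; have := cardsC (v |: (v' |: nbrs v)).
  rewrite !cardsU1 d3 !in_setU1 (negbTE vN) (negbTE vv') vN' /= => h; move: T6; rewrite -h.
  by case: #|_|.
rewrite in_setC !in_setU1 => yN.
apply: (@three_closed_sets (nbrs v) [set v] [set v'] y d3 (@conn1 _ e v) (@conn1 _ e v')).
- by move=> a b /set1P-> eab; rewrite [b \in nbrs v]in_set eab orbT.
- by move=> a b /set1P-> eab; rewrite E [b \in nbrs v']in_set eab orbT.
- by apply/set0Pn; exists v; rewrite set11.
- by apply/set0Pn; exists v'; rewrite set11.
- by rewrite disjoints1.
- by rewrite disjoints1.
- by rewrite disjoints1 in_set1.
- by rewrite !in_set1.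
Qed.

(** The attachments [S] of a bridge [K] form a 3-separator, so some [x'] has neighbourhood [S]. If
    [x'] is in [K], it is all of [K]. If not, [K], [x'] and a further vertex of the cycle give a K33
    minor; length five provides that vertex even if [x'] is on the cycle. *)
Lemma tutte_oi3 s : is_graph_cycle e s -> 4 < size s ->
  (forall K, conn e K -> K \subset ~: [set z in s] -> #|attached e K [set z in s]| <= 3) ->
  oi3 s.
Proof.
move=> cy s5 tutte; split=> // x xs.
set C := [set z in s] in tutte.
have cardC : 4 < #|C| by rewrite cardsE (card_uniqP _) //; case/and3P: cy.
have memC z : (z \in C) = (z \in s) by rewrite in_set.
have xC : x \in ~: C by rewrite in_setC memC.
set K := component e (~: C) x.
have cK : conn e K := component_conn esym xC.
have KC : K \subset ~: C := component_sub _ _ _.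
have xK : x \in K := component_id e xC.
have nKC z : z \in K -> z \notin s by move/(subsetP KC); rewrite in_setC memC.
set S := attached e K C; have leS : #|S| <= 3 := tutte K cK KC.
have SC : S \subset C by apply/subsetP => z /attachedP[].
have DKS : [disjoint K & S].
  by apply/pred0P => z /=; apply/negP => /andP[/nKC + /(subsetP SC)]; rewrite memC => /negbTE->.
have clK a b : a \in K -> e a b -> (b \in K) || (b \in S).
  move=> aK eab; have [bC|bC] := boolP (b \in C).
    by apply/orP; right; apply/attachedP; split=> //; exists a.
  by rewrite (component_closed aK _ eab) ?in_setC.
have K0 : K != set0 by apply/set0Pn; exists x.
have [w wCS] : exists w, w \in C :\: S.
  apply/set0Pn; rewrite -card_gt0 cardsD (setIidPr SC).
  by move: cardC leS; move: #|C| #|S|; clear; lia.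
have wKS : (w \in K) || (w \in S) = false.
  move: wCS; rewrite in_setD memC => /andP[/negbTE-> ws]; rewrite orbF.
  by apply/negbTE/negP => /nKC; rewrite ws.
have S3 : #|S| = 3.
  apply/eqP; rewrite eqn_leq leS leqNgt; apply/negP => lt.
  by have := closed_small tri w K0 lt clK DKS; rewrite wKS.
have wS : w \notin S by case/setDP: wCS.
have xS : x \notin S by rewrite (disjointFr DKS xK).
have sepS : separator e S 3.
  split=> // /conn_minus cS.
  have : ~: S \subset K.
    apply: (conn_sub_closed cS (x := x)); rewrite ?in_setC // => a b _; rewrite in_setC => bS aK eab.
    by have := clK a b aK eab; rewrite (negbTE bS) orbF.
  by move/subsetP/(_ w); rewrite in_setC => /(_ wS) wK; rewrite wK in wKS.
have [x' [x'S nx']] := ess.2 S sepS.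
have Nx' : nbrs x' = S.
  apply/eqP; rewrite eqEcard S3 (degree_ge3 simpl tri) andbT.
  by apply/subsetP => y; rewrite in_set; apply: nx'.
suff Kx : K \subset [set x].
  have Nx : nbrs x \subset S.
    apply/subsetP => y; rewrite in_set => exy; have := clK x y xK exy.
    case/orP=> // /(subsetP Kx)/set1P E.
    by rewrite E eirr in exy.
  split; last by move=> y exy; rewrite -memC; apply/(subsetP SC)/(subsetP Nx); rewrite in_set.
  apply/eqP; rewrite eqn_leq (degree_ge3 simpl tri) andbT -S3.
  exact: subset_leq_card.
have [x'K|x'K] := boolP (x' \in K).
  have sub : K \subset [set x'].
    apply: (conn_sub_closed cK x'K); rewrite ?set11 // => a b aK bK /set1P-> eab.
    by have := nx' b eab; rewrite (disjointFr DKS bK).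
  by have /set1P xx := subsetP sub x xK; move: sub; rewrite -xx.
have [y] : exists y, y \in C :\: S :\ x'.
  apply/set0Pn; rewrite -card_gt0; have := cardsD1 x' (C :\: S); rewrite cardsD (setIidPr SC).
  by move: cardC leS; case: (_ \in _); move: #|C| #|S| #|_ :\ _|; clear; lia.
case/setD1P=> yx' /setDP[yC yS].
have clx' a b : a \in [set x'] -> e a b -> (b \in [set x']) || (b \in S).
  by move=> /set1P-> /nx' ->; rewrite orbT.
case: (@three_closed_sets S K [set x'] y S3 cK (@conn1 _ e x') clK clx' K0) => //.
- by apply/set0Pn; exists x'; rewrite set11.
- by rewrite disjoints1.
- by rewrite disjoint_sym disjoints1.
- by rewrite in_set1 (negbTE yS) (negbTE yx') !orbF; apply/negP => /nKC; rewrite -memC yC.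
Qed.

(** The Tutte path will contain the ends of the arc and the edge [x y], hence four vertices, and a
    fifth one comes with the root. If the arc from the first to the last vertex of [N] has only
    three vertices, all are in [N], and the arc from the third around to the second serves
    instead. *)
Lemma four_arc (N : pred T) s : uniq s -> 3 < size s -> 2 < count N s ->
  exists n v x y z r (w : seq T), [/\ rot n s = (v :: [:: x]) ++ (y :: z :: r) ++ w, N v
    & N (last y (z :: r))].
Proof.
move=> us s4 c3.
have [a as' Na] : exists2 a, a \in s & N a.
  by apply/hasP; rewrite has_count; apply: leq_trans c3.
have [n s' E] := rot_to as'.
have c2 : 1 < count N s'.
  by have /seq.permP cr := permEl (perm_rot n s); move: c3; rewrite -cr E /= Na.
have s3 : 2 < size s' by move: s4; rewrite -(size_rot n) E.
have [s1 [s2 [Es' H2 H1]]] := split_last_sat N s'.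
have c1 : 1 < count N s1.
  move: c2; rewrite Es' count_cat [count N s2](_ : _ = 0) ?addn0 //.
  by apply/eqP; rewrite -leqn0 leqNgt -has_count; apply/hasPn.
case: H1 => [E1|[t [u [E1 Nu]]]]; first by rewrite E1 in c1.
case: t E1 => [|b t] E1; first by rewrite E1 /= Nu in c1.
case: t E1 => [|c t] E1.
  have Nb : N b by move: c1; rewrite E1 /= Nu; case: (N b).
  case: s2 Es' {H2} => [|c s2] Es'; first by rewrite Es' E1 in s3.
  have [k Ek] : exists k, rot k s = u :: c :: s2 ++ [:: a; b].
    by exists (rot_add s n 2); rewrite -rot_rot_add E Es' E1.
  case: s2 Es' Ek => [|z s2] Es' Ek; exists k, u, c.
    by exists a, b, [::], [::].
  case: s2 Es' Ek => [|z' s2] Es' Ek; exists z.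
    by exists a, [:: b], [::].
  by exists z', (s2 ++ [:: a; b]), [::]; rewrite cats0 /= last_cat.
exists n, a, b, c; rewrite E Es' E1 /=; case: t E1 => [|d t] E1.
  by exists u, [::], s2.
by exists d, (rcons t u), s2; rewrite /= last_rcons.
Qed.

(** Closing the path through [o] gives a bridge the new attachment [o] only if the bridge meets [X],
    which contains the neighbours of [o]; in this case [disc_tutte] leaves a unit to spare. *)
Lemma long_oi3_of_root o X f b0 : e o b0 -> is_graph_cycle e X -> {subset X <= ~: [set o]} ->
  interior e rho o b0 f X ->
  (forall x y, x \in ~: [set o] -> y \in ~: [set o] -> e x y -> inside e f x y) ->
  {subset nbrs o <= X} -> 3 < size X -> exists s, oi3 s /\ 4 < size s.
Proof.
move=> eo cyX XH fX insH NX X4.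
have [||n [v [x [y [z [r [w [E Nv Nu]]]]]]]] := @four_arc (e o) X _ X4.
- by case/and3P: cyX.
- rewrite -size_filter; apply: leq_trans (degree_ge3 simpl tri o) _.
  have uX : uniq X by case/and3P: cyX.
  rewrite -(card_uniqP (filter_uniq _ uX)).
  by apply: subset_leq_card; apply/subsetP => t; move=> tN; rewrite mem_filter NX // andbT; move: tN; rewrite in_set.
have cyX' := is_graph_cycle_rot n cyX.
have fX' : interior e rho o b0 f (rot n X) by case: fX => bX f0; split=> //; apply: is_bd_rot.
rewrite E in cyX' fX'.
have XH' : {subset (v :: [:: x]) ++ (y :: z :: r) ++ w <= ~: [set o]}.
  by move=> t; rewrite -E mem_rot; apply: XH.
have [p [pp lp up sp [xp yp tutte]]] := disc_tutteT G eo cyX' XH' fX' insH.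
have op : o \notin v :: p by apply/negP => /sp; rewrite in_setC set11.
have size_p : 3 < size (v :: p).
  have u4 : uniq [:: v; x; y; last y (z :: r)].
    have uz : last y (z :: r) \in z :: r by rewrite /= mem_last.
    case/and3P: cyX' => _ + _; rewrite -[_ ++ _]/([:: v; x; y] ++ (z :: r) ++ w) cat_uniq.
    case/and3P=> u3 /hasPn no _; rewrite -[[:: v; x; y; _]]/(rcons [:: v; x; y] _) rcons_uniq u3.
    by rewrite no // mem_cat uz.
  rewrite -(card_uniqP up); apply: (@leq_trans (size [:: v; x; y; last y (z :: r)])) => //.
  rewrite -(card_uniqP u4); apply: subset_leq_card.
  apply/subsetP/allP; rewrite [all _ _]/= mem_head [x \in _]xp yp.
  by rewrite -[last z r]/(last y (z :: r)) -lp mem_last.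
have cys : is_graph_cycle e (o :: v :: p).
  rewrite /is_graph_cycle cons_uniq op up /= rcons_path pp lp (esym _ o) Nu Nv !andbT.
  by move: size_p; clear; rewrite /=; lia.
exists (o :: v :: p); split; last by move: size_p => /=.
apply: tutte_oi3 => // K cK KC.
have KB : K \subset ~: [set o] :\: [set z in v :: p].
  by apply/subsetP => t /(subsetP KC); rewrite in_setC in_setD [t \in ~: _]in_setC in_set1 !in_set (in_cons o) negb_or andbC.
apply: leq_trans (tutte K cK KB).
have att : attached e K [set z in o :: v :: p] \subset attached e K [set z in v :: p] :|: attached e K [set o].
  apply/subsetP => t /attachedP[tC [k kK ekt]]; rewrite in_setU.
  move: tC; rewrite in_set in_cons => /orP[/eqP E'|tp].
    by apply/orP; right; apply/attachedP; split; [rewrite E' set11 | exists k].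
  by apply/orP; left; apply/attachedP; split; [rewrite in_set | exists k].
apply: leq_trans (subset_leq_card att) (leq_trans (leq_card_setU _ _) _); rewrite leq_add2l.
have [h|h] := boolP (hits K _).
  apply: (@leq_trans #|[set o]|); last by rewrite cards1.
  by apply: subset_leq_card; apply/subsetP => t /attachedP[].
rewrite leqn0 cards_eq0 -subset0; apply/subsetP => t /attachedP[/set1P-> [k kK eko]].
case/negP: h; apply/hitsP; exists k => //; rewrite in_set -E mem_rot; apply: NX.
by rewrite in_set esym.
Qed.

(** The outer dart starts at [o], so all faces at [o] are outer ones, and a neighbour of [o] off the
    cycle would have none of its edges in the disc. *)
Lemma outer_of_root o : exists b0 X f, [/\ e o b0, is_graph_cycle e X, {subset X <= ~: [set o]},
  interior e rho o b0 f X &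
  (forall x y, x \in ~: [set o] -> y \in ~: [set o] -> e x y -> inside e f x y) /\
  {subset nbrs o <= X}].
Proof.
have deg x := degree_ge3 simpl tri x.
have /card_gt0P[b0] : 0 < #|nbrs o| by apply: leq_trans (deg o).
rewrite in_set => eo.
have H2 : 2 < #|~: [set o]| by rewrite cardsC1; have [T4 _] := tri; move: T4; clear; lia.
have [X [f [cyX XH fX insH]]] := outer_cycle G eo (conn_del tri (o := o)) (fun w _ => conn_del2 tri (w := w)) H2.
exists b0, X, f; split=> //; split=> // w; rewrite in_set => eow.
apply/negP => /negP wX; have oX : o \notin X by apply/negP => /XH; rewrite in_setC set11.
have wo : w \in ~: [set o] by rewrite in_setC in_set1; apply: contraTneq eow => ->; rewrite eirr.
have [bX f0] := fX; have const z : z \notin X -> forall x y, e z x -> e z y -> f z x = f z y.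
  move=> zX x y; apply: (face_fun_at esym (pg_rot G)); first by case: bX.
  by move=> {}y ezy; rewrite (off_cycle bX zX ezy).
have swap z y : z \notin X -> e z y -> f z y = f y z.
  by move=> zX ezy; have := off_cycle bX zX ezy; rewrite /bd; case: (f z y); case: (f y z).
have [w'] : exists w', w' \in nbrs w :\ o.
  apply/set0Pn; rewrite -card_gt0; have := deg w; rewrite (cardsD1 o) in_set esym eow.
  by case: #|_|.
rewrite in_setD1 in_set => /andP[w'o eww'].
have w'H : w' \in ~: [set o] by rewrite in_setC in_set1.
have /andP[_] := insH w w' wo w'H eww'.
have ewo : e w o by rewrite esym.
rewrite -(swap w w' wX eww') orbb (const w wX w' o eww' ewo) (swap w o wX ewo).
rewrite (const o oX w b0 eow eo).
by rewrite f0.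
Qed.

(** A root of degree at least four has an outer cycle of length at least four. If all vertices are
    cubic and the outer cycle is a triangle, the graph is K4, which is Hamiltonian. *)
Lemma oi3_exists : exists s, (oi3 s /\ 4 < size s) \/
  (is_graph_cycle e s /\ 3 * (#|T| + 2) <= 5 * size s).
Proof.
have deg x := degree_ge3 simpl tri x.
have root o : 3 < #|nbrs o| -> exists s, oi3 s /\ 4 < size s.
  move=> d4; have [b0 [X [f [eo cyX XH fX [insH NX]]]]] := outer_of_root o.
  apply: (long_oi3_of_root eo cyX XH fX insH NX); apply: leq_trans d4 _.
  rewrite -(card_uniqP _); last by case/and3P: cyX.
  exact/subset_leq_card/subsetP.
have [/existsP[o /root[s hs]]|/existsPn d3] := boolP [exists o, 3 < #|nbrs o|].
  by exists s; left.
have {}d3 x : #|nbrs x| = 3 by apply/eqP; rewrite eqn_leq deg leqNgt d3.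
have /card_gt0P[o _] : 0 < #|T| by have [T4 _] := tri; apply: leq_trans T4.
have [b0 [X [f [eo cyX XH fX [insH NX]]]]] := outer_of_root o.
have [X4|X3] := ltnP 3 (size X).
  by have [s hs] := long_oi3_of_root eo cyX XH fX insH NX X4; exists s; left.
have {X3}X3 : size X = 3 by apply/eqP; rewrite eqn_leq X3; case/andP: cyX.
have uX : uniq X by case/and3P: cyX.
have NE : nbrs o = [set x in X].
  apply/eqP; rewrite eqEcard d3 cardsE (card_uniqP uX) X3 andbT.
  by apply/subsetP => t /NX; rewrite [t \in [set _ in _]]in_set.
have oX : o \notin X by apply/negP => /XH; rewrite in_setC set11.
have oN x : x \in X -> e o x.
  move=> xX; have : x \in nbrs o by rewrite NE in_set.
  by rewrite in_set.
exists (o :: X); right; move: X3 cyX oX oN NE; case: X {XH fX NX uX} => [|a [|b [|c []]]] //= _.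
case/and3P=> _ uabc cabc oX oN NE; have eoa := oN a (mem_head _ _).
have eoc : e o c by apply: oN; rewrite !inE eqxx !orbT.
move: cabc => /= /and4P[eab ebc eca _].
have eob : e o b by apply: oN; rewrite !inE eqxx !orbT.
split; first by rewrite /is_graph_cycle cons_uniq oX uabc /= eoa eab ebc (esym c o) eoc.
have only x p q r : e x p -> e x q -> e x r -> uniq [:: p; q; r] ->
    forall y, e x y -> y \in [:: p; q; r].
  move=> xp xq xr u3 y exy; have E : [set z in [:: p; q; r]] = nbrs x.
    apply/eqP; rewrite eqEcard d3 cardsE (card_uniqP u3) leqnn andbT.
    by apply/subsetP => z; rewrite !inE => /or3P[]/eqP->.
  have : y \in nbrs x by rewrite in_set.
  by rewrite -E in_set.
have oabc : uniq [:: o; a; b; c] by rewrite cons_uniq oX.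
suff : [set: T] \subset [set z in [:: o; a; b; c]].
  by move/subset_leq_card; rewrite cardsT cardsE (card_uniqP oabc) /=; clear; lia.
have clo x y : x \in [:: o; a; b; c] -> e x y -> y \in [:: o; a; b; c].
  move: oabc; rewrite /= !inE !negb_or !andbT => /and3P[/and3P[oa ob oc] /andP[ab ac] bc].
  case/or4P=> /eqP-> exy.
  - have := only o a b c eoa eob eoc uabc y exy; rewrite !inE => ->; by rewrite orbT.
  - have := only a o b c _ eab _ _ y exy; rewrite esym eoa esym eca /= !inE !negb_or ob oc bc.
    by case/(_ isT isT isT)/or3P=> ->; rewrite ?orbT.
  - have := only b o a c _ _ ebc _ y exy; rewrite esym eob esym eab /= !inE !negb_or oa oc ac.
    by case/(_ isT isT isT)/or3P=> ->; rewrite ?orbT.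
  - have := only c o a b _ eca _ _ y exy; rewrite esym eoc esym ebc /= !inE !negb_or oa ob ab.
    by case/(_ isT isT isT)/or3P=> ->; rewrite ?orbT.
apply/subsetP => z _; have /connectP[p pp ->] := three_connected_connect tri o z.
have : o \in [:: o; a; b; c] by rewrite mem_head.
rewrite in_set; move: [:: o; a; b; c] clo => L clo; elim: p (o) pp => //= y p IHp x /andP[exy pp] xo.
by apply: IHp => //; apply: clo exy.
Qed.

End OuterIndependent.

Import Order.TTheory GRing.Theory Num.Theory.

(** * Discharging *)

(** The neighbours of two outer vertices on a segment do not cross, so each triple lies in a gap of
    the other or beside it. The first has the wider span, so it is not enclosed by the second. *)
Lemma triple_span (x1 x2 x3 y1 y2 y3 : nat) : x1 < x2 -> x2 < x3 -> y1 < y2 -> y2 < y3 ->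
  y3 - y1 <= x3 - x1 ->
  (forall X X' Y, X \in [:: x1; x2; x3] -> X' \in [:: x1; x2; x3] -> Y \in [:: y1; y2; y3] ->
     X < Y -> Y < X' -> (X <= y1) && (y3 <= X')) ->
  ~~ [&& y1 == x1, y2 == x2 & y3 == x3] ->
  [|| y3 <= x1, (x1 <= y1) && (y3 <= x2), (x2 <= y1) && (y3 <= x3) | x3 <= y1].
Proof.
move=> x12 x23 y12 y23 span no tw.
have m1 (a b d : nat) : a \in [:: a; b; d] by rewrite !inE eqxx.
have m2 (a b d : nat) : b \in [:: a; b; d] by rewrite !inE eqxx orbT.
have m3 (a b d : nat) : d \in [:: a; b; d] by rewrite !inE eqxx !orbT.
have := no _ _ _ (m1 _ _ _) (m2 _ _ _) (m1 _ _ _).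
have := no _ _ _ (m1 _ _ _) (m2 _ _ _) (m2 _ _ _).
have := no _ _ _ (m1 _ _ _) (m2 _ _ _) (m3 _ _ _).
have := no _ _ _ (m2 _ _ _) (m3 _ _ _) (m1 _ _ _).
have := no _ _ _ (m2 _ _ _) (m3 _ _ _) (m2 _ _ _).
have := no _ _ _ (m2 _ _ _) (m3 _ _ _) (m3 _ _ _).
have := no _ _ _ (m1 _ _ _) (m3 _ _ _) (m1 _ _ _).
have := no _ _ _ (m1 _ _ _) (m3 _ _ _) (m3 _ _ _).
move: x12 x23 y12 y23 span tw; clear; lia.
Qed.
(** The same around the cycle, with the count started at a neighbour of the first vertex. A position
    [0] of the second may stand for the end of the last gap. *)
Lemma triple_ring (x2 x3 y1 y2 y3 : nat) : 0 < x2 -> x2 < x3 -> y1 < y2 -> y2 < y3 ->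
  (forall X X' Y, X \in [:: 0; x2; x3] -> X' \in [:: 0; x2; x3] -> Y \in [:: y1; y2; y3] ->
     X < Y -> Y < X' -> (X <= y1) && (y3 <= X')) ->
  ~~ [&& y1 == 0, y2 == x2 & y3 == x3] ->
  [|| y3 <= x2, (x2 <= y1) && (y3 <= x3) | (x3 <= y2) && ((y1 == 0) || (x3 <= y1))].
Proof.
move=> x12 x23 y12 y23 no tw.
have m1 (a b d : nat) : a \in [:: a; b; d] by rewrite !inE eqxx.
have m2 (a b d : nat) : b \in [:: a; b; d] by rewrite !inE eqxx orbT.
have m3 (a b d : nat) : d \in [:: a; b; d] by rewrite !inE eqxx !orbT.
have := no _ _ _ (m1 _ _ _) (m2 _ _ _) (m1 _ _ _).
have := no _ _ _ (m1 _ _ _) (m2 _ _ _) (m2 _ _ _).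
have := no _ _ _ (m1 _ _ _) (m2 _ _ _) (m3 _ _ _).
have := no _ _ _ (m2 _ _ _) (m3 _ _ _) (m1 _ _ _).
have := no _ _ _ (m2 _ _ _) (m3 _ _ _) (m2 _ _ _).
have := no _ _ _ (m2 _ _ _) (m3 _ _ _) (m3 _ _ _).
have := no _ _ _ (m1 _ _ _) (m3 _ _ _) (m1 _ _ _).
have := no _ _ _ (m1 _ _ _) (m3 _ _ _) (m2 _ _ _).
move: x12 x23 y12 y23 tw; clear; lia.
Qed.

Section Discharging.
Variables (T : finType) (e : rel T) (rho : T -> T -> T).
Hypothesis G : plane_graph e rho.
Local Notation nbrs x := [set y | e x y].
Hypothesis deg3 : forall x, 2 < #|nbrs x|.
Variables (s : seq T) (f : T -> T -> bool).
Hypotheses (oi_s : oi3 e s) (fs : is_bd e rho f s).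
Hypothesis max_s : forall s', oi3 e s' -> size s' <= size s.
Implicit Types (p : int -> T) (i j k l a b : int) (v x y : T) (q : bool).
Let esym := pg_sym G.
Let eirr := pg_irr G.
Local Notation c := (size s).

Definition window p a := mkseq (fun j : nat => p (a + j%:Z)%R) c.

(* [p] runs periodically around the cycle; the definition is invariant under [flip]. *)
Definition enum p : Prop := (forall i, p (i + c%:Z)%R = p i) /\
  forall a, [/\ is_graph_cycle e (window p a), is_bd e rho f (window p a) & window p a =i s].

Definition flip b p i := p (b - i)%R.

Lemma window_flip b p a : window (flip b p) a = rev (window p (b - a - c%:Z + 1)%R).
Proof.
apply: (@eq_from_nth _ (p a)); first by rewrite size_rev !size_mkseq.
move=> j; rewrite size_mkseq => jc; rewrite nth_rev ?size_mkseq // !nth_mkseq //.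
  by rewrite /flip; congr p; move: jc; clear; lia.
by move: jc; clear; lia.
Qed.

Lemma enum_flip b p : enum p -> enum (flip b p).
Proof.
move=> [per win]; split=> [i|a].
  by rewrite /flip -(per (b - (i + c%:Z))%R); congr p; clear; lia.
rewrite window_flip; have [cy bX X_s] := win (b - a - c%:Z + 1)%R; split.
- exact: (is_graph_cycle_rev G).
- by case: bX => ff fE; split=> // x y exy; rewrite cpar_rev fE.
- by move=> x; rewrite mem_rev X_s.
Qed.

Lemma enum_exists : exists p, enum p.
Proof.
have [/and3P[c2 us cy] _] := oi_s.
have [x0 _] : exists x0, x0 \in s by case: (s) c2 => // x0 s' _; exists x0; rewrite mem_head.
pose p i := nth x0 s `|(i %% Posz c)%Z|%N.
have c0 : (c%:Z != 0)%R by move: c2; clear; lia.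
exists p; split=> [i|a]; first by rewrite /p modzDr.
have [r rc Er] : exists2 r : nat, r < c & (a %% Posz c)%Z = Posz r.
  have := modz_ge0 a c0; have := ltz_mod a c0; case: (a %% Posz c)%Z => // r rc _.
  by exists r => //; move: rc; clear; lia.
have -> : window p a = rot r s.
  apply: (@eq_from_nth _ x0); first by rewrite size_rot size_mkseq.
  move=> j; rewrite size_mkseq => jc; rewrite nth_mkseq // /p -modzDml Er /rot nth_cat size_drop nth_drop.
  case: ltnP => jr.
    rewrite -PoszD modz_nat absz_nat modn_small //.
    by move: jr rc; clear; lia.
  rewrite nth_take; last by move: jr rc jc; clear; lia.
  rewrite -PoszD modz_nat absz_nat; congr nth.
  have -> : r + j = (j - (c - r)) + c by move: jr rc; clear; lia.
  by rewrite modnDr modn_small //; move: jc; clear; lia.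
split; first by apply: is_graph_cycle_rot; apply/and3P.
- exact: is_bd_rot.
- by move=> x; rewrite mem_rot.
Qed.

Definition ch q : rel T := inside e (fun x y => f x y == q).
(* The side of a vertex off the cycle, on which [f] is constant. *)
Definition sd v := [exists y, e v y && f v y].

Lemma ch_sym q : symmetric (ch q).
Proof. by move=> x y; rewrite /ch /inside /= esym orbC. Qed.

Lemma ch_edge q x y : ch q x y -> e x y.
Proof. by case/andP. Qed.

Lemma ch_any x y : e x y -> ch true x y || ch false x y.
Proof. by move=> exy; rewrite /ch /inside /= exy; case: (f x y); rewrite ?orbT. Qed.

Lemma out_ch v y : v \notin s -> e v y -> ch (sd v) v y.
Proof.
move=> vs evy; rewrite /ch /inside /= evy; apply/orP; left; apply/eqP.
have [ff fE] := fs; have const := face_fun_at esym (pg_rot G) ff.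
have nbd x : e v x -> ~~ bd f v x by move=> evx; rewrite fE //; apply: contra vs => /cpar_mem/andP[].
apply/idP/existsP => [fvy|[z /andP[evz fvz]]]; first by exists y; rewrite evy.
by rewrite -(const v nbd z).
Qed.

Definition att q x := [exists v, [&& v \notin s, sd v == q & e v x]].

(* [minor p q i n]: the segment from [p i] to [p (i + n)] is cut off on side [q] by a vertex off
   the cycle, and no vertex strictly inside has a neighbour off the cycle on side [q]. *)
Definition minor p q i n := [&& n < c,
  [exists v, [&& v \notin s, sd v == q, e v (p i) & e v (p (i + n%:Z)%R)]]
  & [forall j : 'I_n, (0 < j) ==> ~~ att q (p (i + (j : nat)%:Z)%R)]].

(** Edge [i] joins [p i] to [p (i + 1)]. It lies in a minor 2-segment that starts at [i] or [i - 1],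
    and is the middle of a minor 3-segment that starts at [i - 1]. *)
Definition two p q i := minor p q i 2 || minor p q (i - 1)%R 2.
Definition three p q i := minor p q (i - 1)%R 3.
(** What side [q] demands of the other side on edge [i]; [weight] caps it at the two units available
    there. *)
Definition ask p q i : nat :=
  two p q i + (if three p q i then two p (~~ q) (i - 1)%R + two p (~~ q) (i + 1)%R else 0).

(* Every edge owns four units of charge, two on each side. The edges of a minor 2-segment ask
   their other side for one unit; the middle edge of a minor 3-segment recovers from its other
   side what the two outer edges lost. *)
Definition weight p q i : nat := 2 + minn 2 (ask p q i) - minn 2 (ask p (~~ q) i).

Lemma weight_sides p i : weight p true i + weight p false i = 4.
Proof.
rewrite /weight /=; have := geq_minl 2 (ask p true i); have := geq_minl 2 (ask p false i).
by move: (minn _ _) (minn _ _); clear; lia.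
Qed.

Lemma minorP p q i n : reflect [/\ n < c,
    exists v, [/\ v \notin s, sd v = q, e v (p i) & e v (p (i + n%:Z)%R)]
  & forall j, (i < j < i + n%:Z)%R -> ~~ att q (p j)] (minor p q i n).
Proof.
apply: (iffP and3P) => -[nc].
  case/existsP=> v /and4P[vs /eqP sv ei en] /forallP no; split=> //; first by exists v.
  move=> j ij; have jn : `|(j - i)%R|%N < n by move: ij; clear; lia.
  have /implyP := no (Ordinal jn); rewrite /= (_ : (i + _)%R = j).
    by apply; move: ij; clear; lia.
  by move: ij; clear; lia.
move=> [v [vs sv ei en]] no; split=> //.
  by apply/existsP; exists v; rewrite vs sv eqxx ei.
apply/forallP => -[j jn] /=; apply/implyP => j0; apply: no.
by move: j0 jn; clear; lia.
Qed.

Let minor_mirror p p' b q i j n : (forall a, p' a = p (b - a)%R) -> j = (b - i - n%:Z)%R ->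
  minor p q i n -> minor p' q j n.
Proof.
move=> p'E jE /minorP[nc [v [vs sv ei en]] no]; apply/minorP; split=> //.
  exists v; rewrite !p'E; split=> //; last by rewrite (_ : (b - _)%R = i) //; rewrite jE; clear; lia.
  by rewrite (_ : (b - _)%R = (i + n%:Z)%R) //; rewrite jE; clear; lia.
by move=> a ja; rewrite p'E; apply: no; move: jE ja; clear; lia.
Qed.

Lemma minor_flip b p q i n : minor (flip b p) q i n = minor p q (b - i - n%:Z)%R n.
Proof.
apply/idP/idP.
  by apply: (@minor_mirror (flip b p) p b) => // a; rewrite /flip; congr p; clear; lia.
by apply: (@minor_mirror p (flip b p) b) => //; clear; lia.
Qed.

Lemma two_flip b p q i : two (flip b p) q i = two p q (b - 1 - i)%R.
Proof.
rewrite /two !minor_flip orbC; congr (minor _ _ _ _ || minor _ _ _ _); clear; lia.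
Qed.

Lemma three_flip b p q i : three (flip b p) q i = three p q (b - 1 - i)%R.
Proof. by rewrite /three minor_flip; congr minor; clear; lia. Qed.

Lemma ask_flip b p q i : ask (flip b p) q i = ask p q (b - 1 - i)%R.
Proof.
rewrite /ask !two_flip three_flip addnC [in RHS]addnC; congr (_ + _); case: ifP => // _.
by rewrite addnC; congr (nat_of_bool (two _ _ _) + nat_of_bool (two _ _ _)); clear; lia.
Qed.

Lemma weight_flip b p q i : weight (flip b p) q i = weight p q (b - 1 - i)%R.
Proof. by rewrite /weight !ask_flip. Qed.

(** * Crossings and detours along the cycle *)

Section Enum.
Variable p : int -> T.
Hypothesis en : enum p.

Lemma p_per i : p (i + c%:Z)%R = p i. Proof. by have [] := en. Qed.

Let c2 : 2 < c. Proof. by case: oi_s => /and3P[]. Qed.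

Lemma p_cov x a : x \in s -> exists j, (a <= j < a + c%:Z)%R /\ x = p j.
Proof.
have [_ /(_ a)[_ _ X_s]] := en; rewrite -X_s; case/mapP=> j; rewrite mem_iota => /andP[_ jc] ->.
by exists (a + j%:Z)%R; split=> //; move: jc; clear; lia.
Qed.

Lemma p_window a j : (a <= j < a + c%:Z)%R -> exists2 n : nat, n < c & j = (a + n%:Z)%R.
Proof. by move=> aj; exists `|(j - a)%R|%N; move: aj; clear; lia. Qed.

Lemma p_index a (n : nat) : n < c -> index (p (a + n%:Z)%R) (window p a) = n.
Proof.
move=> nc; have [_ /(_ a)[/and3P[_ uw _] _ _]] := en.
have E : nth (p a) (window p a) n = p (a + n%:Z)%R by rewrite nth_mkseq.
by rewrite -{1}E index_uniq ?size_mkseq.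
Qed.

Lemma p_on i : p i \in s.
Proof.
have [_ /(_ i)[_ _ X_s]] := en; rewrite -X_s; apply/mapP; exists 0; last by rewrite addr0.
by rewrite mem_iota; move: c2; clear; lia.
Qed.

Lemma p_inj i j : (i < j < i + c%:Z)%R -> p i != p j.
Proof.
move=> ij; have [|n nc Ej] := @p_window i j; first by move: ij; clear; lia.
apply/eqP => E; have := p_index i nc; rewrite -Ej -E -{1}(addr0 i) p_index.
  by move: ij Ej; clear; lia.
by move: c2; clear; lia.
Qed.

Lemma p_adj i j : j = (i + 1)%R -> e (p i) (p j).
Proof.
move=> ->; have [_ /(_ i)[/and3P[_ _ cw] _ _]] := en.
have : 2 < size (window p i) by rewrite size_mkseq.
have E : nth (p i) (window p i) 0 = p i by rewrite nth_mkseq ?addr0 //; move: c2; clear; lia.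
have E1 : nth (p i) (window p i) 1 = p (i + 1)%R by rewrite nth_mkseq //; move: c2; clear; lia.
by move: cw E E1; case: (window p i) => [|x [|y w]] //= /andP[exy _] <- <-.
Qed.

Lemma cross q i j k l P Q : (i < j)%R -> (j < k)%R -> (k < l)%R -> (l < i + c%:Z)%R ->
  path (ch q) (p i) P -> last (p i) P = p k -> path (ch q) (p j) Q -> last (p j) Q = p l ->
  (forall z, z \in p i :: P -> z \notin p j :: Q) -> False.
Proof.
move=> ij jk kl li; have [_ /(_ i)[cyw [ff fE] _]] := en.
(* The side [q] as a set of faces is [f] or its complement. *)
have bw : is_bd e rho (fun x y => f x y == q) (window p i).
  split=> [x y exy|x y exy]; first by rewrite ff.
  by rewrite -(fE x y exy) /bd; case: (f x y); case: (f y x); case: (q).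
have idx t : (i <= t)%R -> (t <= l)%R -> index (p t) (window p i) = `|(t - i)%R|%N.
  move=> it tl; have [|n nc ->] := @p_window i t; first by move: it tl li; clear; lia.
  by rewrite p_index //; clear; lia.
apply: (noncross G cyw bw).
- by rewrite -index_mem idx ?size_mkseq; move: ij jk kl li; clear; lia.
- by rewrite !idx; move: ij jk kl li; clear; lia.
- by rewrite !idx; move: ij jk kl li; clear; lia.
- by rewrite !idx; move: ij jk kl li; clear; lia.
Qed.

Lemma cross_out v v' i j k l : v \notin s -> v' \notin s -> v != v' -> sd v = sd v' ->
  e v (p i) -> e v (p k) -> e v' (p j) -> e v' (p l) ->
  (i < j)%R -> (j < k)%R -> (k < l)%R -> (l < i + c%:Z)%R -> False.
Proof.
move=> vs vs' vv' sv ei ek ej el ij jk kl li.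
apply: (@cross (sd v) i j k l [:: v; p k] [:: v'; p l]) => //=.
- by rewrite ch_sym !out_ch.
- by rewrite sv ch_sym !out_ch.
have h a b : (a < b)%R -> (b < a + c%:Z)%R -> p a != p b by move=> ab ba; rewrite p_inj ?ab.
have ne a w : w \notin s -> (p a == w) = false.
  by move=> ws; apply/eqP => E; rewrite -E p_on in ws.
move=> z; rewrite !inE => /or3P[]/eqP->; rewrite !negb_or ?[v == p _]eq_sym ?(ne _ v vs) ?(ne _ v' vs') //=.
- by rewrite !h //; move: ij jk kl li; clear; lia.
- by rewrite andbT.
- by rewrite ?andbT [p k == _]eq_sym !h //; move: ij jk kl li; clear; lia.
Qed.

Lemma cross_out_chord v i j k l : v \notin s -> e v (p i) -> e v (p k) -> ch (sd v) (p j) (p l) ->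
  (i < j)%R -> (j < k)%R -> (k < l)%R -> (l < i + c%:Z)%R -> False.
Proof.
move=> vs ei ek ejl ij jk kl li.
apply: (@cross (sd v) i j k l [:: v; p k] [:: p l]) => //=.
- by rewrite ch_sym !out_ch.
- by rewrite ejl.
have h a b : (a < b)%R -> (b < a + c%:Z)%R -> p a != p b by move=> ab ba; rewrite p_inj ?ab.
have ne a w : w \notin s -> (w == p a) = false.
  by move=> ws; apply/eqP => E; rewrite E p_on in ws.
move=> z; rewrite !inE => /or3P[]/eqP->; rewrite !negb_or ?(ne _ v vs) //=.
- by rewrite !h //; move: ij jk kl li; clear; lia.
- by rewrite ?andbT [p k == _]eq_sym !h //; move: ij jk kl li; clear; lia.
Qed.

Lemma cross_chords q i j k l : ch q (p i) (p k) -> ch q (p j) (p l) ->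
  (i < j)%R -> (j < k)%R -> (k < l)%R -> (l < i + c%:Z)%R -> False.
Proof.
move=> eik ejl ij jk kl li.
apply: (@cross q i j k l [:: p k] [:: p l]) => //=; rewrite ?eik ?ejl //.
have h a b : (a < b)%R -> (b < a + c%:Z)%R -> p a != p b by move=> ab ba; rewrite p_inj ?ab.
move=> z; rewrite !inE => /orP[]/eqP->; rewrite !negb_or.
- by rewrite !h //; move: ij jk kl li; clear; lia.
- by rewrite ?andbT [p k == _]eq_sym !h //; move: ij jk kl li; clear; lia.
Qed.

(* Vertices strictly inside the segment [i, j] which the detour [m] misses must still be allowed
   outside an [oi3] cycle. *)
Lemma exchange i j (m : seq T) : (i < j)%R -> (j < i + c%:Z)%R ->
  path e (p i) (rcons m (p j)) -> uniq m -> (j <= i + (size m)%:Z)%R ->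
  (forall x, x \in m -> x \notin s \/ exists2 t, (i < t < j)%R & x = p t) ->
  (forall t, (i < t < j)%R -> p t \notin m -> #|nbrs (p t)| = 3 /\ forall y, e (p t) y ->
     y \in s /\ forall t', (i < t' < j)%R -> y = p t' -> y \in m) -> False.
Proof.
move=> ij ji pm um szm mE drop.
(* The arc kept, from [p j] around to [p i], has [n + 1] vertices. *)
have [n En] : exists n : nat, Posz c = (j - i + n%:Z)%R by exists `|(Posz c - (j - i))%R|%N; move: ij ji; clear; lia.
have [_ /(_ j)[/and3P[_ uw cw] _ _]] := en.
have nc : n.+1 <= size (window p j) by rewrite size_mkseq; move: ij En; clear; lia.
pose A := take n.+1 (window p j).
have sA : size A = n.+1 by rewrite size_takel.
have AE x : reflect (exists2 r : nat, r <= n & x = p (j + r%:Z)%R) (x \in A).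
  apply: (iffP idP) => [xA|[r rn ->]].
    have ix : index x A < n.+1 by rewrite -sA index_mem.
    have ic : index x A < c by apply: leq_trans ix _; move: nc; rewrite size_mkseq.
    exists (index x A) => //; have := nth_index (p j) xA.
    by rewrite {1}/A nth_take // nth_mkseq.
  have -> : p (j + r%:Z)%R = nth (p j) A r.
    by rewrite nth_take // nth_mkseq //; apply: leq_ltn_trans rn _; move: nc; rewrite size_mkseq.
  by rewrite mem_nth ?sA.
have Am x : x \in A -> x \notin m.
  move=> /AE[r rn ->]; apply/negP => /mE[|[t it E]]; first by rewrite p_on.
  by have := @p_inj t (j + r%:Z)%R; rewrite E eqxx; move: it En rn; clear; lia.
pose C' := A ++ m.
have memC y : y \in s -> y \notin C' -> exists2 t, (i < t < j)%R & y = p t /\ p t \notin m.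
  move=> ys; rewrite mem_cat negb_or => /andP[yA ym].
  have [t [it E]] := p_cov (i + 1)%R ys; rewrite E in yA ym; exists t => //.
  have [jt|tj] := lerP j t; last by move: it tj; clear; lia.
  case/negP: yA; apply/AE; exists `|(t - j)%R|%N; first by move: it jt En; clear; lia.
  by congr p; move: jt; clear; lia.
have oiC : oi3 e C'.
  split.
    apply/and3P; split.
    - rewrite size_cat sA; move: En szm ij c2; clear; lia.
    - rewrite cat_uniq take_uniq // um andbT; apply/hasPn => x xm.
      by apply/negP => /Am; rewrite xm.
    have EW : window p j = p j :: behead (window p j).
      by rewrite /window; case: (c) c2 => // c' _; rewrite /mkseq /= addr0.
    have EA : A = p j :: behead A by rewrite /A EW.
    have lA : last (p j) (behead A) = p i.
      have -> : last (p j) (behead A) = nth (p j) A (size A).-1 by rewrite nth_last EA.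
      rewrite sA.
      rewrite nth_take // nth_mkseq; last by move: nc; rewrite size_mkseq.
      by rewrite -(p_per i); congr p; move: En; clear; lia.
    have pA : path e (p j) (behead A).
      by rewrite /A EW /=; apply: take_path; move: cw; rewrite EW /= rcons_path => /andP[].
    by rewrite /C' EA /= rcons_cat cat_path pA lA.
  move=> x xC; have [xs|xs] := boolP (x \in s).
    have [t it [E tm]] := memC x xs xC; have [d3 dr] := drop t it tm.
    rewrite E; split=> // y /dr[ys yw]; have [//|yC] := boolP (y \in C').
    have [t' it' [E' ym]] := memC y ys yC.
    by case/negP: ym; rewrite -E'; apply: yw E'.
  have [d3 ns] := oi_s.2 x xs; split=> // y exy; have ys := ns y exy.
  have [//|yC] := boolP (y \in C'); have [t it [E tm]] := memC y ys yC.
  by have [_ /(_ x)] := drop t it tm; rewrite -E esym exy => /(_ isT)[]; rewrite (negbTE xs).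
(* The detour has at least [j - i] vertices and replaces only [j - i - 1]. *)
have := max_s oiC; rewrite size_cat sA leqNgt => /negP; apply.
by move: En szm ij; clear; lia.
Qed.

Lemma out_not_adjacent v i j : j = (i + 1)%R -> v \notin s -> e v (p i) -> e v (p j) -> False.
Proof.
move=> -> vs ei ej; apply: (@exchange i (i + 1)%R [:: v]).
- by clear; lia.
- by move: c2; clear; lia.
- by rewrite /= esym ei ej.
- by [].
- by rewrite /=; clear; lia.
- by move=> x; rewrite inE => /eqP->; left.
- by move=> t it; exfalso; move: it; clear; lia.
Qed.

Lemma minor_att q i n : minor p q i n -> att q (p i) /\ att q (p (i + n%:Z)%R).
Proof.
by case/minorP=> _ [v [vs sv vi vn]] _; split; apply/existsP; exists v; rewrite vs sv eqxx.
Qed.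

Lemma minor_inner q i n j : minor p q i n -> att q (p j) -> (i < j < i + n%:Z)%R -> False.
Proof. by case/minorP=> _ _ no aj ij; case/negP: (no j ij). Qed.

Hypothesis c6 : 5 < c.

Let ne i j : [&& i != j, (i < j + 6%:Z)%R & (j < i + 6%:Z)%R] -> (p i == p j) = false.
Proof.
move=> /and3P[ij lt_ij lt_ji]; have [lt|gt|E] := ltgtP i j; last by rewrite E eqxx in ij.
  by apply/negbTE/p_inj; move: c6 lt lt_ji; clear; lia.
by rewrite eq_sym; apply/negbTE/p_inj; move: c6 gt lt_ij; clear; lia.
Qed.
Let neO v i : v \notin s -> (v == p i) = false.
Proof. by move=> vs; apply/eqP => E; rewrite E p_on in vs. Qed.
Let neO' v i : v \notin s -> (p i == v) = false.
Proof. by rewrite eq_sym; apply: neO. Qed.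

Let adj i j : j = (i + 1)%R \/ i = (j + 1)%R -> e (p i) (p j).
Proof. by case=> [/p_adj//|/p_adj]; rewrite esym. Qed.

(** Detour: [i], [v], [i + 2], [i + 1], [v'], [i + 3]. *)
Lemma minor2_minor2 q q' i j : j = (i + 1)%R -> q != q' -> minor p q i 2 -> minor p q' j 2 -> False.
Proof.
move=> -> qq /minorP[_ [v [vs sv v0 v2]] _] /minorP[_ [v' [vs' sv' v1 v3]] _].
apply: (@exchange i (i + 3%:Z)%R [:: v; p (i + 2%:Z)%R; p (i + 1)%R; v']).
- by clear; lia.
- by move: c6; clear; lia.
- rewrite /= [e (p i) v]esym v0 v2 adj; last by right; clear; lia.
  by rewrite esym v1 /= (_ : (i + 3%:Z)%R = (i + 1 + 2%:Z)%R) ?v3 //; clear; lia.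
- have vv : v != v' by apply: contraNneq qq => E; rewrite -sv -sv' E.
  by rewrite /= !inE !(neO _ vs) !(neO' _ vs') (negbTE vv) ne //; clear; lia.
- by rewrite /=; clear; lia.
- move=> x; rewrite !inE => /or4P[]/eqP->; [by left | right | right | by left].
    by exists (i + 2%:Z)%R => //; clear; lia.
  by exists (i + 1)%R => //; clear; lia.
move=> t it /negP[]; have [->|->] : t = (i + 1)%R \/ t = (i + 2%:Z)%R by move: it; clear; lia.
  by rewrite !inE eqxx ?orbT.
by rewrite !inE eqxx ?orbT.
Qed.

(** Detour: [i], [v], [i + 2], [i + 1], [i + 3]. *)
Lemma minor2_chord q i j l : minor p q i 2 -> j = (i + 1)%R -> l = (i + 3%:Z)%R -> ~~ e (p j) (p l).
Proof.
move=> /minorP[_ [v [vs sv v0 v2]] _] -> ->; apply/negP => ch13.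
apply: (@exchange i (i + 3%:Z)%R [:: v; p (i + 2%:Z)%R; p (i + 1)%R]).
- by clear; lia.
- by move: c6; clear; lia.
- by rewrite /= [e (p i) v]esym v0 v2 ch13 adj //; right; clear; lia.
- by rewrite /= !inE !(neO _ vs) ?ne //; clear; lia.
- by rewrite /=; clear; lia.
- move=> x; rewrite !inE => /or3P[]/eqP->; [by left | right | right].
    by exists (i + 2%:Z)%R => //; clear; lia.
  by exists (i + 1)%R => //; clear; lia.
move=> t it /negP[]; have [->|->] : t = (i + 1)%R \/ t = (i + 2%:Z)%R by move: it; clear; lia.
  by rewrite !inE eqxx ?orbT.
by rewrite !inE eqxx ?orbT.
Qed.

(** Detour: [i - 1], [i + 1], [i], [v], [i + 2]. *)
Lemma minor2_chord_left q i j l : minor p q i 2 -> j = (i + 1)%R -> l = (i - 1)%R -> ~~ e (p j) (p l).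
Proof.
move=> /minorP[_ [v [vs sv v0 v2]] _] -> ->; apply/negP => ch; rewrite esym in ch.
apply: (@exchange (i - 1)%R (i + 2%:Z)%R [:: p (i + 1)%R; p i; v]).
- by clear; lia.
- by move: c6; clear; lia.
- by rewrite /= [e (p i) v]esym v0 v2 ch adj //; right; clear; lia.
- by rewrite /= !inE !(neO' _ vs) ?ne //; clear; lia.
- by rewrite /=; clear; lia.
- move=> x; rewrite !inE => /or3P[]/eqP->; [right | right | by left].
    by exists (i + 1)%R => //; clear; lia.
  by exists i => //; clear; lia.
move=> t it /negP[]; have [->|->] : t = (i + 1)%R \/ t = i by move: it; clear; lia.
  by rewrite !inE eqxx ?orbT.
by rewrite !inE eqxx ?orbT.
Qed.

(** Detour: [i], [v], [i + 3], [i + 2], [v'], [i + 4]. It drops [p (i + 1)], which is allowed off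
    the cycle as it is cubic and has all its neighbours on the new cycle. *)
Lemma minor3_minor2 q q' i j : q != q' -> minor p q i 3 -> j = (i + 2%:Z)%R -> minor p q' j 2 ->
  #|nbrs (p (i + 1)%R)| = 3 -> (forall y, e (p (i + 1)%R) y -> y \in s) -> False.
Proof.
move=> qq /minorP[_ [v [vs sv v0 v3]] _] -> /minorP[_ [v' [vs' sv' v2 v4]] _] d3 on_s.
apply: (@exchange i (i + 4%:Z)%R [:: v; p (i + 3%:Z)%R; p (i + 2%:Z)%R; v']).
- by clear; lia.
- by move: c6; clear; lia.
- rewrite /= [e (p i) v]esym v0 v3 adj; last by right; clear; lia.
  by rewrite esym v2 /= (_ : (i + 4%:Z)%R = (i + 2%:Z + 2%:Z)%R) ?v4 //; clear; lia.
- have vv : v != v' by apply: contraNneq qq => E; rewrite -sv -sv' E.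
  by rewrite /= !inE !(neO _ vs) !(neO' _ vs') (negbTE vv) ne //; clear; lia.
- by rewrite /=; clear; lia.
- move=> x; rewrite !inE => /or4P[]/eqP->; [by left | right | right | by left].
    by exists (i + 3%:Z)%R => //; clear; lia.
  by exists (i + 2%:Z)%R => //; clear; lia.
have cases t : (i < t < i + 4%:Z)%R -> t = (i + 1)%R \/
    p t \in [:: v; p (i + 3%:Z)%R; p (i + 2%:Z)%R; v'].
  move=> it; have [->|[->|->]] : t = (i + 1)%R \/ t = (i + 2%:Z)%R \/ t = (i + 3%:Z)%R.
  - by move: it; clear; lia.
  - by left.
  - by right; rewrite !inE eqxx ?orbT.
  - by right; rewrite !inE eqxx ?orbT.
move=> t /cases[->|->//] _; split=> // y ey; split; first exact: on_s.
by move=> t' /cases[E y'|] => [|? ->//]; rewrite y' E eirr in ey.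
Qed.

(** Detour: [i], [v], [i + 2], [i + 1], [i + 4], [i + 3], [v'], [i + 5]. *)
Lemma minor2_chord_minor2 q i j l : minor p q i 2 -> minor p q j 2 -> j = (i + 3%:Z)%R ->
  l = (i + 4%:Z)%R -> e (p (i + 1)%R) (p l) -> False.
Proof.
move=> /minorP[_ [v [vs sv v0 v2]] _] /minorP[_ [v' [vs' sv' v3 v5]] _] Ej El ch.
rewrite Ej in v3 v5; rewrite El in ch.
apply: (@exchange i (i + 5%:Z)%R [:: v; p (i + 2%:Z)%R; p (i + 1)%R; p (i + 4%:Z)%R;
  p (i + 3%:Z)%R; v']).
- by clear; lia.
- by move: c6; clear; lia.
- rewrite /= [e (p i) v]esym v0 v2 ch !adj; try by right; clear; lia.
  by rewrite esym v3 /= (_ : (i + 5%:Z)%R = (i + 3%:Z + 2%:Z)%R) ?v5 //; clear; lia.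
- have vv : v != v'.
    apply/eqP => E; rewrite -E in v3; apply: (@out_not_adjacent v _ _ _ vs v2 v3).
    by clear; lia.
  by rewrite /= !inE !(neO _ vs) !(neO' _ vs') (negbTE vv) ?ne //; clear; lia.
- by rewrite /=; clear; lia.
- move=> x; rewrite !inE => /predU1P[->|/predU1P[->|/predU1P[->|/predU1P[->|/orP[]/eqP->]]]];
    [by left | right | right | right | right | by left].
  + by exists (i + 2%:Z)%R => //; clear; lia.
  + by exists (i + 1)%R => //; clear; lia.
  + by exists (i + 4%:Z)%R => //; clear; lia.
  + by exists (i + 3%:Z)%R => //; clear; lia.
move=> t it /negP[]; have [->|[->|[->|->]]] :
  t = (i + 1)%R \/ t = (i + 2%:Z)%R \/ t = (i + 3%:Z)%R \/ t = (i + 4%:Z)%R by move: it; clear; lia.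
all: by rewrite !inE eqxx ?orbT.
Qed.

(** A chord that left the segment on side [q] would cross the outer vertex that cuts it off. *)
Lemma minor_chord q i n j y : minor p q i n -> (i < j < i + n%:Z)%R -> y \in s ->
  ch q (p j) y -> exists2 l, (i <= l <= i + n%:Z)%R & y = p l.
Proof.
move=> /minorP[nc [v [vs sv vi vn]] _] ij ys cy; have [l [il E]] := p_cov i ys.
exists l => //; apply/andP; split; first by case/andP: il.
rewrite leNgt; apply/negP => nl; rewrite E -sv in cy.
by apply: (@cross_out_chord v i j (i + n%:Z)%R l vs vi vn cy); move: ij il nl; clear; lia.
Qed.

Lemma minor_inner_nbr q i n i' n' j y : minor p q i n -> minor p (~~ q) i' n' ->
  (i < j < i + n%:Z)%R -> (i' < j < i' + n'%:Z)%R -> e (p j) y ->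
  exists2 l, y = p l & (i <= l <= i + n%:Z)%R /\ ch q (p j) (p l) \/
    (i' <= l <= i' + n'%:Z)%R /\ ch (~~ q) (p j) (p l).
Proof.
move=> m m' ij ij' ejy; have ys : y \in s.
  apply/negPn/negP => ys; have aq : att (sd y) (p j).
    by apply/existsP; exists y; rewrite ys eqxx esym.
  have [E|E] := eqVneq (sd y) q; first by apply: (minor_inner m _ ij); rewrite -E.
  apply: (minor_inner m' _ ij'); suff <- : sd y = ~~ q by [].
  by move: E; case: (sd y); case: (q).
have : ch q (p j) y || ch (~~ q) (p j) y.
  by have := ch_any ejy; case: (q) => //=; rewrite orbC.
case/orP=> cy.
  by have [l il E] := minor_chord m ij ys cy; exists l => //; left; rewrite -E.
by have [l il E] := minor_chord m' ij' ys cy; exists l => //; right; rewrite -E.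
Qed.

(** Inside minor segments of both sides there is no outer neighbour, and the degree of at least
    three forces a chord. *)
Lemma minor_inner_chord q i n i' n' j : minor p q i n -> minor p (~~ q) i' n' ->
  (i < j < i + n%:Z)%R -> (i' < j < i' + n'%:Z)%R ->
  exists l, [/\ l <> j, l <> (j - 1)%R, l <> (j + 1)%R &
    (i <= l <= i + n%:Z)%R /\ ch q (p j) (p l) \/
    (i' <= l <= i' + n'%:Z)%R /\ ch (~~ q) (p j) (p l)].
Proof.
move=> m m' ij ij'.
have [y] : exists y, y \in nbrs (p j) :\ p (j - 1)%R :\ p (j + 1)%R.
  apply/set0Pn; rewrite -card_gt0; have := deg3 (p j).
  rewrite (cardsD1 (p (j - 1)%R)) (cardsD1 (p (j + 1)%R) (_ :\ _)).
  by move: (_ \in _) (_ \in _) #|_| => b1 b2 n0; clear; case: b1; case: b2; lia.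
case/setD1P=> y1 /setD1P[y0]; rewrite in_set => ejy.
have [l E dl] := minor_inner_nbr m m' ij ij' ejy; rewrite E in y0 y1 ejy.
exists l; split=> // L; move: y0 y1 ejy; rewrite L ?eqxx //.
by rewrite eirr.
Qed.

End Enum.

(** * What a minor segment can lose *)

Section MinorWeight.
Hypothesis c6 : 5 < c.

Let Nq q : ~~ q != q. Proof. by case: q. Qed.

(** A 2-segment sharing an edge with a longer segment has an end strictly inside it, where nothing
    is attached. *)
Lemma minor_two p q n i : minor p q 0%R n -> 2 < n -> (0 <= i < n%:Z)%R -> two p q i = false.
Proof.
move=> m n2 i0; apply/negP => /orP[]/minor_att[a1 a2].
  have out j : att q (p j) -> (0 < j < 0 + n%:Z)%R -> False by apply: minor_inner m.
  by have := out _ a1; have := out _ a2; move: n2 i0; clear; lia.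
have out j : att q (p j) -> (0 < j < 0 + n%:Z)%R -> False by apply: minor_inner m.
by have := out _ a1; have := out _ a2; move: n2 i0; clear; lia.
Qed.

(** A demand comes from an overlapping segment of the other side. Either there is a detour through
    both outer vertices, or the middle vertex needs a chord, for which there is no room or which
    yields a detour. *)
Lemma ask_minor2 p q : enum p -> minor p q 0%R 2 -> ask p (~~ q) 0%R = 0.
Proof.
move=> en m; rewrite /ask.
have -> : two p (~~ q) 0%R = false.
  apply/negP => /orP[m'|m'].
    have [//|//|l [l0 l1 l2 dl]] := @minor_inner_chord _ en q 0%R 2 0%R 2 1%R m m'.
    by case: dl => -[]; move: l0 l1 l2; clear; lia.
  by apply: (@minor2_minor2 _ en c6 (~~ q) q (0 - 1)%R 0%R _ (Nq q) m' m); clear; lia.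
have -> // : three p (~~ q) 0%R = false.
apply/negP => m'.
have [//|//|l [l0 l1 l2 dl]] := @minor_inner_chord _ en q 0%R 2 (0 - 1)%R 3 1%R m m'.
have [El cl] : l = (- 1)%R /\ e (p 1%R) (p l).
  by case: dl => -[dl /ch_edge ->]; split=> //; move: l0 l1 l2 dl; clear; lia.
by have := @minor2_chord_left _ en c6 q 0%R 1%R l m erefl El; rewrite cl.
Qed.

(** A demand would put an inner vertex of the segment in the middle of a 2-segment of the other
    side, and its chord yields a detour. *)
Lemma ask_minor3_mid p q : enum p -> minor p q 0%R 3 -> ask p (~~ q) 1%R = 0.
Proof.
move=> en m; rewrite /ask negbK.
rewrite !(minor_two m) //.
rewrite if_same addn0; case E : (two _ _ _) => //; case/orP: E => m'.
  have [//|//|l [l0 l1 l2 dl]] := @minor_inner_chord _ en q 0%R 3 1%R 2 2%:Z%R m m'.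
  have [El cl] : l = 0%R /\ e (p 2%:Z%R) (p l).
    by case: dl => -[dl /ch_edge ->]; split=> //; move: l0 l1 l2 dl; clear; lia.
  by have := @minor2_chord_left _ en c6 (~~ q) 1%R 2%:Z%R l m' erefl El; rewrite cl.
have [//|//|l [l0 l1 l2 dl]] := @minor_inner_chord _ en q 0%R 3 0%R 2 1%R m m'.
have [El cl] : l = 3%:Z%R /\ e (p 1%R) (p l).
  by case: dl => -[dl /ch_edge ->]; split=> //; move: l0 l1 l2 dl; clear; lia.
by have := @minor2_chord _ en c6 (~~ q) 0%R 1%R l m' erefl El; rewrite cl.
Qed.

(** The end edge loses only the unit that is refunded to the middle edge. A further loss needs a
    3-segment of the other side from [1] to [4] and a 2-segment from [3] to [5]; then [p 2] is cubic
    without outer neighbours, and [minor3_minor2] applies. *)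
Lemma ask_minor3_end p q : enum p -> minor p q 0%R 3 -> ask p (~~ q) 2%:Z%R = two p (~~ q) 2%:Z%R.
Proof.
move=> en m; rewrite /ask negbK.
rewrite (@minor_two p q 3 (2%:Z - 1)%R m) // add0n.
case: ifP => [m'|_]; last by rewrite addn0.
suff -> : two p q (2%:Z + 1)%R = false by rewrite addn0.
apply/negP => /orP[m2|m2]; last first.
  by apply: (minor_inner m (minor_att m2).1).
have nb y : e (p 2%:Z%R) y -> y \in [:: p 0%R; p 1%R; p 3%:Z%R].
  move=> ey; have [l E dl] := @minor_inner_nbr _ en q 0%R 3 1%R 3 2%:Z%R y m m' isT isT ey.
  have [l4|l4] := eqVneq l 4%:Z%R.
    have := @minor2_chord_left _ en c6 q 3%:Z%R 4%:Z%R 2%:Z%R m2 erefl erefl.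
    by rewrite esym -l4 -E ey.
  have [l2|l2] := eqVneq l 2%:Z%R; first by rewrite E l2 eirr in ey.
  have [L|[L|L]] : l = 0%R \/ l = 1%R \/ l = 3%:Z%R.
  - by case: dl => -[]; move: l2 l4; clear; lia.
  - by rewrite E L !inE eqxx.
  - by rewrite E L !inE eqxx ?orbT.
  - by rewrite E L !inE eqxx ?orbT.
have ys y : e (p 2%:Z%R) y -> y \in s.
  by move/nb; rewrite !inE => /or3P[]/eqP->; apply: p_on en _.
apply: (@minor3_minor2 _ en c6 (~~ q) q 1%R 3%:Z%R (Nq q) m' erefl m2) => //.
apply/eqP; rewrite eqn_leq deg3 andbT; apply: leq_trans (card_size [:: p 0%R; p 1%R; p 3%:Z%R]).
by apply: subset_leq_card; apply/subsetP => y; rewrite in_set; apply: nb.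
Qed.

(** The middle edge of a 3-segment of the other side is in no 2-segment there, and two refunds at
    once would need a 2-segment of side [q] attached inside the segment. *)
Lemma ask_le1 p q n i : minor p q 0%R n -> 2 < n -> (0 <= i < n%:Z)%R -> ask p (~~ q) i <= 1.
Proof.
move=> m n2 i0; rewrite /ask negbK; case: ifP => [m3|_]; last by case: (two _ _ _).
have out j : att q (p j) -> (0 < j < 0 + n%:Z)%R -> False by apply: minor_inner m.
have out3 j : att (~~ q) (p j) -> (i - 1 < j < i - 1 + 3%:Z)%R -> False by apply: minor_inner m3.
have -> : two p (~~ q) i = false.
  apply/negP => /orP[]/minor_att[a1 a2].
    by apply: (out3 _ a1); clear; lia.
  by apply: (out3 _ a2); clear; lia.
rewrite add0n; case E1 : (two _ _ _); last by case: (two _ _ _).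
case E2 : (two _ _ _) => //; exfalso; case/orP: E1 => /minor_att[a1 a2].
  by have := out _ a1; have := out _ a2; move: n2 i0; clear; lia.
case/orP: E2 => /minor_att[b1 b2].
  by have := out _ a2; have := out _ b1; move: n2 i0; clear; lia.
by have := out _ b1; have := out _ a2; have := out _ b2; move: n2 i0; clear; lia.
Qed.

(** The demand comes from a 2-segment of the other side; every possible chord at its middle vertex
    yields a detour, except the one from [p 1] to [p 4]. *)
Lemma ask_minor4 p q : enum p -> minor p q 0%R 4 -> 0 < ask p (~~ q) 1%R ->
  minor p (~~ q) 0%R 2 /\ ch q (p 1%R) (p 4%:Z%R).
Proof.
move=> en m; rewrite /ask negbK.
rewrite !(minor_two m) //.
rewrite if_same addn0 lt0b => /orP[m'|m'].
  have [//|//|l [l0 l1 l2 dl]] := @minor_inner_chord _ en q 0%R 4 1%R 2 2%:Z%R m m'.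
  have [El cl] : (l = 0%R \/ l = 4%:Z%R) /\ e (p 2%:Z%R) (p l).
    by case: dl => -[dl /ch_edge ->]; split=> //; move: l0 l1 l2 dl; clear; lia.
  case: El => El.
    by have := @minor2_chord_left _ en c6 (~~ q) 1%R 2%:Z%R l m' erefl El; rewrite cl.
  by have := @minor2_chord _ en c6 (~~ q) 1%R 2%:Z%R l m' erefl El; rewrite cl.
split=> //.
have [//|//|l [l0 l1 l2 [] [dl cl]]] := @minor_inner_chord _ en q 0%R 4 0%R 2 1%R m m'.
  have [El|El] : l = 3%:Z%R \/ l = 4%:Z%R by move: l0 l1 l2 dl; clear; lia.
    have := @minor2_chord _ en c6 (~~ q) 0%R 1%R l m' erefl El.
    by rewrite (ch_edge cl).
  by rewrite El in cl.
by move: l0 l1 l2 dl; clear; lia.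
Qed.

(** A loss of the third edge gives the mirrored chord from [p 3] to [p 0], which crosses the chord
    from [p 1] to [p 4]. A loss of the fourth edge leads to a crossing or a detour as well. *)
Lemma ask_minor4_rest p q : enum p -> minor p q 0%R 4 -> 0 < ask p (~~ q) 1%R ->
  ask p (~~ q) 2%:Z%R = 0 /\ ask p (~~ q) 3%:Z%R = 0.
Proof.
move=> en m a1; have [m02 c14] := ask_minor4 en m a1.
have a2 : ask p (~~ q) 2%:Z%R = 0.
  apply/eqP; rewrite -leqn0 leqNgt; apply/negP => a2.
  have mf : minor (flip 4%:Z%R p) q 0%R 4 by rewrite minor_flip.
  have [|_ c30] := ask_minor4 (enum_flip _ en) mf; first by rewrite ask_flip.
  rewrite ch_sym in c30; apply: (cross_chords en c30 c14) => //; by move: c6; clear; lia.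
split=> //.
have t2 : two p (~~ q) 2%:Z%R = false by move: a2; rewrite /ask; case: (two _ _ _).
rewrite /ask negbK (@minor_two p q 4 (3%:Z - 1)%R m) // add0n.
have -> : two p (~~ q) 3%:Z%R = false.
  apply/negP => /orP[m3|m2].
    by apply: (@minor2_chord_minor2 _ en c6 (~~ q) 0%R 3%:Z%R 4%:Z%R m02 m3 erefl erefl (ch_edge c14)).
  by move/negbT/negP: t2; apply; apply/orP; left.
rewrite add0n; case: ifP => // m3; case E : (two _ _ _) => //; exfalso.
case/orP: E => m4; last by apply: (minor_inner m (minor_att m4).1).
have [//|//|l [l0 l1 l2 [] [dl cl]]] := @minor_inner_chord _ en q 0%R 4 2%:Z%R 3 3%:Z%R m m3.
  have [El|El] : l = 0%R \/ l = 1%R by move: l0 l1 l2 dl; clear; lia.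
    by rewrite El ch_sym in cl; apply: (cross_chords en cl c14) => //; move: c6; clear; lia.
  have := @minor2_chord _ en c6 (~~ q) 0%R 1%R 3%:Z%R m02 erefl erefl.
  by rewrite esym -El (ch_edge cl).
have El : l = 5%:Z%R by move: l0 l1 l2 dl; clear; lia.
have := @minor2_chord_left _ en c6 q 4%:Z%R 5%:Z%R 3%:Z%R m4 erefl erefl.
by rewrite esym -El (ch_edge cl).
Qed.

(** Otherwise the other side has 2-segments around [p 2] and [p 4], and the chords at these vertices
    cross or yield a detour. *)
Lemma ask_minor5 p q : enum p -> minor p q 0%R 5 -> minor p (~~ q) 1%R 2 ->
  ask p (~~ q) 3%:Z%R = 0.
Proof.
move=> en m m1; rewrite /ask negbK.
rewrite !(minor_two m) //.
rewrite if_same addn0; case E : (two _ _ _) => //; exfalso.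
case/orP: E => m3; last by apply: (minor_inner m1 (minor_att m3).1).
have [//|//|l [l0 l1 l2 [] [dl cl]]] := @minor_inner_chord _ en q 0%R 5 1%R 2 2%:Z%R m m1; last first.
  by move: l0 l1 l2 dl; clear; lia.
have [El|[El|El]] : l = 0%R \/ l = 4%:Z%R \/ l = 5%:Z%R by move: l0 l1 l2 dl; clear; lia.
- have := @minor2_chord_left _ en c6 (~~ q) 1%R 2%:Z%R l m1 erefl El.
  by rewrite (ch_edge cl).
- have := @minor2_chord _ en c6 (~~ q) 1%R 2%:Z%R l m1 erefl El.
  by rewrite (ch_edge cl).
rewrite {}El {l0 l1 l2 dl} in cl.
have [//|//|l' [l0 l1 l2 [] [dl cl']]] := @minor_inner_chord _ en q 0%R 5 3%:Z%R 2 4%:Z%R m m3; last first.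
  by move: l0 l1 l2 dl; clear; lia.
have [El|[El|El]] : l' = 0%R \/ l' = 1%R \/ l' = 2%:Z%R by move: l0 l1 l2 dl; clear; lia.
- by rewrite El ch_sym in cl'; apply: (cross_chords en cl' cl) => //; move: c6; clear; lia.
- by rewrite El ch_sym in cl'; apply: (cross_chords en cl' cl) => //; move: c6; clear; lia.
have := @minor2_chord_left _ en c6 (~~ q) 3%:Z%R 4%:Z%R l' m3 erefl El.
by rewrite (ch_edge cl').
Qed.

(** Two edges hold four units, gain at least two and lose none. Three edges hold six and are
    refunded what they lose. Four edges hold eight and lose at most two, and five hold ten and lose
    at most four. In a longer segment every edge keeps one unit. *)
Lemma minor_weight0 p q n : enum p -> 0 < n -> minor p q 0%R n ->
  6 <= \sum_(t < n) weight p q (t : nat)%:Z%R.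
Proof.
move=> en n0 m.
have mf b : b = n%:Z%R -> minor (flip b p) q 0%R n by move=> ->; rewrite minor_flip subr0 subrr.
have [n2|[n1|[E|[E|[E|[E|n6]]]]]] : n = 0 \/ n = 1 \/ n = 2 \/ n = 3 \/ n = 4 \/ n = 5 \/ 5 < n.
- by move: n0; clear; lia.
- by rewrite n2 in n0.
- exfalso; move: m; rewrite n1 => /minorP[_ [v [vs _ v0 v1]] _].
  by apply: (out_not_adjacent en _ vs v0 v1); clear; lia.
- rewrite {n n0}E in m mf *.
  have a0 := ask_minor2 en m; have := ask_minor2 (enum_flip 2%:Z%R en) (mf _ erefl).
  rewrite ask_flip (_ : (2%:Z - 1 - 0)%R = 1%R) // => a1.
  have -> : \sum_(t < 2) weight p q (t : nat)%:Z%R = weight p q 0%R + weight p q 1%R.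
    by rewrite !big_ord_recr big_ord0.
  have b0 : 0 < ask p q 0%R by rewrite /ask /two m.
  have b1 : 0 < ask p q 1%R by rewrite /ask /two subrr m orbT.
  by rewrite /weight a0 a1; move: b0 b1; move: (ask _ _ _) (ask _ _ _); clear; lia.
- rewrite {n n0}E in m mf *.
  have a1 := ask_minor3_mid en m; have a2 := ask_minor3_end en m.
  have := ask_minor3_end (enum_flip 3%:Z%R en) (mf _ erefl).
  rewrite ask_flip two_flip (_ : (3%:Z - 1 - 2%:Z)%R = 0%R) // => a0.
  have -> : \sum_(t < 3) weight p q (t : nat)%:Z%R = weight p q 0%R + weight p q 1%R + weight p q 2%:Z%R.
    by rewrite !big_ord_recr big_ord0.
  have b1 : two p (~~ q) 0%R + two p (~~ q) 2%:Z%R <= ask p q 1%R.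
    by rewrite /ask /three subrr m leq_addl.
  rewrite /weight a0 a1 a2; move: b1; move: (ask _ _ _) (ask _ _ _) (ask _ _ _).
  by case: (two _ _ _); case: (two _ _ _); clear; lia.
- rewrite {n n0}E in m mf *.
  have -> : \sum_(t < 4) weight p q (t : nat)%:Z%R =
      weight p q 0%R + weight p q 1%R + weight p q 2%:Z%R + weight p q 3%:Z%R.
    by rewrite !big_ord_recr big_ord0.
  have r1 := ask_minor4_rest en m; have := ask_minor4_rest (enum_flip 4%:Z%R en) (mf _ erefl).
  rewrite !ask_flip (_ : (4%:Z - 1 - 1)%R = 2%:Z%R) //.
  rewrite (_ : (4%:Z - 1 - 2%:Z)%R = 1%R) // (_ : (4%:Z - 1 - 3%:Z)%R = 0%R) // => r2.
  have := @ask_le1 p q 4 0%R m isT isT; have := @ask_le1 p q 4 1%R m isT isT.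
  have := @ask_le1 p q 4 2%:Z%R m isT isT; have := @ask_le1 p q 4 3%:Z%R m isT isT.
  rewrite /weight; move: r1 r2; move: (ask p (~~ q) _) (ask p (~~ q) _) (ask p (~~ q) _) (ask p (~~ q) _).
  by move: (ask p q _) (ask p q _) (ask p q _) (ask p q _); clear; lia.
- rewrite {n n0}E in m mf *.
  have -> : \sum_(t < 5) weight p q (t : nat)%:Z%R =
      weight p q 0%R + weight p q 1%R + weight p q 2%:Z%R + weight p q 3%:Z%R + weight p q 4%:Z%R.
    by rewrite !big_ord_recr big_ord0.
  have some0 : [|| ask p (~~ q) 1%R == 0, ask p (~~ q) 2%:Z%R == 0 | ask p (~~ q) 3%:Z%R == 0].
    have [a2|a2] := posnP (ask p (~~ q) 2%:Z%R); first by rewrite orbT.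
    have : two p (~~ q) 2%:Z%R.
      by move: a2; rewrite /ask negbK !(minor_two m) // if_same addn0 lt0b.
    case/orP=> [m2|m1].
      have := @ask_minor5 (flip 5%:Z%R p) q (enum_flip _ en) (mf _ erefl).
      by rewrite minor_flip ask_flip (_ : (5%:Z - 1 - 3%:Z)%R = 1%R) // => /(_ m2) ->.
    by rewrite (ask_minor5 en m m1) !orbT.
  have := @ask_le1 p q 5 0%R m isT isT; have := @ask_le1 p q 5 1%R m isT isT.
  have := @ask_le1 p q 5 2%:Z%R m isT isT; have := @ask_le1 p q 5 3%:Z%R m isT isT.
  have := @ask_le1 p q 5 4%:Z%R m isT isT.
  rewrite /weight; move: some0; move: (ask p (~~ q) _) (ask p (~~ q) _) (ask p (~~ q) _) (ask p (~~ q) _).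
  move: (ask p (~~ q) _) => a4 a0 a1 a2 a3.
  by move: (ask p q _) (ask p q _) (ask p q _) (ask p q _) (ask p q _); clear; lia.
apply: (leq_trans n6); rewrite -[X in X <= _]card_ord -sum1_card leq_sum // => -[t tn] _ /=.
have tn' : (0 <= t%:Z < n%:Z)%R by move: tn; clear; lia.
have n2 : 2 < n by move: n6; clear; lia.
have := ask_le1 m n2 tn'; rewrite /weight.
by move: (ask _ _ _) (ask _ _ _) => x y; clear; lia.
Qed.

End MinorWeight.
Lemma minor_weight p q i n : 5 < c -> enum p -> 0 < n -> minor p q i n ->
  6 <= \sum_(t < n) weight p q (i + (t : nat)%:Z)%R.
Proof.
move=> c6 en n0 m.
have mf : minor (flip (i + n%:Z)%R p) q 0%R n.
  by rewrite minor_flip (_ : (_ - _ - _)%R = i) //; clear; lia.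
have := minor_weight0 c6 (enum_flip _ en) n0 mf; rewrite (reindex_inj rev_ord_inj) /=.
rewrite (eq_bigr (fun t : 'I_n => weight p q (i + (t : nat)%:Z)%R)) // => -[t tn] _.
by rewrite weight_flip; congr weight; rewrite /=; move: tn; clear; lia.
Qed.

Lemma weight_per p q i : enum p -> weight p q (i + c%:Z)%R = weight p q i.
Proof.
move=> en; have m q' j n : minor p q' (j + c%:Z)%R n = minor p q' j n.
  have E a : p (j + c%:Z + a)%R = p (j + a)%R by rewrite -(p_per en (j + a)%R); congr p; clear; lia.
  by rewrite /minor (p_per en) E; congr [&& _, _ & _]; apply: eq_forallb => a; rewrite E.
have sub j : (j + c%:Z - 1)%R = (j - 1 + c%:Z)%R by clear; lia.
have add j : (j + c%:Z + 1)%R = (j + 1 + c%:Z)%R by clear; lia.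
by rewrite /weight /ask /three !(add, sub) /two !(add, sub) !m.
Qed.

Definition charge p q i n := \sum_(t < n) weight p q (i + (t : nat)%:Z)%R.

Lemma charge_cat p q i n n' : charge p q i (n + n') = charge p q i n + charge p q (i + n%:Z)%R n'.
Proof.
rewrite /charge big_split_ord /=; congr (_ + _); apply: eq_bigr => t _.
by congr weight; rewrite /=; clear; lia.
Qed.

Definition inner p q i n := [set v | [&& v \notin s, sd v == q
  & [forall y, e v y ==> [exists t : 'I_n.+1, y == p (i + (t : nat)%:Z)%R]]]].

Lemma innerP p q i n v : reflect [/\ v \notin s, sd v = q
  & forall y, e v y -> exists2 j, (i <= j <= i + n%:Z)%R & y = p j] (v \in inner p q i n).
Proof.
rewrite in_set; apply: (iffP and3P) => -[vs].
  move=> /eqP sv /forallP nb; split=> // y ey; have /implyP/(_ ey)/existsP[[t tn] /eqP->] := nb y.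
  by exists (i + t%:Z)%R => //=; move: tn; clear; lia.
move=> sv nb; split=> //; first exact/eqP.
apply/forallP => y; apply/implyP => /nb[j ij ->].
have jn : `|(j - i)%R|%N < n.+1 by move: ij; clear; lia.
by apply/existsP; exists (Ordinal jn) => /=; apply/eqP; congr p; move: ij; clear; lia.
Qed.

Lemma three_positions p i n v : enum p -> n < c -> v \notin s ->
  (forall y, e v y -> exists2 j, (i <= j <= i + n%:Z)%R & y = p j) ->
  exists x1 x2 x3 : nat, [/\ x1 < x2, x2 < x3, x3 <= n & forall x : nat, x <= n ->
    e v (p (i + x%:Z)%R) = (x \in [:: x1; x2; x3])].
Proof.
move=> en nc vs nb; pose P (x : nat) := e v (p (i + x%:Z)%R).
pose L := filter P (iota 0 n.+1).
have mL (x : nat) : x <= n -> P x = (x \in L) by move=> xn; rewrite mem_filter mem_iota /= ltnS xn andbT.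
have Ln (x : nat) : x \in L -> x <= n by rewrite mem_filter mem_iota /= ltnS => /andP[].
have sL : sorted ltn L by apply: sorted_filter; [apply: ltn_trans | apply: iota_ltn_sorted].
have inj : {in L &, injective (fun x : nat => p (i + x%:Z)%R)}.
  move=> x y /Ln xn /Ln yn E; apply/eqP/negPn/negP => xy.
  case: (ltngtP x y) xy => // lt _.
    have := @p_inj p en (i + x%:Z)%R (i + y%:Z)%R; rewrite E eqxx.
    by move: lt yn nc; clear; lia.
  have := @p_inj p en (i + y%:Z)%R (i + x%:Z)%R; rewrite E eqxx.
  by move: lt xn nc; clear; lia.
have L3 : size L = 3.
  have [<- _] := oi_s.2 v vs; rewrite -(size_map (fun x : nat => p (i + x%:Z)%R)).
  rewrite -(card_uniqP _) ?map_inj_in_uniq //; last by rewrite filter_uniq ?iota_uniq.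
  apply: eq_card => y; rewrite in_set; apply/mapP/idP => [[x xL ->]|ey].
    by rewrite -[e _ _]/(P x) mL // Ln.
  have [j ij E] := nb y ey; exists `|(j - i)%R|%N; last first.
    by rewrite E; congr p; move: ij; clear; lia.
  rewrite -mL; last by move: ij; clear; lia.
  by rewrite /P (_ : (i + _)%R = j) -?E //; move: ij; clear; lia.
case EL : L L3 sL mL Ln => [|x1 [|x2 [|x3 []]]] //= _ /and3P[x12 x23 _] mL Ln.
exists x1, x2, x3; split=> //; apply: Ln; rewrite !inE eqxx !orbT //.
Qed.

(** * Summing the charge over nested segments *)

Section Charge.
Hypothesis c6 : 5 < c.
Hypothesis twin_free : forall v v', v \notin s -> v' \notin s -> nbrs v = nbrs v' -> v = v'.
Variables (p : int -> T) (q : bool).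
Hypothesis en : enum p.
Local Notation inner := (inner p q).
Local Notation charge := (charge p q).

Lemma inner_sub i n (x x' : nat) v : x <= x' -> v \in inner i n ->
  (forall t : nat, t <= n -> e v (p (i + t%:Z)%R) -> x <= t <= x') ->
  v \in inner (i + x%:Z)%R (x' - x).
Proof.
move=> xx' /innerP[vs sv nb] h; apply/innerP; split=> // y ey.
have [j ij E] := nb y ey; exists j => //.
have := h `|(j - i)%R|%N; rewrite (_ : (i + _)%R = j) -?E ?ey; last by move: ij; clear; lia.
by move=> /(_ _ isT); move: ij xx'; clear; lia.
Qed.

(** A gap of [v] without inner vertices is minor: an outer vertex attached inside it cannot cross
    [v], so it would be an inner vertex. *)
Lemma segment_charge i (x x' : nat) v : x < x' -> x' < x + c -> v \notin s -> sd v = q ->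
  e v (p (i + x%:Z)%R) -> e v (p (i + x'%:Z)%R) ->
  (forall t : nat, x < t < x' -> ~~ e v (p (i + t%:Z)%R)) ->
  let I := inner (i + x%:Z)%R (x' - x) in let W := charge (i + x%:Z)%R (x' - x) in
  (0 < #|I| -> 6 * #|I|.+1 <= W) -> 6 * #|I|.+1 <= W.
Proof.
move=> xx' x'c vs sv ex ex' no I W; have [I0 _|I0 h] := posnP #|I|; last exact: h.
rewrite I0 muln1; apply: minor_weight => //; first by rewrite subn_gt0.
have E : (i + x%:Z + (x' - x)%:Z)%R = (i + x'%:Z)%R by move: xx'; clear; lia.
apply/minorP; split; first by move: x'c xx'; clear; lia.
  by exists v; rewrite E.
rewrite E => j ij; apply/negP => /existsP[v' /and3P[vs' /eqP sv' ej]].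
have vv' : v != v'.
  apply: contraTneq ej => <-; have := no `|(j - i)%R|%N.
  by rewrite (_ : (i + _)%R = j) => [->//|]; move: ij; clear; lia.
have /eqP := I0; rewrite cards_eq0 => /eqP/setP/(_ v'); rewrite in_set0 => /negbT/negP; apply.
apply/innerP; split=> // y ey; have [_ on_s] := oi_s.2 v' vs'.
have [l [il El]] := p_cov en (i + x%:Z)%R (on_s y ey).
exists l => //; rewrite E; apply/andP; split; first by case/andP: il.
rewrite leNgt; apply/negP => lt; rewrite El in ey.
apply: (@cross_out _ en v v' (i + x%:Z)%R j (i + x'%:Z)%R l) => //; first by rewrite sv.
- by case/andP: ij.
- by case/andP: ij.
- by case/andP: il.
Qed.

Let arc_closed i (X X' Y Y' : nat) v v' : v \notin s -> v' \notin s -> v != v' -> sd v = sd v' ->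
  e v (p (i + X%:Z)%R) -> e v (p (i + X'%:Z)%R) ->
  e v' (p (i + Y%:Z)%R) -> e v' (p (i + Y'%:Z)%R) -> X' < c -> Y' < c ->
  X < Y -> Y < X' -> X <= Y' <= X'.
Proof.
move=> vs vs' vv' sv eX eX' eY eY' X'c Y'c XY YX'; apply/andP; split; rewrite leqNgt; apply/negP => lt.
  apply: (@cross_out _ en v' v (i + Y'%:Z)%R (i + X%:Z)%R (i + Y%:Z)%R (i + X'%:Z)%R) => //.
  - by rewrite eq_sym.
  - by move: lt; clear; lia.
  - by move: XY; clear; lia.
  - by move: YX'; clear; lia.
  - by move: X'c; clear; lia.
apply: (@cross_out _ en v v' (i + X%:Z)%R (i + Y%:Z)%R (i + X'%:Z)%R (i + Y'%:Z)%R) => //.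
- by move: XY; clear; lia.
- by move: YX'; clear; lia.
- by move: lt; clear; lia.
- by move: Y'c; clear; lia.
Qed.

Let positions_eq i n v v' (x1 x2 x3 : nat) : v \in inner i n -> v' \in inner i n ->
  (forall x : nat, x <= n -> e v (p (i + x%:Z)%R) = (x \in [:: x1; x2; x3])) ->
  (forall x : nat, x <= n -> e v' (p (i + x%:Z)%R) = (x \in [:: x1; x2; x3])) -> v = v'.
Proof.
move=> /innerP[vs _ nb] /innerP[vs' _ nb'] E E'; apply: twin_free => //.
have pos y j : (i <= j <= i + n%:Z)%R -> y = p j -> e v y = e v' y.
  move=> ij ->; have := E `|(j - i)%R|%N; have := E' `|(j - i)%R|%N.
  rewrite (_ : (i + _)%R = j); last by move: ij; clear; lia.
  by move=> -> => [->//|]; move: ij; clear; lia.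
apply/setP => y; rewrite !in_set; apply/idP/idP => ey.
  by have [j ij Ey] := nb y ey; rewrite -(pos y j).
by have [j ij Ey] := nb' y ey; rewrite (pos y j).
Qed.

(** Take an inner vertex of widest span. All others lie in its two gaps or on the two flanks. Each
    gap has six units more than its inner vertices need; one surplus pays for [v] and the other
    remains. *)
Lemma inner_charge n i : n < c -> 0 < #|inner i n| -> 6 * #|inner i n|.+1 <= charge i n.
Proof.
have [m] := ubnP n; elim: m n i => // m IHm n i; rewrite ltnS => le_nm nc /card_gt0P[v0 v0I].
pose P d := [exists v in inner i n, [exists x : 'I_n.+1,
  [&& e v (p (i + (x : nat)%:Z)%R), e v (p (i + (x + d)%:Z)%R) & x + d <= n]]].
have pos v : v \in inner i n -> exists x1 x2 x3 : nat, [/\ x1 < x2, x2 < x3, x3 <= n &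
    forall x : nat, x <= n -> e v (p (i + x%:Z)%R) = (x \in [:: x1; x2; x3])].
  by case/innerP=> vs _ nb; apply: three_positions.
have exP : exists d, P d.
  exists 0; apply/exists_inP; exists v0 => //; have [x1 [x2 [x3 [x12 x23 x3n E]]]] := pos v0 v0I.
  have x1n : x1 < n.+1 by move: x12 x23 x3n; clear; lia.
  by apply/existsP; exists (Ordinal x1n); rewrite /= addn0 E // mem_head.
have bP d : P d -> d <= n.
  by case/exists_inP=> v _ /existsP[x /and3P[_ _ h]]; apply: leq_trans h; apply: leq_addl.
case: (ex_maxnP exP bP) => d /exists_inP[v vI /existsP[[x xn] /and3P[/= ex exd xdn]]] maxd.
have [x1 [x2 [x3 [x12 x23 x3n E]]]] := pos v vI.
have dx : d <= x3 - x1.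
  move: ex exd; rewrite !E // !inE; move: x12 x23; clear; lia.
have {d ex exd xdn x xn dx} maxd v' (y z : nat) : v' \in inner i n -> y <= z -> z <= n ->
    e v' (p (i + y%:Z)%R) -> e v' (p (i + z%:Z)%R) -> z - y <= x3 - x1.
  move=> v'I yz zn ey ez; apply: leq_trans dx; apply: maxd; apply/exists_inP; exists v' => //.
  have yn : y < n.+1 by move: yz zn; clear; lia.
  by apply/existsP; exists (Ordinal yn); rewrite /= ey subnKC // ez zn.
have [vs sv _] := innerP _ _ _ _ _ vI.
have sub : inner i n \subset v |: (inner i x1 :|: inner (i + x1%:Z)%R (x2 - x1)
    :|: inner (i + x2%:Z)%R (x3 - x2) :|: inner (i + x3%:Z)%R (n - x3)).
  apply/subsetP => v' v'I; rewrite in_setU1; have [//|vv'] := eqVneq v' v.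
  have [y1 [y2 [y3 [y12 y23 y3n E']]]] := pos v' v'I; have [vs' sv' _] := innerP _ _ _ _ _ v'I.
  have part (X X' : nat) : X <= X' -> X <= y1 -> y3 <= X' -> v' \in inner (i + X%:Z)%R (X' - X).
    move=> XX' Xy yX'; apply: inner_sub v'I _ => // t tn; rewrite E' // !inE.
    by move: Xy yX' y12 y23; clear; lia.
  have [y1n y2n x1n x2n] : [/\ y1 <= n, y2 <= n, x1 <= n & x2 <= n].
    by split; move: x12 x23 x3n y12 y23 y3n; clear; lia.
  have leE (X : nat) : X \in [:: x1; x2; x3] -> X <= n by rewrite !inE => /or3P[]/eqP->.
  have leE' (Y : nat) : Y \in [:: y1; y2; y3] -> Y <= n by rewrite !inE => /or3P[]/eqP->.
  have span : y3 - y1 <= x3 - x1.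
    apply: (maxd v') => //; rewrite ?E' ?inE ?eqxx ?orbT //.
    by move: y12 y23; clear; lia.
  have arcs (X X' Y : nat) : X \in [:: x1; x2; x3] -> X' \in [:: x1; x2; x3] ->
      Y \in [:: y1; y2; y3] -> X < Y -> Y < X' -> (X <= y1) && (y3 <= X').
    move=> mX mX' mY XY YX'; have arc (Y' : nat) : Y' \in [:: y1; y2; y3] -> X <= Y' <= X'.
      move=> mY'; have eX : e v (p (i + X%:Z)%R) by rewrite E // leE.
      have eX' : e v (p (i + X'%:Z)%R) by rewrite E // leE.
      have eY : e v' (p (i + Y%:Z)%R) by rewrite E' // leE'.
      have eY' : e v' (p (i + Y'%:Z)%R) by rewrite E' // leE'.
      have nv : v != v' by rewrite eq_sym.
      have svv : sd v = sd v' by rewrite sv.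
      by apply: (arc_closed vs vs' nv svv eX eX' eY eY' _ _ XY YX'); apply: leq_ltn_trans nc;
        [apply: leE | apply: leE'].
    have /andP[-> _] := arc y1 (mem_head _ _).
    by have /andP[_ ->] : X <= y3 <= X' by apply: arc; rewrite !inE eqxx !orbT.
  have tw : ~~ [&& y1 == x1, y2 == x2 & y3 == x3].
    apply/negP => /and3P[/eqP Y1 /eqP Y2 /eqP Y3]; case/eqP: vv'.
    by apply: (positions_eq v'I vI E'); rewrite Y1 Y2 Y3.
  rewrite !in_setU; case/or4P: (triple_span x12 x23 y12 y23 span arcs tw) => [h|/andP[h h']|/andP[h h']|h].
  - by have := part 0 x1 (leq0n _) (leq0n _) h; rewrite addr0 subn0 => ->.
  - by rewrite (part x1 x2 (ltnW x12) h h') orbT.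
  - by rewrite (part x2 x3 (ltnW x23) h h') orbT.
  - by rewrite (part x3 n x3n h y3n) !orbT.
have seg (x x' : nat) : x < x' -> x' <= n -> x' - x < n ->
    x \in [:: x1; x2; x3] -> x' \in [:: x1; x2; x3] ->
    (forall t : nat, x < t < x' -> t \notin [:: x1; x2; x3]) ->
    6 * #|inner (i + x%:Z)%R (x' - x)|.+1 <= charge (i + x%:Z)%R (x' - x).
  move=> xx' x'n lt mx mx' no; apply: (@segment_charge i x x' v) => //.
  - by move: x'n nc; clear; lia.
  - by rewrite E //; move: xx' x'n; clear; lia.
  - by rewrite E.
  - by move=> t xt; rewrite E ?no //; move: xt x'n; clear; lia.
  by apply: IHm; [apply: leq_trans lt le_nm | apply: ltn_trans lt nc].
have side j (k : nat) : k < n -> 6 * #|inner j k| <= charge j k.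
  move=> kn; have [->|I0] := posnP #|inner j k|; first by rewrite muln0.
  apply: leq_trans (IHm k j _ _ I0); first by rewrite leq_mul2l leqnSn.
    exact: leq_trans kn le_nm.
  exact: ltn_trans kn nc.
have s1 : 6 * #|inner i x1| <= charge i x1 by apply: side; move: x12 x23 x3n; clear; lia.
have s4 : 6 * #|inner (i + x3%:Z)%R (n - x3)| <= charge (i + x3%:Z)%R (n - x3).
  by apply: side; move: x12 x23 x3n; clear; lia.
have s2 : 6 * #|inner (i + x1%:Z)%R (x2 - x1)|.+1 <= charge (i + x1%:Z)%R (x2 - x1).
  apply: seg => //; rewrite ?inE ?eqxx ?orbT //; try by move: x12 x23 x3n; clear; lia.
  by move=> t; rewrite !inE; move: x23; clear; lia.
have s3 : 6 * #|inner (i + x2%:Z)%R (x3 - x2)|.+1 <= charge (i + x2%:Z)%R (x3 - x2).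
  apply: seg => //; rewrite ?inE ?eqxx ?orbT //; try by move: x12 x23 x3n; clear; lia.
  by move=> t; rewrite !inE; move: x12; clear; lia.
have EW : charge i n = charge i x1 + charge (i + x1%:Z)%R (x2 - x1)
    + charge (i + x2%:Z)%R (x3 - x2) + charge (i + x3%:Z)%R (n - x3).
  have -> : n = x1 + (x2 - x1) + (x3 - x2) + (n - x3) by move: x12 x23 x3n; clear; lia.
  rewrite !charge_cat; congr (_ + charge _ _ + charge _ _ + charge _ _); move: x12 x23 x3n; clear; lia.
have cardle : #|inner i n| <= 1 + (#|inner i x1| + #|inner (i + x1%:Z)%R (x2 - x1)|
    + #|inner (i + x2%:Z)%R (x3 - x2)| + #|inner (i + x3%:Z)%R (n - x3)|).
  apply: leq_trans (subset_leq_card sub) _; apply: leq_trans (leq_card_setU _ _) _.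
  rewrite cards1 leq_add2l; apply: leq_trans (leq_card_setU _ _) _; rewrite leq_add2r.
  by apply: leq_trans (leq_card_setU _ _) _; rewrite leq_add2r; apply: leq_card_setU.
move: s1 s2 s3 s4 cardle; rewrite EW.
move: (charge i x1) (charge _ _) (charge _ _) (charge _ _) => w1 w2 w3 w4.
move: #|inner i n| #|inner i x1| #|inner _ (x2 - x1)| #|inner _ (x3 - x2)| #|inner _ (n - x3)|.
by clear; lia.
Qed.

(** The stretch of [m + c] edges from [0] is summed in two ways, and the weights have period [c]. *)
Lemma charge_rot (m : nat) : charge m%:Z%R c = charge 0%R c.
Proof.
have := charge_cat p q 0%R m c; rewrite addnC charge_cat !add0r addnC => /eqP.
suff -> : charge c%:Z%R m = charge 0%R m by rewrite eqn_add2l => /eqP.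
by apply: eq_bigr => t _; rewrite add0r addrC weight_per.
Qed.

Let side_set := [set v | (v \notin s) && (sd v == q)].

(** Around the cycle [v] has three gaps and no flanks: one surplus of six pays for [v], and two
    remain. *)
Lemma side_charge : 0 < #|side_set| -> 6 * (#|side_set| + 2) <= charge 0%R c.
Proof.
case/card_gt0P=> v; rewrite in_set => /andP[vs /eqP sv].
have [d3 on_s] := oi_s.2 v vs.
have /card_gt0P[y0] : 0 < #|nbrs v| by rewrite d3.
rewrite in_set => ey0; have [i0 [i0c Ey0]] := p_cov en 0%R (on_s y0 ey0).
have [m Ei0] : exists m : nat, i0 = m%:Z%R by exists `|i0|%N; move: i0c; clear; lia.
(* The count is started at a neighbour of [v], which makes its first position [0]. *)
rewrite -(charge_rot m); move: ey0; rewrite Ey0 Ei0 {i0 i0c Ey0 Ei0}; move: (m%:Z%R) => i ei.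
have c1 : c.-1 < c by move: c6; clear; lia.
have in_all v' : v' \notin s -> sd v' = q -> v' \in inner i c.-1.
  move=> vs' sv'; apply/innerP; split=> // y ey; have [_ on_s'] := oi_s.2 v' vs'.
  have [j [ij ->]] := p_cov en i (on_s' y ey); exists j => //.
  by move: ij c6; clear; lia.
have pos v' : v' \in inner i c.-1 -> exists x1 x2 x3 : nat, [/\ x1 < x2, x2 < x3, x3 <= c.-1 &
    forall x : nat, x <= c.-1 -> e v' (p (i + x%:Z)%R) = (x \in [:: x1; x2; x3])].
  by case/innerP=> vs' _ nb; apply: three_positions.
have vI := in_all v vs sv.
have [x1 [x2 [x3 [x12 x23 x3n E]]]] := pos v vI.
have x10 : x1 = 0.
  by have := E 0 (leq0n _); rewrite addr0 ei !inE; move: x12 x23; clear; lia.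
rewrite {}x10 in x12 E.
have leE (X : nat) : X \in [:: 0; x2; x3] -> X <= c.-1.
  by rewrite !inE => /or3P[]/eqP-> //; apply: leq_trans x3n; apply: ltnW.
have sub : side_set \subset v |: (inner i x2 :|: inner (i + x2%:Z)%R (x3 - x2)
    :|: inner (i + x3%:Z)%R (c - x3)).
  apply/subsetP => v'; rewrite in_set => /andP[vs' /eqP sv'].
  rewrite in_setU1; have [//|vv'] := eqVneq v' v.
  have v'I := in_all v' vs' sv'; have [y1 [y2 [y3 [y12 y23 y3n E']]]] := pos v' v'I.
  have leE' (Y : nat) : Y \in [:: y1; y2; y3] -> Y <= c.-1.
    by rewrite !inE => /or3P[]/eqP->; move: y12 y23 y3n; clear; lia.
  have part (X X' : nat) : X <= X' -> X <= y1 -> y3 <= X' -> v' \in inner (i + X%:Z)%R (X' - X).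
    move=> XX' Xy yX'; apply: inner_sub v'I _ => // t tn; rewrite E' // !inE.
    by move: Xy yX' y12 y23; clear; lia.
  have arcs (X X' Y : nat) : X \in [:: 0; x2; x3] -> X' \in [:: 0; x2; x3] ->
      Y \in [:: y1; y2; y3] -> X < Y -> Y < X' -> (X <= y1) && (y3 <= X').
    move=> mX mX' mY XY YX'; have arc (Y' : nat) : Y' \in [:: y1; y2; y3] -> X <= Y' <= X'.
      move=> mY'; have eX : e v (p (i + X%:Z)%R) by rewrite E // leE.
      have eX' : e v (p (i + X'%:Z)%R) by rewrite E // leE.
      have eY : e v' (p (i + Y%:Z)%R) by rewrite E' // leE'.
      have eY' : e v' (p (i + Y'%:Z)%R) by rewrite E' // leE'.
      have nv : v != v' by rewrite eq_sym.
      have svv : sd v = sd v' by rewrite sv.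
      by apply: (arc_closed vs vs' nv svv eX eX' eY eY' _ _ XY YX'); apply: leq_ltn_trans c1;
        [apply: leE | apply: leE'].
    have /andP[-> _] := arc y1 (mem_head _ _).
    by have /andP[_ ->] : X <= y3 <= X' by apply: arc; rewrite !inE eqxx !orbT.
  have tw : ~~ [&& y1 == 0, y2 == x2 & y3 == x3].
    apply/negP => /and3P[/eqP Y1 /eqP Y2 /eqP Y3]; case/eqP: vv'.
    by apply: (positions_eq v'I vI E'); rewrite Y1 Y2 Y3.
  rewrite !in_setU; case/or3P: (triple_ring x12 x23 y12 y23 arcs tw) => [h|/andP[h h']|/andP[h h']].
  - by have := part 0 x2 (leq0n _) (leq0n _) h; rewrite addr0 subn0 => ->.
  - by rewrite (part x2 x3 (ltnW x23) h h') orbT.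
  suff -> : v' \in inner (i + x3%:Z)%R (c - x3) by rewrite !orbT.
  have [_ _ nb] := innerP _ _ _ _ _ v'I.
  apply/innerP; split=> // y ey; have [j ij Ey] := nb y ey.
  have := E' `|(j - i)%R|%N; rewrite (_ : (i + _)%R = j); last by move: ij; clear; lia.
  rewrite -Ey ey => jE.
  (* A neighbour at the start counts as the end [i + c] of the last gap. *)
  have [ji|ji] := eqVneq j i.
    by exists (i + c%:Z)%R; rewrite ?(p_per en) -?ji //; move: x3n c1; clear; lia.
  have jy : `|(j - i)%R|%N \in [:: y1; y2; y3] by rewrite -jE //; move: ij; clear; lia.
  exists j => //; move: jy; rewrite !inE.
  by move: ij ji h h' c1 y12 y23; clear; lia.
have seg (x x' : nat) : x < x' -> x' - x < c -> e v (p (i + x%:Z)%R) -> e v (p (i + x'%:Z)%R) ->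
    (forall t : nat, x < t < x' -> ~~ e v (p (i + t%:Z)%R)) ->
    6 * #|inner (i + x%:Z)%R (x' - x)|.+1 <= charge (i + x%:Z)%R (x' - x).
  move=> xx' lt ex ex' no; apply: (@segment_charge i x x' v) => //.
    by move: xx' lt; clear; lia.
  exact: inner_charge.
have s2 : 6 * #|inner (i + x2%:Z)%R (x3 - x2)|.+1 <= charge (i + x2%:Z)%R (x3 - x2).
  apply: seg; rewrite ?E ?leE ?inE ?eqxx ?orbT //; first by move: x12 x23 x3n c1; clear; lia.
  by move=> t xt; rewrite E ?inE; move: xt x12 x3n; clear; lia.
have s1 : 6 * #|inner i x2|.+1 <= charge i x2.
  have := @seg 0 x2; rewrite addr0 subn0; apply; rewrite ?E ?leE ?inE ?eqxx ?orbT //.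
    by move: x12 x23 x3n c1; clear; lia.
  by move=> t xt; rewrite E ?inE; move: xt x23 x3n; clear; lia.
have s3 : 6 * #|inner (i + x3%:Z)%R (c - x3)|.+1 <= charge (i + x3%:Z)%R (c - x3).
  apply: seg; rewrite ?(p_per en) // ?E ?leE ?inE ?eqxx ?orbT //.
  - by move: x3n c1; clear; lia.
  - by move: x12 x23 c1; clear; lia.
  by move=> t xt; rewrite E ?inE; move: xt x12 x23 c1; clear; lia.
have EW : charge i c = charge i x2 + charge (i + x2%:Z)%R (x3 - x2) + charge (i + x3%:Z)%R (c - x3).
  have {1}-> : c = x2 + (x3 - x2) + (c - x3) by move: x12 x23 x3n c1; clear; lia.
  by rewrite !charge_cat; congr (_ + charge _ _ + charge _ _); move: x12 x23 x3n; clear; lia.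
have cardle : #|side_set| <= 1 + (#|inner i x2| + #|inner (i + x2%:Z)%R (x3 - x2)|
    + #|inner (i + x3%:Z)%R (c - x3)|).
  apply: leq_trans (subset_leq_card sub) _; apply: leq_trans (leq_card_setU _ _) _.
  rewrite cards1 leq_add2l; apply: leq_trans (leq_card_setU _ _) _; rewrite leq_add2r.
  exact: leq_card_setU.
move: s1 s2 s3 cardle; rewrite EW.
move: (charge i x2) (charge _ _) (charge _ _) => w1 w2 w3.
move: #|side_set| #|inner i x2| #|inner _ (x3 - x2)| #|inner _ (c - x3)|.
by clear; lia.
Qed.

End Charge.
(** The three neighbours of an outer vertex are pairwise non-consecutive on the cycle. *)
Lemma outer_size v : v \notin s -> 5 < c.
Proof.
move=> vs; have [p en] := enum_exists; have [cy _] := oi_s.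
have c2 : 2 < c by case/andP: cy.
have c1 : c.-1 < c by move: c2; clear; lia.
have [|x1 [x2 [x3 [x12 x23 x3n E]]]] := three_positions en (i := 0%R) c1 vs.
  move=> y ey; have [j [ij ->]] := p_cov en 0%R ((oi_s.2 v vs).2 y ey).
  by exists j => //; move: ij c2; clear; lia.
have ev (x : nat) : x \in [:: x1; x2; x3] -> e v (p x%:Z%R).
  move=> mx; have := E x; rewrite add0r mx; apply.
  by move: mx; rewrite !inE; move: x12 x23 x3n; clear; lia.
have e1 := ev x1 (mem_head _ _).
have e2 : e v (p x2%:Z%R) by apply: ev; rewrite !inE eqxx orbT.
have e3 : e v (p x3%:Z%R) by apply: ev; rewrite !inE eqxx !orbT.
have e4 : e v (p (x1%:Z + c%:Z)%R) by rewrite (p_per en).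
have n12 : (x2%:Z)%R <> (x1%:Z + 1)%R by move=> E12; apply: (out_not_adjacent en E12 vs e1 e2).
have n23 : (x3%:Z)%R <> (x2%:Z + 1)%R by move=> E23; apply: (out_not_adjacent en E23 vs e2 e3).
have n31 : (x1%:Z + c%:Z)%R <> (x3%:Z + 1)%R.
  by move=> E31; apply: (out_not_adjacent en E31 vs e3 e4).
by move: x12 x23 x3n n12 n23 n31 c2; clear; lia.
Qed.

(** One side with outer vertices suffices for the surplus of twelve; an empty side contributes a
    charge of at least zero. *)
Lemma longest_oi3_bound : 2 < #|T| ->
  (5 < #|T| -> forall v v', #|nbrs v| = 3 -> nbrs v = nbrs v' -> v = v') ->
  3 * (#|T| + 2) <= 5 * c.
Proof.
move=> T3 twin; have [/and3P[_ us _] out_s] := oi_s; have cT : c <= #|T|.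
  by rewrite -(card_uniqP us) max_card.
have [/forallP all_s|/forallPn[v vs]] := boolP [forall v, v \in s].
  have : #|T| <= c by rewrite -(card_uniqP us); apply: subset_leq_card; apply/subsetP.
  by move: T3 cT; clear; lia.
have c6 := outer_size vs; have [p en] := enum_exists.
have twin_free x y : x \notin s -> y \notin s -> nbrs x = nbrs y -> x = y.
  by move=> xs _; apply: (twin (leq_trans c6 cT)); case: (out_s x xs).
pose n q := #|[set v | (v \notin s) && (sd v == q)]|.
have side q : 0 < n q -> 6 * (n q + 2) <= charge p q 0%R c.
  exact: (side_charge c6 twin_free en).
have total : charge p true 0%R c + charge p false 0%R c = 4 * c.
  rewrite /charge -big_split (eq_bigr (fun _ => 4)) /=; first by rewrite sum_nat_const card_ord mulnC.
  by move=> t _; apply: weight_sides.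
have cardT : #|T| <= c + (n true + n false).
  have sub : [set: T] \subset [set x in s] :|: ([set v | (v \notin s) && (sd v == true)]
      :|: [set v | (v \notin s) && (sd v == false)]).
    apply/subsetP => x _; rewrite !in_setU !in_set.
    by case: (x \in s); case: (sd x).
  have := subset_leq_card sub; rewrite cardsT => h; apply: leq_trans h _.
  apply: leq_trans (leq_card_setU _ _) _; rewrite cardsE (card_uniqP us) leq_add2l.
  exact: leq_card_setU.
have pos : 0 < n (sd v) by apply/card_gt0P; exists v; rewrite in_set vs eqxx.
have {pos} pos : (0 < n true) || (0 < n false) by move: pos; case: (sd v) => ->; rewrite ?orbT.
have := side true; have := side false; move: total cardT pos.
move: (charge _ _ _ _) (charge _ _ _ _) => w w'; move: (n true) (n false) #|T| c.
by clear; lia.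
Qed.

End Discharging.

Theorem mainTheorem1 (T : finType) (e : rel T) :
  simple_graph e -> planar e -> essentially_4_connected e ->
  exists s : seq T, is_graph_cycle e s /\ 3 * (#|T| + 2) <= 5 * size s.
Proof.
move=> simpl pl ess; have tri : three_connected e by case: ess.
have [rho G] := planar_plane simpl tri pl.
have [s0 [[oi_s0 _]|good]] := oi3_exists simpl ess G; last by exists s0.
(* A Boolean form of [oi3], so that a cycle of greatest length can be picked. *)
pose oi3b s := is_graph_cycle e s && [forall x, (x \notin s) ==>
  (#|[set y | e x y]| == 3) && [forall y, e x y ==> (y \in s)]].
have oi3P s : reflect (oi3 e s) (oi3b s).
  apply: (iffP andP) => -[cy].
    move=> /forallP h; split=> // x xs; have /implyP/(_ xs)/andP[/eqP d3 /forallP hy] := h x.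
    by split=> // y exy; apply: (implyP (hy y)).
  move=> h; split=> //; apply/forallP => x; apply/implyP => /h[-> hy]; rewrite eqxx.
  by apply/forallP => y; apply/implyP; apply: hy.
pose P n := [exists t : n.-tuple T, oi3b t].
have exP : exists n, P n.
  by exists (size s0); apply/existsP; exists (in_tuple s0); apply/oi3P.
have bP n : P n -> n <= #|T|.
  case/existsP=> t /andP[/and3P[_ ut _] _].
  by rewrite -{1}(size_tuple t) -(card_uniqP ut) max_card.
case: (ex_maxnP exP bP) => n /existsP[s /oi3P oi_s] max_n; exists s; split; first by case: oi_s.
have [f fs] : exists f, is_bd e rho f s by apply: cycle_bd; case: oi_s => /and3P[].
have max_s s' : oi3 e s' -> size s' <= size s.
  move=> /oi3P oi_s'; rewrite size_tuple; apply: max_n.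
  by apply/existsP; exists (in_tuple s').
apply: (longest_oi3_bound G (degree_ge3 simpl tri) oi_s fs max_s).
  by have [T4 _] := tri; apply: ltnW.
by move=> T6 v v'; apply: (twins ess G).
Qed.
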